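(* Let $A$ be a $\sigma$-unital $C^*$-algebra, let $G$ be a second-countable compact group, and let $\alpha\colon G\to\mathrm{Aut}(A)$ be an action with the Rokhlin property. (1) If $A$ has real rank zero, then so do $A^\alpha$ and $A\rtimes_\alpha G$. (2) If $A$ has stable rank one, then so do $A^\alpha$ and $A\rtimes_\alpha G$.
   Context: A unital $C^*$-algebra has real rank zero if its invertible self-adjoint elements are dense in its self-adjoint elements, and stable rank one if its invertible elements are dense. A non-unital $C^*$-algebra has one of these properties if its unitization does. Conventions: homomorphisms between $C^*$-algebras are $*$-homomorphisms, subalgebras are $C^*$-subalgebras; actions on $C^*$-algebras are point-norm continuous; $A^\alpha$ is the fixed point algebra and $A\rtimes_\alpha G$ the crossed product. Sequence algebras: for a $C^*$-algebra $A$, let $\ell^\infty(\mathbb{N},A)$ be the $C^*$-algebra of bounded sequences in $A$, $c_0(\mathbb{N},A)$ the ideal of norm-null sequences, $A_\infty=\ell^\infty(\mathbb{N},A)/c_0(\mathbb{N},A)$ with quotient map $\eta_A$; $A$ sits in $A_\infty$ as constant sequences. For a subalgebra $D\subseteq A$, let $\mathrm{Ann}(D,A_\infty)$ be the annihilator of $D$ in $A_\infty$, an ideal of $A_\infty\cap D'$, let $F(D,A)=(A_\infty\cap D')/\mathrm{Ann}(D,A_\infty)$ and let $\kappa_{D,A}$ be the quotient map. If $\alpha\colon G\to\mathrm{Aut}(A)$ is an action and $D$ is $\alpha$-invariant, entrywise application of $\alpha$ gives actions (not necessarily continuous) $\alpha^\infty$ on $\ell^\infty(\mathbb{N},A)$,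 $\alpha_\infty$ on $A_\infty$ and on $A_\infty\cap D'$, and $F(\alpha)$ on $F(D,A)$. Let $\ell^\infty_\alpha(\mathbb{N},A)$ be the set of $a\in\ell^\infty(\mathbb{N},A)$ with $g\mapsto\alpha^\infty_g(a)$ norm continuous, $A_{\infty,\alpha}=\eta_A(\ell^\infty_\alpha(\mathbb{N},A))$ and $F_\alpha(D,A)=\kappa_{D,A}(A_{\infty,\alpha}\cap D')$. Rokhlin property: an action $\alpha\colon G\to\mathrm{Aut}(A)$ of a second-countable compact group $G$ on a $\sigma$-unital $C^*$-algebra $A$ has the Rokhlin property if for every separable $\alpha$-invariant subalgebra $D\subseteq A$ there is an equivariant unital homomorphism $\varphi\colon(C(G),\mathtt{Lt})\to(F_\alpha(D,A),F(\alpha))$, where $\mathtt{Lt}$ is the action of $G$ on $C(G)$ induced by left translation. *)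

(* Defs.v *)
From HB Require Import structures.
From mathcomp Require Import all_boot all_order all_algebra generic_quotient ring_quotient.
From mathcomp Require Import complex.
From mathcomp Require Import all_classical all_reals all_analysis.

Set Implicit Arguments.
Unset Strict Implicit.
Unset Printing Implicit Defensive.

Import Order.TTheory GRing.Theory Num.Theory.
Import numFieldNormedType.Exports.

Local Open Scope classical_set_scope.
Local Open Scope quotient_scope.
Local Open Scope ring_scope.

HB.mixin Record Lmodule_isStarAlg (R : realType) A & GRing.Lmodule R[i] A := {
  amul : A -> A -> A;
  star : A -> A;
  amulA : associative amul;
  amulDl : left_distributive amul +%R;
  amulDr : right_distributive amul +%R;
  amulZl : forall (c : R[i]) a b, amul (c *: a) b = c *: amul a b;
  amulZr : forall (c : R[i]) a b, amul a (c *: b) = c *: amul a b;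
  starK : involutive star;
  starD : {morph star : a b / a + b};
  starZ : forall (c : R[i]) a, star (c *: a) = (Num.conj c) *: star a;
  starM : forall a b, star (amul a b) = amul (star b) (star a)
}.

#[short(type="starAlgType")]
HB.structure Definition StarAlg (R : realType) :=
  {A of GRing.Lmodule R[i] A & Lmodule_isStarAlg R A}.

Notation "a ** b" := (amul a b) (at level 40, left associativity).

#[short(type="normedStarAlgType")]
HB.structure Definition NormedStarAlg (R : realType) :=
  {A of StarAlg R A & NormedModule R[i] A}.

HB.mixin Record NormedStarAlg_isCStar (R : realType) A & NormedStarAlg R A := {
  normM_le : forall a b : A, `|a ** b| <= `|a| * `|b|;
  norm_star_mul : forall a : A, `|star a ** a| = `|a| ^+ 2
}.

#[short(type="cstarAlgType")]
HB.structure Definition CStarAlg (R : realType) :=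
  {A of NormedStarAlg R A & CompleteNormedModule R[i] A & NormedStarAlg_isCStar R A}.

Section StarAlgTheory.
Variables (R : realType) (A : starAlgType R).
Implicit Types a b : A.

Lemma amul0r a : 0 ** a = 0.
Proof. by rewrite -[X in X ** _](scale0r (0 : A)) amulZl scale0r. Qed.

Lemma amulr0 a : a ** 0 = 0.
Proof. by rewrite -[X in _ ** X](scale0r (0 : A)) amulZr scale0r. Qed.

Lemma amulNl a b : (- a) ** b = - (a ** b).
Proof. by rewrite -scaleN1r amulZl scaleN1r. Qed.

Lemma amulNr a b : a ** (- b) = - (a ** b).
Proof. by rewrite -scaleN1r amulZr scaleN1r. Qed.

Lemma star0 : star (0 : A) = 0.
Proof. by apply: (addrI (star 0)); rewrite -starD !addr0. Qed.

Lemma starN a : star (- a) = - star a.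
Proof. by apply: (addrI (star a)); rewrite -starD !subrr star0. Qed.

End StarAlgTheory.

HB.instance Definition _ (R : realType) := Lmodule_isStarAlg.Build R R[i]^o
  (@mulrA R[i]) (@mulrDl R[i]) (@mulrDr R[i])
  (fun c a b => esym (mulrA c a b)) (fun c a b => mulrCA a c b)
  (@conjCK R[i]) (@rmorphD _ _ (@Num.conj R[i])) (@rmorphM _ _ (@Num.conj R[i]))
  (fun a b => etrans (rmorphM (@Num.conj R[i]) a b) (mulrC _ _)).

Section FunStarAlg.
Variables (R : realType) (T : Type) (A : starAlgType R).
Implicit Types a b c : T -> A.

Definition fun_amul a b : T -> A := fun t => a t ** b t.
Definition fun_star a : T -> A := fun t => star (a t).

Fact fun_amulA : associative fun_amul.
Proof. by move=> a b c; apply/funext => t; apply: amulA. Qed.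
Fact fun_amulDl : left_distributive fun_amul +%R.
Proof. by move=> a b c; apply/funext => t; apply: amulDl. Qed.
Fact fun_amulDr : right_distributive fun_amul +%R.
Proof. by move=> a b c; apply/funext => t; apply: amulDr. Qed.
Fact fun_amulZl (k : R[i]) a b : fun_amul (k *: a) b = k *: fun_amul a b.
Proof. by apply/funext => t; apply: amulZl. Qed.
Fact fun_amulZr (k : R[i]) a b : fun_amul a (k *: b) = k *: fun_amul a b.
Proof. by apply/funext => t; apply: amulZr. Qed.
Fact fun_starK : involutive fun_star.
Proof. by move=> a; apply/funext => t; apply: starK. Qed.
Fact fun_starD : {morph fun_star : a b / a + b}.
Proof. by move=> a b; apply/funext => t; apply: starD. Qed.
Fact fun_starZ (k : R[i]) a : fun_star (k *: a) = (Num.conj k) *: fun_star a.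
Proof. by apply/funext => t; apply: starZ. Qed.
Fact fun_starM a b : fun_star (fun_amul a b) = fun_amul (fun_star b) (fun_star a).
Proof. by apply/funext => t; apply: starM. Qed.

HB.instance Definition _ := Lmodule_isStarAlg.Build R (T -> A)
  fun_amulA fun_amulDl fun_amulDr fun_amulZl fun_amulZr
  fun_starK fun_starD fun_starZ fun_starM.

End FunStarAlg.

Record starSubalg (R : realType) (U : starAlgType R) := StarSubalg {
  sset : set U;
  subalg0 : sset 0;
  subalgD : forall a b, sset a -> sset b -> sset (a + b);
  subalgZ : forall (c : R[i]) a, sset a -> sset (c *: a);
  subalgM : forall a b, sset a -> sset b -> sset (a ** b);
  subalg_star : forall a, sset a -> sset (star a)
}.

Definition subalg_pred (R : realType) (U : starAlgType R) (S : starSubalg U) : {pred U} :=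
  fun x => x \in sset S.

Section Subalgebra.
Variables (R : realType) (U : starAlgType R) (S : starSubalg U).

Fact subalg_pred_submod : submod_closed (subalg_pred S).
Proof.
split; first by rewrite inE; apply: subalg0.
by move=> c a b; rewrite !inE => Sa Sb; apply: subalgD => //; apply: subalgZ.
Qed.

HB.instance Definition _ :=
  GRing.isSubmodClosed.Build R[i] U (subalg_pred S) subalg_pred_submod.

Definition subalg_type := {x : U | subalg_pred S x}.
HB.instance Definition _ := SubChoice.on subalg_type.
HB.instance Definition _ := [SubChoice_isSubLmodule of subalg_type by <:].

Implicit Types a b c : subalg_type.

Lemma subalg_valP a : sset S (val a).
Proof. exact: set_mem (valP a). Qed.

Definition mk_subalg (x : U) (Sx : sset S x) : subalg_type := exist _ x (mem_set Sx).

Definition sub_amul a b := mk_subalg (subalgM (subalg_valP a) (subalg_valP b)).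
Definition sub_star a := mk_subalg (subalg_star (subalg_valP a)).

Fact sub_amulA : associative sub_amul.
Proof. by move=> a b c; apply: val_inj; apply: amulA. Qed.
Fact sub_amulDl : left_distributive sub_amul +%R.
Proof. by move=> a b c; apply: val_inj; apply: amulDl. Qed.
Fact sub_amulDr : right_distributive sub_amul +%R.
Proof. by move=> a b c; apply: val_inj; apply: amulDr. Qed.
Fact sub_amulZl (k : R[i]) a b : sub_amul (k *: a) b = k *: sub_amul a b.
Proof. by apply: val_inj; apply: amulZl. Qed.
Fact sub_amulZr (k : R[i]) a b : sub_amul a (k *: b) = k *: sub_amul a b.
Proof. by apply: val_inj; apply: amulZr. Qed.
Fact sub_starK : involutive sub_star.
Proof. by move=> a; apply: val_inj; apply: starK. Qed.
Fact sub_starD : {morph sub_star : a b / a + b}.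
Proof. by move=> a b; apply: val_inj; apply: starD. Qed.
Fact sub_starZ (k : R[i]) a : sub_star (k *: a) = (Num.conj k) *: sub_star a.
Proof. by apply: val_inj; apply: starZ. Qed.
Fact sub_starM a b : sub_star (sub_amul a b) = sub_amul (sub_star b) (sub_star a).
Proof. by apply: val_inj; apply: starM. Qed.

HB.instance Definition _ := Lmodule_isStarAlg.Build R subalg_type
  sub_amulA sub_amulDl sub_amulDr sub_amulZl sub_amulZr
  sub_starK sub_starD sub_starZ sub_starM.

(* Agrees with [f] wherever [f] stays in [S], and is [0] elsewhere. *)
Definition subalg_map (f : U -> U) (x : subalg_type) : subalg_type :=
  insubd (0 : subalg_type) (f (val x)).

End Subalgebra.

Section NormedSubalgebra.
Variables (R : realType) (A : normedStarAlgType R) (S : starSubalg A).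

HB.instance Definition _ := Lmodule_isNormed.Build R[i] (subalg_type S)
  (fun a b => ler_normD (val a) (val b))
  (fun k a => normrZ k (val a))
  (fun a (a0 : `|val a| = 0) => val_inj (normr0_eq0 a0 : val a = val (0 : subalg_type S))).

End NormedSubalgebra.

Record starIdeal (R : realType) (U : starAlgType R) := StarIdeal {
  iset : set U;
  ideal0 : iset 0;
  idealD : forall a b, iset a -> iset b -> iset (a + b);
  idealZ : forall (c : R[i]) a, iset a -> iset (c *: a);
  idealMl : forall a b, iset b -> iset (a ** b);
  idealMr : forall a b, iset a -> iset (a ** b);
  ideal_star : forall a, iset a -> iset (star a)
}.

Definition ideal_pred (R : realType) (U : starAlgType R) (J : starIdeal U) : {pred U} :=
  fun x => x \in iset J.

Section Quotient.
Variables (R : realType) (U : starAlgType R) (J : starIdeal U).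

Fact ideal_pred_zmod : zmod_closed (ideal_pred J).
Proof.
split; first by rewrite inE; apply: ideal0.
move=> a b; rewrite !inE => Ja Jb; apply: idealD => //.
by rewrite -scaleN1r; apply: idealZ.
Qed.

HB.instance Definition _ := GRing.isZmodClosed.Build U (ideal_pred J) ideal_pred_zmod.

Definition quot_type :=
  Quotient.quot (GRing.ZmodClosed.clone U (ideal_pred J) _).
HB.instance Definition _ := EqQuotient.on quot_type.
HB.instance Definition _ := GRing.Zmodule.on quot_type.

Definition quot_pi (x : U) : quot_type := \pi_quot_type x.

Lemma quot_eqP x y : quot_pi x = quot_pi y <-> iset J (x - y).
Proof.
rewrite /quot_pi; split=> [/eqP|Jxy].
  by rewrite -Quotient.idealrBE => /set_mem.
by apply/eqP; rewrite -Quotient.idealrBE; apply: mem_set.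
Qed.

Lemma quot_piK (u : quot_type) : quot_pi (repr u) = u.
Proof. exact: reprK. Qed.

Lemma quot_piD x y : quot_pi (x + y) = quot_pi x + quot_pi y.
Proof. exact: (raddfD \pi_quot_type). Qed.

Definition quot_scale (k : R[i]) (u : quot_type) := quot_pi (k *: repr u).
Definition quot_amul (u v : quot_type) := quot_pi (repr u ** repr v).
Definition quot_star (u : quot_type) := quot_pi (star (repr u)).

Lemma quot_reprB x : iset J (repr (quot_pi x) - x).
Proof. by apply/quot_eqP; rewrite quot_piK. Qed.

Lemma quot_piZ k x : quot_scale k (quot_pi x) = quot_pi (k *: x).
Proof. by apply/quot_eqP; rewrite -scalerBr; apply: idealZ; apply: quot_reprB. Qed.

Lemma quot_piM x y : quot_amul (quot_pi x) (quot_pi y) = quot_pi (x ** y).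
Proof.
apply/quot_eqP; set x' := repr _; set y' := repr _.
have -> : x' ** y' - x ** y = x' ** (y' - y) + (x' - x) ** y.
  by rewrite amulDr amulDl amulNr amulNl addrA subrK.
by apply: idealD; [apply: idealMl|apply: idealMr]; apply: quot_reprB.
Qed.

Lemma quot_pi_star x : quot_star (quot_pi x) = quot_pi (star x).
Proof. by apply/quot_eqP; rewrite -starN -starD; apply/ideal_star/quot_reprB. Qed.

Lemma quot_ind (P : quot_type -> Prop) : (forall x, P (quot_pi x)) -> forall u, P u.
Proof. by move=> Ppi u; rewrite -(quot_piK u). Qed.

Fact quot_scaleA k l (u : quot_type) :
  quot_scale k (quot_scale l u) = quot_scale (k * l) u.
Proof. by elim/quot_ind: u => x; rewrite !quot_piZ scalerA. Qed.
Fact quot_scale1 : left_id 1 quot_scale.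
Proof. by elim/quot_ind => x; rewrite quot_piZ scale1r. Qed.
Fact quot_scaleDr : right_distributive quot_scale +%R.
Proof.
move=> k; elim/quot_ind => x; elim/quot_ind => y.
by rewrite -quot_piD !quot_piZ scalerDr quot_piD.
Qed.
Fact quot_scaleDl (u : quot_type) : {morph quot_scale^~ u : k l / k + l}.
Proof. by move=> k l; elim/quot_ind: u => x; rewrite !quot_piZ scalerDl quot_piD. Qed.

HB.instance Definition _ := GRing.Zmodule_isLmodule.Build R[i] quot_type
  quot_scaleA quot_scale1 quot_scaleDr quot_scaleDl.

Fact quot_amulA : associative quot_amul.
Proof.
by elim/quot_ind => x; elim/quot_ind => y; elim/quot_ind => z; rewrite !quot_piM amulA.
Qed.
Fact quot_amulDl : left_distributive quot_amul +%R.
Proof.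
elim/quot_ind => x; elim/quot_ind => y; elim/quot_ind => z.
by rewrite -quot_piD !quot_piM amulDl quot_piD.
Qed.
Fact quot_amulDr : right_distributive quot_amul +%R.
Proof.
elim/quot_ind => x; elim/quot_ind => y; elim/quot_ind => z.
by rewrite -quot_piD !quot_piM amulDr quot_piD.
Qed.
Fact quot_amulZl (k : R[i]) (u v : quot_type) : quot_amul (k *: u) v = k *: quot_amul u v.
Proof.
elim/quot_ind: u => x; elim/quot_ind: v => y.
by rewrite quot_piM [_ *: _]quot_piZ quot_piM [RHS]quot_piZ amulZl.
Qed.
Fact quot_amulZr (k : R[i]) (u v : quot_type) : quot_amul u (k *: v) = k *: quot_amul u v.
Proof.
elim/quot_ind: u => x; elim/quot_ind: v => y.
by rewrite quot_piM [_ *: _]quot_piZ quot_piM [RHS]quot_piZ amulZr.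
Qed.
Fact quot_starK : involutive quot_star.
Proof. by elim/quot_ind => x; rewrite !quot_pi_star starK. Qed.
Fact quot_starD : {morph quot_star : u v / u + v}.
Proof.
elim/quot_ind => x; elim/quot_ind => y.
by rewrite -quot_piD !quot_pi_star starD quot_piD.
Qed.
Fact quot_starZ (k : R[i]) (u : quot_type) :
  quot_star (k *: u) = (Num.conj k) *: quot_star u.
Proof.
elim/quot_ind: u => x.
by rewrite quot_pi_star [_ *: _]quot_piZ quot_pi_star [RHS]quot_piZ starZ.
Qed.
Fact quot_starM (u v : quot_type) :
  quot_star (quot_amul u v) = quot_amul (quot_star v) (quot_star u).
Proof.
elim/quot_ind: u => x; elim/quot_ind: v => y.
by rewrite quot_piM !quot_pi_star quot_piM starM.
Qed.

HB.instance Definition _ := Lmodule_isStarAlg.Build R quot_type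
  quot_amulA quot_amulDl quot_amulDr quot_amulZl quot_amulZr
  quot_starK quot_starD quot_starZ quot_starM.

(* The map induced on the quotient by a map [f] such that
   [J (x - y) -> J (f x - f y)]. *)
Definition quot_map (f : U -> U) (u : quot_type) : quot_type := quot_pi (f (repr u)).

Lemma quot_map_pi (f : U -> U) x :
  (forall y z, iset J (y - z) -> iset J (f y - f z)) -> quot_map f (quot_pi x) = quot_pi (f x).
Proof. by move=> fJ; apply/quot_eqP/fJ/quot_reprB. Qed.

End Quotient.

Definition star_hom (R : realType) (U V : starAlgType R) (f : U -> V) : Prop :=
  [/\ linear f, {morph f : a b / a ** b} & {morph f : a / star a}].

(* Norms of [R[i]]-modules take values in [R[i]]; [rnorm] is the real-valued norm. *)
Definition rnorm (R : realType) (V : normedModType R[i]) (x : V) : R :=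
  complex.Re `|x|.

Definition is_unit_elt (R : realType) (U : starAlgType R) (e : U) : Prop :=
  forall a : U, e ** a = a /\ a ** e = a.

Definition unital (R : realType) (U : starAlgType R) : Prop :=
  exists e : U, is_unit_elt e.

Definition invertible (R : realType) (U : starAlgType R) (a : U) : Prop :=
  exists e b : U, [/\ is_unit_elt e, a ** b = e & b ** a = e].

Definition selfadjoint (R : realType) (U : starAlgType R) (a : U) : Prop := star a = a.

Definition unitization (R : realType) (U : starAlgType R) := (U * R[i]^o)%type.

Section Unitization.
Variables (R : realType) (U : starAlgType R).
Local Notation U1 := (unitization U).

HB.instance Definition _ := GRing.Lmodule.on U1.

Implicit Types x y z : U1.

Definition unitz_amul x y : U1 :=
  (x.1 ** y.1 + (y.2 : R[i]) *: x.1 + (x.2 : R[i]) *: y.1, x.2 * y.2).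
Definition unitz_star x : U1 := (star x.1, Num.conj (x.2 : R[i])).

Lemma unitz_eqP x y : x.1 = y.1 -> x.2 = y.2 -> x = y.
Proof. by case: x y => [a k] [b l] /= -> ->. Qed.

Fact unitz_amulA : associative unitz_amul.
Proof.
move=> x y z; apply: unitz_eqP; last exact: mulrA.
rewrite /= !(amulDl, amulDr, amulZl, amulZr, scalerDr, scalerA) amulA -!addrA.
congr (_ + _); rewrite [y.2 * z.2]mulrC [x.2 * z.2]mulrC.
rewrite [LHS]addrCA; congr (_ + _); rewrite [RHS]addrCA; congr (_ + _).
exact: addrCA.
Qed.
Fact unitz_amulDl : left_distributive unitz_amul +%R.
Proof.
move=> x y z; apply: unitz_eqP; last exact: mulrDl.
rewrite /= amulDl scalerDr scalerDl [X in X + _ = _]addrACA [LHS]addrACA.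
by [].
Qed.
Fact unitz_amulDr : right_distributive unitz_amul +%R.
Proof.
move=> x y z; apply: unitz_eqP; last exact: mulrDr.
rewrite /= amulDr scalerDr scalerDl [X in X + _ = _]addrACA [LHS]addrACA.
by [].
Qed.
Fact unitz_amulZl (k : R[i]) x y : unitz_amul (k *: x) y = k *: unitz_amul x y.
Proof.
apply: unitz_eqP; last by rewrite /= -mulrA.
by rewrite /= amulZl !scalerDr !scalerA [k * y.2]mulrC.
Qed.
Fact unitz_amulZr (k : R[i]) x y : unitz_amul x (k *: y) = k *: unitz_amul x y.
Proof.
apply: unitz_eqP; last by rewrite /= mulrCA.
by rewrite /= amulZr !scalerDr !scalerA [k * x.2]mulrC.
Qed.
Fact unitz_starK : involutive unitz_star.
Proof. by move=> x; apply: unitz_eqP; [apply: starK|apply: conjCK]. Qed.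
Fact unitz_starD : {morph unitz_star : x y / x + y}.
Proof. by move=> x y; apply: unitz_eqP; [apply: starD|apply: rmorphD]. Qed.
Fact unitz_starZ (k : R[i]) x : unitz_star (k *: x) = (Num.conj k) *: unitz_star x.
Proof. by apply: unitz_eqP; [apply: starZ|apply: rmorphM]. Qed.
Fact unitz_starM x y :
  unitz_star (unitz_amul x y) = unitz_amul (unitz_star y) (unitz_star x).
Proof.
apply: unitz_eqP; last by rewrite /= rmorphM mulrC.
by rewrite /= !starD starM !starZ -!addrA; congr (_ + _); rewrite addrC.
Qed.

HB.instance Definition _ := Lmodule_isStarAlg.Build R U1
  unitz_amulA unitz_amulDl unitz_amulDr unitz_amulZl unitz_amulZr
  unitz_starK unitz_starD unitz_starZ unitz_starM.

End Unitization.

(* The operator norm of left multiplication on [A]: the C*-norm of the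
   unitization of a non-unital [A]. *)
Definition unitization_norm (R : realType) (A : normedStarAlgType R)
    (x : unitization A) : R :=
  sup [set rnorm (x.1 ** b + (x.2 : R[i]) *: b) | b in [set b : A | rnorm b <= 1]].

Definition rr0_for (R : realType) (U : starAlgType R) (nrm : U -> R) : Prop :=
  forall (a : U) (e : R), selfadjoint a -> 0 < e ->
    exists b : U, [/\ selfadjoint b, invertible b & nrm (a - b) < e].

Definition sr1_for (R : realType) (U : starAlgType R) (nrm : U -> R) : Prop :=
  forall (a : U) (e : R), 0 < e -> exists b : U, invertible b /\ nrm (a - b) < e.

Definition real_rank_zero (R : realType) (A : normedStarAlgType R) : Prop :=
  (unital A -> rr0_for (@rnorm R A)) /\
  (~ unital A -> rr0_for (@unitization_norm R A)).

Definition stable_rank_one (R : realType) (A : normedStarAlgType R) : Prop :=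
  (unital A -> sr1_for (@rnorm R A)) /\
  (~ unital A -> sr1_for (@unitization_norm R A)).

(* A countable approximate unit of positive contractions. *)
Definition sigma_unital (R : realType) (A : cstarAlgType R) : Prop :=
  exists e : nat -> A,
    [/\ forall n, exists b : A, e n = star b ** b,
        forall n, rnorm (e n) <= 1,
        forall a : A, (fun n => e n ** a) @ \oo --> a &
        forall a : A, (fun n => a ** e n) @ \oo --> a].

Local Open Scope group_scope.

(* Pointedness is only there because the library's generated sigma-algebras
   require it; the point plays no role. *)
HB.mixin Record isTopologicalGroup G & PointedTopological G & Group G := {
  mulg_continuous : continuous (fun xy : G * G => xy.1 * xy.2 : G);
  invg_continuous : continuous (fun x : G => x^-1)
}.

#[short(type="topologicalGroupType")]
HB.structure Definition TopologicalGroup :=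
  {G of PointedTopological G & Group G & isTopologicalGroup G}.

Record cstarAction (R : realType) (G : topologicalGroupType) (A : cstarAlgType R) :=
  CStarAction {
    act :> G -> A -> A;
    act_hom : forall g, star_hom (act g);
    act1 : forall a, act 1 a = a;
    actM : forall g h a, act (g * h) a = act g (act h a);
    act_continuous : forall a, continuous (fun g => act g a)
  }.

Local Close Scope group_scope.

Section ActionTheory.
Variables (R : realType) (G : topologicalGroupType) (A : cstarAlgType R).
Variables (alpha : cstarAction G A).

Lemma actL g : linear (alpha g). Proof. by case: (act_hom alpha g). Qed.

Lemma actMul g a b : alpha g (a ** b) = alpha g a ** alpha g b.
Proof. by case: (act_hom alpha g). Qed.

Lemma actStar g a : alpha g (star a) = star (alpha g a).
Proof. by case: (act_hom alpha g). Qed.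

Lemma actD g a b : alpha g (a + b) = alpha g a + alpha g b.
Proof. by have := actL g 1 a b; rewrite !scale1r. Qed.

Lemma act0 g : alpha g 0 = 0.
Proof. by apply: (addrI (alpha g 0)); rewrite -actD !addr0. Qed.

Lemma actZ g (k : R[i]) a : alpha g (k *: a) = k *: alpha g a.
Proof. by have := actL g k a 0; rewrite act0 !addr0. Qed.

Definition fixed_algebra : starSubalg A.
Proof.
refine (@StarSubalg R A [set a | forall g, alpha g a = a] _ _ _ _ _).
- by move=> g; apply: act0.
- by move=> a b /= Ha Hb g; rewrite actD Ha Hb.
- by move=> c a /= Ha g; rewrite actZ Ha.
- by move=> a b /= Ha Hb g; rewrite actMul Ha Hb.
- by move=> a /= Ha g; rewrite actStar Ha.
Defined.

End ActionTheory.

Section SequenceAlgebra.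
Variables (R : realType) (A : cstarAlgType R).

Lemma norm_star (a : A) : `|star a| = `|a|.
Proof.
have le (b : A) : `|b| <= `|star b|.
  have [->|b0] := eqVneq b 0; first by rewrite normr0.
  rewrite -(@ler_pM2r _ `|b|) ?normr_gt0//.
  by rewrite -expr2 -norm_star_mul normM_le.
by apply/eqP; rewrite eq_le le andbT -{2}(starK a) le.
Qed.

Definition ell_infty : starSubalg (nat -> A).
Proof.
refine (@StarSubalg R (nat -> A) [set a | exists M, forall n, `|a n| <= M] _ _ _ _ _).
- by exists 0 => n; rewrite normr0.
- move=> a b [M aM] [N bN]; exists (M + N) => n.
  by rewrite (le_trans (ler_normD _ _))// lerD.
- by move=> c a [M aM]; exists (`|c| * M) => n; rewrite normrZ ler_wpM2l.
- move=> a b [M aM] [N bN]; exists (M * N) => n.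
  by rewrite (le_trans (normM_le _ _))// ler_pM.
- by move=> a [M aM]; exists M => n; rewrite [star a n]/(star (a n)) norm_star.
Defined.

Definition linf := subalg_type ell_infty.

Definition linf_norm (a : linf) : R := sup (range (fun n => rnorm (val a n))).

Lemma null_mull (a b : nat -> A) (M : R[i]) : (forall n, `|a n| <= M) ->
  b @ \oo --> (0 : A) -> (fun n => a n ** b n) @ \oo --> (0 : A).
Proof.
move=> aM b0; have M0 : 0 <= M := le_trans (normr_ge0 _) (aM 0).
apply/cvgr0Pnorm_le => e e0.
have M1 : 0 < M + 1 by rewrite ltr_wpDl.
have /cvgr0Pnorm_le/(_ (e / (M + 1))) := b0.
rewrite divr_gt0// => /(_ isT); apply: filterS => n bn.
rewrite (le_trans (normM_le _ _))// (@le_trans _ _ (M * (e / (M + 1))))//.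
  by rewrite ler_pM.
by rewrite mulrCA ger_pMr// ler_pdivrMr// mul1r lerDl.
Qed.

Lemma null_star (a : nat -> A) :
  a @ \oo --> (0 : A) -> (fun n => star (a n)) @ \oo --> (0 : A).
Proof.
move=> /cvgr0Pnorm_le a0; apply/cvgr0Pnorm_le => e /a0.
by apply: filterS => n; rewrite norm_star.
Qed.

Definition c_zero : starIdeal linf.
Proof.
refine (@StarIdeal R linf [set a | val a @ \oo --> (0 : A)] _ _ _ _ _ _).
- exact: cvg_cst.
- by move=> a b /= a0 b0; rewrite -[0 : A]addr0; apply: cvgD.
- by move=> c a /= a0; rewrite -(scaler0 A c); apply: cvgZr.
- by move=> a b /= b0; case: (subalg_valP a) => M aM; apply: null_mull aM b0.
- move=> a b /= /null_star a0; case: (subalg_valP (star b)) => M bM.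
  have := null_star (null_mull bM a0).
  by under eq_fun do rewrite [val (star b) _]/(star (val b _)) -starM starK.
- by move=> a /= /null_star.
Defined.

Definition A_infty := quot_type c_zero.

Definition eta (a : linf) : A_infty := quot_pi c_zero a.

Fact const_bounded (a : A) : sset ell_infty (fun=> a).
Proof. by exists `|a|. Qed.

Definition const_seq (a : A) : A_infty := eta (mk_subalg (const_bounded a)).

End SequenceAlgebra.

Section CentralSequenceAlgebra.
Variables (R : realType) (A : cstarAlgType R) (D : starSubalg A).
Local Notation Ainf := (A_infty A).

Lemma const_star (d : A) : star (const_seq d) = const_seq (star d).
Proof. by rewrite [star _]quot_pi_star; congr quot_pi; apply: val_inj. Qed.

Definition commutant : starSubalg Ainf.
Proof.
refine (@StarSubalg R Ainf
  [set x | forall d, sset D d -> x ** const_seq d = const_seq d ** x] _ _ _ _ _).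
- by move=> d _; rewrite amul0r amulr0.
- by move=> x y /= Hx Hy d Dd; rewrite amulDl amulDr Hx// Hy.
- by move=> c x /= Hx d Dd; rewrite amulZl amulZr Hx.
- by move=> x y /= Hx Hy d Dd; rewrite -amulA Hy// amulA Hx// amulA.
- move=> x /= Hx d Dd.
  by rewrite -[const_seq d]starK const_star -!starM Hx//; apply: subalg_star.
Defined.

Definition annihilator : starIdeal (subalg_type commutant).
Proof.
refine (@StarIdeal R (subalg_type commutant)
  [set x | forall d, sset D d ->
     val x ** const_seq d = 0 /\ const_seq d ** val x = 0] _ _ _ _ _ _).
- by move=> d _ /=; rewrite amul0r amulr0.
- move=> x y /= Hx Hy d Dd; have [x1 x2] := Hx d Dd; have [y1 y2] := Hy d Dd.
  by rewrite amulDl amulDr x1 x2 y1 y2 addr0.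
- move=> c x /= Hx d Dd; have [x1 x2] := Hx d Dd.
  by rewrite amulZl amulZr x1 x2 scaler0.
- move=> x y /= Hy d Dd; have [y1 y2] := Hy d Dd.
  split; first by rewrite -amulA y1 amulr0.
  by rewrite amulA -(subalg_valP x) // -amulA y2 amulr0.
- move=> x y /= Hx d Dd; have [x1 x2] := Hx d Dd.
  split; last by rewrite amulA x2 amul0r.
  by rewrite -amulA (subalg_valP y) // amulA x1 amul0r.
- move=> x /= Hx d Dd; have [x1 x2] := Hx _ (subalg_star Dd).
  split; rewrite -[const_seq d]starK const_star -starM.
    by rewrite x2 star0.
  by rewrite x1 star0.
Defined.

Definition F_algebra := quot_type annihilator.

Definition kappa (x : subalg_type commutant) : F_algebra := quot_pi annihilator x.

End CentralSequenceAlgebra.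

Section SequenceActions.
Variables (R : realType) (G : topologicalGroupType) (A : cstarAlgType R).
Variables (alpha : cstarAction G A) (D : starSubalg A).

(* [subalg_map] and [quot_map] are used on maps that do restrict and descend:
   [alpha g] is isometric, and in [F_act] the subalgebra [D] is meant to be
   [alpha]-invariant. *)
Definition act_linf (g : G) : linf A -> linf A :=
  @subalg_map R (nat -> A) (ell_infty A) (fun a n => alpha g (a n)).

Definition act_infty (g : G) : A_infty A -> A_infty A :=
  @quot_map R (linf A) (c_zero A) (act_linf g).

Definition F_act (g : G) : F_algebra D -> F_algebra D :=
  @quot_map R (subalg_type (commutant D)) (annihilator D)
    (@subalg_map R (A_infty A) (commutant D) (act_infty g)).

Definition ell_infty_cont : set (linf A) :=
  [set a | forall g (e : R), 0 < e ->
     \forall h \near g, linf_norm (act_linf h a - act_linf g a) < e].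

Definition A_infty_cont : set (A_infty A) := @eta R A @` ell_infty_cont.

Definition F_cont : set (F_algebra D) :=
  @kappa R A D @` [set x | A_infty_cont (val x)].

End SequenceActions.

Section ContinuousFunctions.
Variables (R : realType) (G : topologicalGroupType).

Definition cont_subalg : starSubalg (G -> R[i]^o).
Proof.
refine (@StarSubalg R (G -> R[i]^o) [set f | continuous f] _ _ _ _ _).
- by move=> x; apply: cvg_cst.
- by move=> f h /= cf ch x; apply: cvgD; [apply: cf|apply: ch].
- by move=> c f /= cf x; apply: cvgZr; apply: cf.
- by move=> f h /= cf ch x; apply: cvgM; [apply: cf|apply: ch].
- move=> f /= cf x; apply/cvgrPdist_le => e e0.
  have /cvgrPdist_le/(_ e e0) := cf x; apply: filterS => y.
  by rewrite [star f x]/(Num.conj (f x : R[i])) [star f y]/(Num.conj (f y : R[i]))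
    -rmorphB norm_conjC.
Defined.

Definition CG := subalg_type cont_subalg.

Definition left_translation (g : G) : CG -> CG :=
  @subalg_map R (G -> R[i]^o) cont_subalg (fun f h => f (g^-1 * h)%g).

End ContinuousFunctions.

Definition separable_set (T : topologicalType) (S : set T) : Prop :=
  exists X : set T, [/\ countable X, X `<=` S & S `<=` closure X].

Definition rokhlin_property (R : realType) (G : topologicalGroupType)
    (A : cstarAlgType R) (alpha : cstarAction G A) : Prop :=
  forall D : starSubalg A,
    closed (sset D) -> separable_set (sset D) ->
    (forall g d, sset D d -> sset D (alpha g d)) ->
    exists phi : CG R G -> F_algebra D,
      [/\ star_hom phi,
          forall f, F_cont alpha (phi f),
          forall (e : CG R G) (y : F_algebra D), is_unit_elt e -> F_cont alpha y ->
            phi e ** y = y /\ y ** phi e = y &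
          forall g f, phi (left_translation g f) = F_act alpha g (phi f)].

Section CrossedProduct.
Variables (R : realType) (G : topologicalGroupType).
Variable mu : probability (g_sigma_algebraType (@open G)) R.

(* A left-invariant probability is the normalized Haar measure. *)
Definition left_invariant : Prop :=
  forall (s : G) (B : set (g_sigma_algebraType (@open G))), measurable B ->
    mu [set t : G | B (s * t)%g] = mu B.

Definition complex_integral (h : G -> R[i]) : R[i] :=
  Complex (Rintegral mu setT (fun t => complex.Re (h t)))
          (Rintegral mu setT (fun t => complex.Im (h t))).

(* The weak (Pettis) integral, which exists and is unique for continuous [f]
   when [G] is compact. *)
Definition vector_integral (A : cstarAlgType R) (f : G -> A) : A :=
  xget 0 [set a : A | forall phi : A -> R[i]^o, linear phi -> continuous phi ->
    phi a = complex_integral (fun t => phi (f t))].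

Variables (A : cstarAlgType R) (alpha : cstarAction G A).

Definition convolution (f h : G -> A) : G -> A :=
  fun s => vector_integral (fun t => f t ** alpha t (h (t^-1 * s)%g)).

(* No modular function: compact groups are unimodular. *)
Definition involution (f : G -> A) : G -> A :=
  fun s => alpha s (star (f (s^-1)%g)).

(* An L^1-contractive star-homomorphism from the convolution algebra C(G, A)
   to [B]; the values of [pi] at discontinuous functions are irrelevant. *)
Definition convolution_rep (B : cstarAlgType R) (pi : (G -> A) -> B) : Prop :=
  forall f h : G -> A, continuous f -> continuous h ->
    [/\ forall c : R[i], pi (c *: f + h) = c *: pi f + pi h,
        pi (convolution f h) = pi f ** pi h,
        pi (involution f) = star (pi f) &
        rnorm (pi f) <= Rintegral mu setT (fun t => rnorm (f t))].

(* [B] is the enveloping C*-algebra of L^1(G, A), i.e. the Hausdorff completion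
   of C(G, A) in the largest L^1-dominated C*-seminorm. This determines
   [(B, iota)] up to isomorphism. *)
Definition is_crossed_product (B : cstarAlgType R) (iota : (G -> A) -> B) : Prop :=
  [/\ convolution_rep iota,
      closure (iota @` [set f | continuous f]) = setT &
      forall f, continuous f ->
        rnorm (iota f) = sup [set x : R | exists (E : cstarAlgType R) (pi : (G -> A) -> E),
          convolution_rep pi /\ x = rnorm (pi f)]].

End CrossedProduct.

(* Main.v *)
(* Both properties say that quasi-invertible elements [b], those for which
   [1 + b] has an inverse [1 + c] in the unitization, are dense (among the
   self-adjoint elements, for real rank zero).  In this form they need no unit,
   and [b] is quasi-invertible as soon as it has approximate quasi-inverses.

   A lift of a Rokhlin homomorphism on a separable invariant subalgebra [D]
   induces a multiplicative contraction from [C(G) (x) D] to the sequence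
   algebra.  The function [s |-> alpha s d] goes to the class of a sequence
   [psi d] in the fixed point algebra, and [psi] carries a quasi-invertible
   element near a fixed point [a], and its quasi-inverse, to sequences of fixed
   points.

   For the crossed product, a continuous [f : G -> A] is approximated by
   [g |-> sum_ij p_i(s) p_j(g^-1 s) alpha s d_ij] for all [s], where the [p_i] are
   real and orthonormal for the Haar measure.  Quasi-invertible elements are also
   dense in matrices over [A], by Schur complements.  The functions
   [g |-> sum_ij q(p_i) psi(d_ij) alpha g (q(p_j)^star)] approximate [f], and by
   orthonormality they are multiplied asymptotically like the matrices [d]. *)

Require Import Defs.
From HB Require Import structures.
From mathcomp Require Import all_boot all_order all_algebra complex generic_quotient.
From mathcomp Require Import all_classical all_reals all_analysis.
From mathcomp Require Import ring lra.

Set Implicit Arguments.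
Unset Strict Implicit.
Unset Printing Implicit Defensive.

Import Order.TTheory GRing.Theory Num.Theory.
Import numFieldNormedType.Exports.

Local Open Scope classical_set_scope.
Local Open Scope complex_scope.
Local Open Scope ring_scope.

(** The hard point is that an element of the sequence algebra must be controlled by the function
    [G -> A] it stands for. This is obtained by counting. A partition of unity is written as nested
    two-term convex combinations; powers of one such combination are sums of words, grouped by the
    binomial theorem into linearly many contractive blocks, and the C*-identity on powers [2^j]
    removes the linear factor.

    Integration over [G] is carried out by finite averages of translates, because these make sense
    inside the sequence algebra; the integrals against Haar measure are then identified with limits
    of such averages.

    In the crossed product, the convolution of two kernels [x_i u alpha_g(star x_j)], with [x_i] an
    entry of the lift of [p_i], produces the average over [t] of [alpha_t(star x_j x_k e)]. This
    stands for [s |-> p_j(s) p_k(s) alpha_s(d)], whose translates average to the integral of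
    [p_j p_k] times [alpha_s(d)]: this is where orthonormality acts.

    An error below 1 in the quasi-inverse equations at a single index already gives an exact
    quasi-inverse, so limits need not be inverted. *)

Inductive zexpr := ZVar of nat | ZZero | ZAdd of zexpr & zexpr | ZOpp of zexpr.

(** * Equations in abelian groups by reflection *)

Section Abel.
Variable V : zmodType.

Fixpoint zeval (env : seq V) (e : zexpr) : V :=
  match e with
  | ZVar i => nth 0 env i
  | ZZero => 0
  | ZAdd a b => zeval env a + zeval env b
  | ZOpp a => - zeval env a
  end.

(* [zcount e i] counts the occurrences of the [i]-th atom with each sign. *)
Fixpoint zcount (e : zexpr) (i : nat) : nat * nat :=
  match e with
  | ZVar j => if Nat.eqb i j then (1, 0)%N else (0, 0)%N
  | ZZero => (0, 0)%N
  | ZAdd a b => let: (p, n) := zcount a i in let: (p', n') := zcount b i in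
      (Nat.add p p', Nat.add n n')
  | ZOpp a => let: (p, n) := zcount a i in (n, p)
  end.

Fixpoint zcheck (e : zexpr) (k : nat) : bool :=
  match k with
  | 0%N => true
  | k'.+1 => let: (p, n) := zcount e k' in Nat.eqb p n && zcheck e k'
  end.

Fixpoint zbounded (e : zexpr) (k : nat) : bool :=
  match e with
  | ZVar i => Nat.ltb i k
  | ZZero => true
  | ZAdd a b => zbounded a k && zbounded b k
  | ZOpp a => zbounded a k
  end.

Lemma zevalE env e : zbounded e (size env) -> zeval env e =
  \sum_(i < size env) (nth 0 env i *+ (zcount e i).1 - nth 0 env i *+ (zcount e i).2).
Proof.
elim: e => [j|_|a IHa b IHb|a IHa] /=.
- move=> /PeanoNat.Nat.ltb_spec0 /ssrnat.ltP ltj; rewrite (bigD1 (Ordinal ltj)) //= PeanoNat.Nat.eqb_refl.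
  rewrite mulr1n mulr0n subr0 big1 ?addr0// => i /negP ij.
  case: PeanoNat.Nat.eqb_spec => [eij|_]; last by rewrite subr0.
  by case: ij; apply/eqP/val_inj.
- by rewrite big1 // => i _; rewrite subr0.
- move=> /andP[Ba Bb]; rewrite IHa // IHb // -big_split /=; apply: eq_bigr => i _.
  case: (zcount a i) (zcount b i) => [p n] [p' n'] /=.
  by rewrite !mulrnDr addrACA opprD.
- move=> Ba; rewrite IHa // -sumrN; apply: eq_bigr => i _.
  by case: (zcount a i) => p n /=; rewrite opprB.
Qed.

(** Moving [b] to the left turns the equation into the vanishing of every coefficient, a computation
    on natural numbers: each atom must occur equally often with either sign. *)
Lemma zevalP env a b :
  zbounded (ZAdd a (ZOpp b)) (size env) && zcheck (ZAdd a (ZOpp b)) (size env) ->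
  zeval env a = zeval env b.
Proof.
move=> /andP[/zevalE E C]; apply/eqP; rewrite -subr_eq0; apply/eqP.
move: E; rewrite [zeval _ _]/=  => ->; apply: big1 => i _.
have H : forall k, zcheck (ZAdd a (ZOpp b)) k -> forall i, (i < k)%N ->
    (zcount (ZAdd a (ZOpp b)) i).1 = (zcount (ZAdd a (ZOpp b)) i).2.
  elim=> // k IH /= + j; case E: (let: (p, n) := zcount a k in _) => [p n].
  move=> /andP[/PeanoNat.Nat.eqb_spec pn /IH Hk].
  rewrite ltnS leq_eqVlt => /predU1P[->|]; last exact: Hk.
  by rewrite E /= pn.
by rewrite (H _ C) ?subrr.
Qed.
End Abel.

(** The [match goal] inside the [let] runs a test while a term is being built. Syntactic equality is
    tried before unification, which identifies convertible atoms. *)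
Ltac abel_index x env :=
  lazymatch env with
  | cons ?y ?env' => match constr:(tt) with
     | _ => let __ := match goal with _ => first [constr_eq x y | unify x y] end in constr:(O)
     | _ => let i := abel_index x env' in constr:(S i) end
  end.
Ltac abel_atoms V env t :=
  lazymatch t with
  | @Algebra.add _ ?a ?b => let env := abel_atoms V env a in abel_atoms V env b
  | @Algebra.opp _ ?a => abel_atoms V env a
  | @Algebra.zero _ => env
  | _ => match constr:(tt) with
     | _ => let __ := abel_index t env in env
     | _ => constr:(@cons V t env) end
  end.
Ltac abel_reify env t :=
  lazymatch t with
  | @Algebra.add _ ?a ?b => let a := abel_reify env a in let b := abel_reify env b in
      constr:(ZAdd a b)
  | @Algebra.opp _ ?a => let a := abel_reify env a in constr:(ZOpp a)
  | @Algebra.zero _ => constr:(ZZero)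
  | _ => let i := abel_index t env in constr:(ZVar i)
  end.
Ltac abel_on V :=
  lazymatch goal with |- @eq _ ?x ?y =>
    let env := abel_atoms V (@nil V) x in
    let env := abel_atoms V env y in
    let a := abel_reify env x in let b := abel_reify env y in
    refine (@zevalP _ env a b _); vm_compute; exact (erefl true)
  end.
Ltac abel := lazymatch goal with |- @eq ?V _ _ => abel_on V end.

(** * Real-valued norms and geometric convergence *)

Section Norm.
Variables (R : realType) (V : normedModType R[i]).
Implicit Types x y z : V.

(** The order on [R[i]] makes a nonnegative element real, so the real part loses nothing and
    estimates can be run in [R]. *)
Lemma rnormE x : `|x| = (rnorm x)%:C.
Proof.
by rewrite /rnorm; have := normr_ge0 x; case: `|x| => a b; rewrite lecE /= => /andP[/eqP-> _].
Qed.

Lemma rnorm_ge0 x : 0 <= rnorm x.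
Proof. by rewrite -lecR -rnormE normr_ge0. Qed.

Lemma rnormD x y : rnorm (x + y) <= rnorm x + rnorm y.
Proof. by rewrite -lecR rmorphD /= -!rnormE ler_normD. Qed.

Lemma rnormN x : rnorm (- x) = rnorm x.
Proof. by rewrite /rnorm normrN. Qed.

Lemma rnormB x y : rnorm (x - y) <= rnorm x + rnorm y.
Proof. by rewrite -(rnormN y) rnormD. Qed.

Lemma rnormC x y : rnorm (x - y) = rnorm (y - x).
Proof. by rewrite /rnorm distrC. Qed.

Lemma rnorm_tri y x z : rnorm (x - z) <= rnorm (x - y) + rnorm (y - z).
Proof. have -> : x - z = (x - y) + (y - z) by abel.
exact: rnormD. Qed.

Lemma rnorm_le_sub x y : rnorm x <= rnorm y + rnorm (x - y).
Proof. have {1}-> : x = y + (x - y) by abel.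
exact: rnormD. Qed.

Lemma rnorm0 : rnorm (0 : V) = 0.
Proof. by rewrite /rnorm normr0. Qed.

Lemma rnorm_eq0 x : rnorm x <= 0 -> x = 0.
Proof.
move=> x0; apply/normr0_eq0; rewrite rnormE.
by have /eqP -> : rnorm x == 0 by rewrite eq_le x0 rnorm_ge0.
Qed.

Lemma rnormZ (c : R[i]) x : rnorm (c *: x) = rnorm (c : R[i]^o) * rnorm x.
Proof. by apply: (@complexI R); rewrite rmorphM /= -!rnormE normrZ. Qed.

Lemma rnorm_real (r : R) : rnorm (r%:C : R[i]^o) = `|r|.
Proof. by rewrite /rnorm normc_def /= expr0n /= addr0 sqrtr_sqr. Qed.

Lemma rnormZr (r : R) x : rnorm (r%:C *: x) = `|r| * rnorm x.
Proof. by rewrite rnormZ rnorm_real. Qed.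

Lemma rnorm_sum (I : Type) (s : seq I) (P : pred I) (F : I -> V) :
  rnorm (\sum_(i <- s | P i) F i) <= \sum_(i <- s | P i) rnorm (F i).
Proof.
elim/big_rec2: _ => [|i b a _ IH]; first by rewrite rnorm0.
by rewrite (le_trans (rnormD _ _)) // lerD2l.
Qed.

Lemma rnorm_cvgP (T : Type) (F : set_system T) {FF : Filter F} (f : T -> V) (l : V) :
  f @ F --> l <-> forall e : R, 0 < e -> \forall x \near F, rnorm (f x - l) < e.
Proof.
split=> [/cvgrPdist_lt fl e e0|fl].
  have /fl : 0 < e%:C by rewrite ltcR.
  by apply: filterS => x; rewrite rnormE ltcR rnormC.
apply/cvgrPdist_lt => e e0.
have eE : e = (complex.Re e)%:C by move: e0; case: (e) => a b; rewrite ltcE /= => /andP[/eqP -> _].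
have : 0 < complex.Re e by rewrite -ltcR -eE.
move=> /fl; apply: filterS => x; rewrite eE rnormE ltcR rnormC; exact.
Qed.

Lemma rnorm_nbhsP (x : V) (P : set V) :
  nbhs x P <-> exists2 e : R, 0 < e & forall y, rnorm (y - x) < e -> P y.
Proof.
split=> [|[e e0 eP]].
  rewrite -nbhs_ballE => -[e /= e0 eP].
  have eE : e = (complex.Re e)%:C by move: e0; case: (e) => a b; rewrite ltcE /= => /andP[/eqP -> _].
  exists (complex.Re e); first by rewrite -ltcR -eE.
  move=> y yx; apply: eP; rewrite -ball_normE /= rnormE eE ltcR rnormC; exact: yx.
rewrite -nbhs_ballE; exists e%:C; first by rewrite /= ltcR.
by move=> y; rewrite -ball_normE /= rnormE ltcR rnormC; apply: eP.
Qed.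

Lemma rnorm_closureP (S : set V) (x : V) :
  closure S x <-> forall e : R, 0 < e -> exists2 y, S y & rnorm (y - x) < e.
Proof.
split=> [clS e e0|H B /rnorm_nbhsP[e e0 eB]].
  have /clS[y [Sy yx]] : nbhs x [set y | rnorm (y - x) < e] by apply/rnorm_nbhsP; exists e.
  by exists y.
by have [y Sy yx] := H e e0; exists y; split=> //; apply: eB.
Qed.

End Norm.

Section Complete.
Variables (R : realType) (V : completeNormedModType R[i]).

Lemma geometric_cauchy_cvg (u : nat -> V) (C q : R) : 0 <= q -> q < 1 ->
  (forall n, rnorm (u n.+1 - u n) <= C * q ^+ n) ->
  exists2 l : V, u @ \oo --> l & forall n, rnorm (l - u n) <= C * q ^+ n / (1 - q).
Proof.
move=> q0 q1 Hu.
have q1' : 0 < 1 - q by rewrite subr_gt0.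
have C0 : 0 <= C by have := Hu 0%N; rewrite expr0 mulr1; apply: le_trans; exact: rnorm_ge0.
(* The partial geometric sum is kept in closed form, since the bare bound [C q^n / (1 - q)] would
   not be inductive. *)
have Hk n k : rnorm (u (n + k)%N - u n) <= C * q ^+ n * (1 - q ^+ k) / (1 - q).
  elim: k => [|k IH]; first by rewrite addn0 subrr rnorm0 expr0 subrr mulr0 mul0r.
  rewrite (le_trans (rnorm_tri (u (n + k)%N) _ _)) // addnS.
  rewrite (le_trans (lerD (Hu _) IH)) // ler_pdivlMr // mulrDl divfK ?gt_eqF//.
  rewrite exprD exprS.
  have -> : C * (q ^+ n * q ^+ k) * (1 - q) + C * q ^+ n * (1 - q ^+ k) =
    C * q ^+ n * (1 - q * q ^+ k) by ring.
  by [].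
have Hk' n k : rnorm (u (n + k)%N - u n) <= C * q ^+ n / (1 - q).
  rewrite (le_trans (Hk n k)) // ler_pM2r ?invr_gt0// ler_piMr //.
    by rewrite mulr_ge0 // exprn_ge0.
  by rewrite lerBlDr lerDl exprn_ge0.
have small (e : R) : 0 < e -> \forall n \near \oo, C * q ^+ n / (1 - q) < e.
  move=> e0.
  have /cvgrPdist_lt/(_ e e0) : (fun n => (C / (1 - q)) * q ^+ n) @ \oo --> (0 : R).
    rewrite -(mulr0 (C / (1 - q))); apply: cvgMr; apply: cvg_expr.
    by rewrite ger0_norm.
  apply: filterS => n; rewrite sub0r normrN ger0_norm; first by rewrite mulrAC.
  by rewrite mulr_ge0 ?exprn_ge0// divr_ge0 // ltW.
have cu : cvg (u @ \oo).
  apply/cauchy_cvgP/cauchy_ballP => e e0; near_simpl.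
  have eE : e = (complex.Re e)%:C by move: e0; case: (e) => a b; rewrite ltcE /= => /andP[/eqP -> _].
  have e0' : 0 < complex.Re e / 2 by rewrite divr_gt0 // -ltcR -eE.
  have [N _ HN] := small _ e0'.
  have H n : (N <= n)%N -> rnorm (u n - u N) < complex.Re e / 2.
    by move=> Nn; rewrite -(subnKC Nn) (le_lt_trans (Hk' _ _)) //; apply: HN => /=.
  exists ([set n | N <= n]%N, [set n | N <= n]%N); first by split; exists N.
  move=> [n m] /= [Nn Nm]; rewrite -ball_normE /= rnormE eE ltcR /=.
  rewrite (le_lt_trans (rnorm_tri (u N) _ _)) // [X in _ < X]splitr ltrD //; first exact: H.
  by rewrite rnormC; exact: H.
exists (lim (u @ \oo)) => // n; apply/ler_addgt0Pr => e e0.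
have /rnorm_cvgP/(_ e e0)[N _ HN] := cu.
have := HN (n + N)%N (leq_addl _ _); rewrite rnormC => h.
rewrite (le_trans (rnorm_tri (u (n + N)%N) _ _)) // addrC lerD //; exact: ltW.
Unshelve. all: by end_near. Qed.
End Complete.

Section CStarNorm.
Variables (R : realType) (A : cstarAlgType R).
Implicit Types a b : A.

Lemma rnormM a b : rnorm (a ** b) <= rnorm a * rnorm b.
Proof. by rewrite -lecR rmorphM /= -!rnormE normM_le. Qed.

Lemma rnorm_star_mul a : rnorm (star a ** a) = rnorm a ^+ 2.
Proof. by apply: (@complexI R); rewrite rmorphXn /= -!rnormE norm_star_mul. Qed.

Lemma rnorm_star a : rnorm (star a) = rnorm a.
Proof. by rewrite /rnorm norm_star. Qed.
End CStarNorm.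

(** * Quasi-inverses and the density property *)

Lemma scale_half (R : realType) (V : lmodType R[i]) (x : V) : (1 / 2 : R)%:C *: (x + x) = x.
Proof.
rewrite -[x + x]mulr2n -[x *+ 2]scaler_nat scalerA -(rmorph_nat (@real_complex R)).
by rewrite -rmorphM divfK // scale1r.
Qed.

Ltac amul_expand := rewrite ?(amulDl, amulDr, amulNl, amulNr, amulA, opprD, opprK).
Ltac amul_ring := amul_expand; abel.

Section Limits.
Variables (R : realType).

Lemma rnorm_small_eq0 (V : normedModType R[i]) (x : V) :
  (forall e : R, 0 < e -> rnorm x <= e) -> x = 0.
Proof.
by move=> H; apply: rnorm_eq0; apply/ler_addgt0Pr => e e0; rewrite add0r; exact: H.
Qed.

Lemma rnorm_cvg_unique (V : normedModType R[i]) (u : nat -> V) (a b : V) :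
  u @ \oo --> a -> u @ \oo --> b -> a = b.
Proof.
move=> /rnorm_cvgP ua /rnorm_cvgP ub; apply/eqP; rewrite -subr_eq0; apply/eqP.
apply: rnorm_small_eq0 => e e0.
have e2 : 0 < e / 2 by rewrite divr_gt0.
near \oo => n.
rewrite (le_trans (rnorm_tri (u n) _ _)) // [leRHS]splitr lerD // ltW //.
  by rewrite rnormC; near: n; exact: ua.
by near: n; exact: ub.
Unshelve. all: by end_near. Qed.

Variable A : cstarAlgType R.

Lemma cvg_amulr (T : Type) (F : set_system T) {FF : Filter F} (u : T -> A) (a b : A) :
  u @ F --> a -> (fun n => u n ** b) @ F --> a ** b.
Proof.
move=> /rnorm_cvgP ua; apply/rnorm_cvgP => e e0.
have b0 : 0 < rnorm b + 1 by rewrite ltr_wpDl // rnorm_ge0.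
have /ua : 0 < e / (rnorm b + 1) by rewrite divr_gt0.
apply: filterS => n; rewrite ltr_pdivlMr // -amulNl -amulDl; apply: le_lt_trans.
by rewrite (le_trans (rnormM _ _)) // ler_wpM2l ?rnorm_ge0 // lerDl.
Qed.

Lemma cvg_amull (T : Type) (F : set_system T) {FF : Filter F} (u : T -> A) (a b : A) :
  u @ F --> a -> (fun n => b ** u n) @ F --> b ** a.
Proof.
move=> /rnorm_cvgP ua; apply/rnorm_cvgP => e e0.
have b0 : 0 < rnorm b + 1 by rewrite ltr_wpDl // rnorm_ge0.
have /ua : 0 < e / (rnorm b + 1) by rewrite divr_gt0.
apply: filterS => n; rewrite ltr_pdivlMr // -amulNr -amulDr; apply: le_lt_trans.
by rewrite (le_trans (rnormM _ _)) // mulrC ler_wpM2l ?rnorm_ge0 // lerDl.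
Qed.

Lemma cvg_star (T : Type) (F : set_system T) {FF : Filter F} (u : T -> A) (a : A) :
  u @ F --> a -> (fun n => star (u n)) @ F --> star a.
Proof.
move=> /rnorm_cvgP ua; apply/rnorm_cvgP => e /ua.
by apply: filterS => n; rewrite -starN -starD rnorm_star.
Qed.

Lemma cvg_amul (T : Type) (F : set_system T) {FF : Filter F} (u v : T -> A) (a b : A) :
  u @ F --> a -> v @ F --> b -> (fun n => u n ** v n) @ F --> a ** b.
Proof.
move=> ua vb; have /rnorm_cvgP ub : (fun n => u n ** b) @ F --> a ** b by exact: cvg_amulr.
have /rnorm_cvgP va := vb; have /rnorm_cvgP ua' := ua.
apply/rnorm_cvgP => e e0.
have e2 : 0 < e / 2 by rewrite divr_gt0.
have a0 : 0 < rnorm a + 1 by rewrite ltr_wpDl // rnorm_ge0.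
near=> n.
have -> : u n ** v n - a ** b = u n ** (v n - b) + (u n ** b - a ** b) by amul_ring.
rewrite (le_lt_trans (rnormD _ _)) // [ltRHS]splitr ltrD //; last by near: n; exact: ub.
have un : rnorm (u n) <= rnorm a + 1.
  rewrite (le_trans (rnorm_le_sub _ a)) // lerD2l ltW //; near: n; exact: ua'.
rewrite (le_lt_trans (rnormM _ _)) // (@le_lt_trans _ _ ((rnorm a + 1) * rnorm (v n - b))) //.
  by rewrite ler_wpM2r ?rnorm_ge0.
rewrite mulrC -ltr_pdivlMr //; near: n; apply: va; exact: divr_gt0.
Unshelve. all: by end_near. Qed.

End Limits.

Section QuasiInverse.
Variable R : realType.

(* [1 + b] is invertible with inverse [1 + c] in the unitization. *)
Definition qinv (U : starAlgType R) (b c : U) : Prop :=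
  b + c + b ** c = 0 /\ b + c + c ** b = 0.

(** [1 + l = (1 + l)(1 + b)(1 + c) = 1 + c], expanded so that no unit occurs. *)
Lemma qinv_uniq (U : starAlgType R) (b c l : U) :
  b + l + l ** b = 0 -> b + c + b ** c = 0 -> l = c.
Proof.
move=> Hl Hc.
have E : (b + l + l ** b) + (b + l + l ** b) ** c = (b + c + b ** c) + l ** (b + c + b ** c) + l - c.
  by amul_ring.
by apply/eqP; rewrite eq_sym -subr_eq0 -opprB oppr_eq0; apply/eqP; move: E; rewrite Hl Hc amul0r amulr0 !addr0 add0r.
Qed.

Variable A : cstarAlgType R.

(** Neumann series: [u n] runs through the partial sums of the powers of [- r], from exponent 1 on.
    The limit solves [s = - r - r s] and commutes with [r], which gives the second identity. *)
Lemma small_qinv (r : A) : rnorm r < 1 -> exists s, qinv r s.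
Proof.
move=> r1.
pose u := fix u n : A := if n is m.+1 then - r - r ** u m else 0.
have uE n : u n.+1 - u n = iter n (fun x => - (r ** x)) (- r).
  elim: n => [|n IH] /=; first by rewrite amulr0 !subr0.
  rewrite -IH -/(u n.+1) [u n.+1]/=; amul_ring.
have ucomm n : u n ** r = r ** u n.
  elim: n => [|n IH]; first by rewrite amul0r amulr0.
  by rewrite [u n.+1]/= amulDl amulDr !amulNl !amulNr -amulA IH.
have Hu n : rnorm (u n.+1 - u n) <= rnorm r * rnorm r ^+ n.
  rewrite uE; elim: n => [|n IH] /=; first by rewrite expr0 mulr1 rnormN.
  rewrite rnormN (le_trans (rnormM _ _)) // exprS.
  by rewrite ler_wpM2l ?rnorm_ge0 //.
have [s us _] := geometric_cauchy_cvg (rnorm_ge0 r) r1 Hu.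
have us1 : (fun n => u n.+1) @ \oo --> s by rewrite cvg_shiftS.
have us2 : (fun n => u n.+1) @ \oo --> - r - r ** s.
  apply: cvgB; first exact: cvg_cst.
  exact: cvg_amull.
have sE := rnorm_cvg_unique us1 us2.
have cE : s ** r = r ** s.
  apply: (@rnorm_cvg_unique _ _ (fun n => u n ** r)); first exact: cvg_amulr.
  under eq_fun do rewrite ucomm.
  exact: cvg_amull.
by exists s; split; rewrite ?cE {1}sE; abel.
Qed.

(** [(1 + y)(1 + z)] and [(1 + z')(1 + y)] are invertible by the Neumann series, so [1 + y] has a
    right inverse [1 + c] and a left inverse [1 + l]; these coincide. *)
Lemma approx_qinv (y z z' : A) : rnorm (y + z + y ** z) < 1 ->
  rnorm (y + z' + z' ** y) < 1 -> exists c, qinv y c.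
Proof.
move=> /small_qinv[s [s1 s2]] /small_qinv[s' [s1' s2']].
set r := y + z + _ in s1 s2; set r' := y + z' + _ in s1' s2'.
pose c := z + s + z ** s; pose l := s' + z' + s' ** z'.
have H1 : y + c + y ** c = 0.
  have -> : y + c + y ** c = r + s + r ** s by rewrite /c /r; amul_ring.
  by [].
have H2 : y + l + l ** y = 0.
  have -> : y + l + l ** y = r' + s' + s' ** r' by rewrite /l /r'; amul_ring.
  by [].
by exists c; split => //; rewrite -(qinv_uniq H2 H1).
Qed.

End QuasiInverse.

(** The flag [sa] selects real rank zero ([true]) or stable rank one ([false]), so that one argument
    serves both. *)
Definition qdense (R : realType) (sa : bool) (U : normedStarAlgType R) : Prop :=
  forall (a : U) (e : R), (sa -> star a = a) -> 0 < e ->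
    exists b c : U, [/\ sa -> star b = b, qinv b c & rnorm (a - b) < e].

Definition dense_inv (R : realType) (sa : bool) (U : starAlgType R) (nrm : U -> R) : Prop :=
  forall (a : U) (e : R), (sa -> star a = a) -> 0 < e ->
    exists b : U, [/\ sa -> star b = b, invertible b & nrm (a - b) < e].

Section Rank.
Variable R : realType.

Lemma rr0_dense_inv (U : starAlgType R) (nrm : U -> R) : rr0_for nrm <-> dense_inv true nrm.
Proof.
split=> H a e.
  by move=> /(_ isT) sa e0; have [b [sb ib ab]] := H a e sa e0; exists b; split.
by move=> sa e0; have [|b [sb ib ab]] := H a e _ e0; [|exists b; split=> //; exact: sb].
Qed.

Lemma sr1_dense_inv (U : starAlgType R) (nrm : U -> R) : sr1_for nrm <-> dense_inv false nrm.
Proof.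
split=> H a e.
  by move=> _ e0; have [b [ib ab]] := H a e e0; exists b; split.
by move=> e0; have [|b [sb ib ab]] := H a e _ e0; [|exists b; split].
Qed.

Definition rank_prop (sa : bool) (A : normedStarAlgType R) : Prop :=
  (unital A -> dense_inv sa (@rnorm R A)) /\
  (~ unital A -> dense_inv sa (@unitization_norm R A)).

Lemma rr0_rank (A : normedStarAlgType R) : real_rank_zero A <-> rank_prop true A.
Proof. by split=> -[H1 H2]; split=> [/H1|/H2] /rr0_dense_inv. Qed.

Lemma sr1_rank (A : normedStarAlgType R) : stable_rank_one A <-> rank_prop false A.
Proof. by split=> -[H1 H2]; split=> [/H1|/H2] /sr1_dense_inv. Qed.

Lemma unitz_mulE (U : starAlgType R) (x y : unitization U) :
  x ** y = (x.1 ** y.1 + (y.2 : R[i]) *: x.1 + (x.2 : R[i]) *: y.1, x.2 * y.2).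
Proof. by []. Qed.

Lemma unitz_unit (U : starAlgType R) : is_unit_elt ((0, 1) : unitization U).
Proof.
by move=> [a k]; rewrite !unitz_mulE /= amul0r amulr0 scaler0 scale1r !addr0 !add0r mul1r mulr1.
Qed.

Lemma unit_elt_uniq (U : starAlgType R) (e f : U) : is_unit_elt e -> is_unit_elt f -> e = f.
Proof. by move=> He Hf; rewrite -(Hf e).1 (He f).2. Qed.

(** The element is [k (1 + b)], with inverse [k^-1 (1 + c)]. *)
Lemma unitz_invertible (U : starAlgType R) (b : U) (k : R[i]) (c : U) :
  k != 0 -> qinv b c -> invertible ((k *: b, k) : unitization U).
Proof.
move=> k0 [H1 H2]; exists (0, 1); exists (k^-1 *: c, k^-1).
split; first exact: unitz_unit.
  rewrite unitz_mulE /= divff // amulZl amulZr !scalerA divff // mulVf // !scale1r.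
  by rewrite -[b ** c + b + c]addrA addrC H1.
rewrite unitz_mulE /= amulZl amulZr !scalerA divff // mulVf // !scale1r.
by rewrite -addrA [c + b]addrC addrC H2.
Qed.

(** The second coordinates give [k k' = 1]; dividing by [k] leaves [1 + k^-1 b], whose inverse is
    [1 + k b']. *)
Lemma invertible_unitz (U : starAlgType R) (b : U) (k : R[i]) :
  invertible ((b, k) : unitization U) -> k != 0 /\ exists c, qinv (k^-1 *: b) c.
Proof.
move=> [e [[b' k'] [ue]]]; rewrite (unit_elt_uniq ue (@unitz_unit U)) !unitz_mulE /=.
move=> [H1 H2] [H3 H4].
have k0 : k != 0 by apply: contra_eq_neq H2 => ->; rewrite mul0r eq_sym oner_neq0.
have -> : k^-1 = k' by rewrite -[LHS]mulr1 -H2 mulKf.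
split=> //; exists (k *: b'); split.
  rewrite amulZl amulZr scalerA H4 scale1r -{}[RHS]H1; abel.
rewrite amulZl amulZr scalerA H2 scale1r -{}[RHS]H3; abel.
Qed.

Section FromQdense.
Variables (sa : bool) (U : normedStarAlgType R).
Hypothesis normM : forall a b : U, `|a ** b| <= `|a| * `|b|.

Let rM (a b : U) : rnorm (a ** b) <= rnorm a * rnorm b.
Proof. by rewrite -lecR rmorphM /= -!rnormE normM. Qed.

Lemma unitization_norm_le (a : U) (k : R[i]) :
  unitization_norm ((a, k) : unitization U) <= rnorm a + rnorm (k : R[i]^o).
Proof.
apply: ge_sup; first by exists (rnorm (a ** 0 + k *: 0)), 0 => //=; rewrite rnorm0.
move=> _ [b /= b1 <-].
rewrite (le_trans (rnormD _ _)) // lerD //.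
  by rewrite (le_trans (rM _ _)) // ler_piMr // rnorm_ge0.
by rewrite rnormZ ler_piMr // rnorm_ge0.
Qed.

(** With a unit [e], [a - e] is approximated and [e] added back; without one, [(a, k)] is treated as
    [k (1 + k^-1 a)]. Submultiplicativity is a separate hypothesis because the fixed point algebra
    is given only as a normed star-algebra. *)
Lemma qdense_rank : qdense sa U -> rank_prop sa U.
Proof.
move=> Q; split=> [[e ue] a d ssa d0|_ [a k] d ssa d0].
  have se : star e = e.
    by rewrite -[LHS](ue _).1 -[in RHS](starK e) -[in RHS](ue (star e)).1 starM starK.
  have [|b [c [sb [H1 H2] ab]]] := Q (a - e) d _ d0.
    by move=> s; rewrite starD starN ssa // se.
  exists (e + b); split.
  - by move=> s; rewrite starD se sb.
  - exists e, (e + c); split=> //.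
      rewrite amulDl !amulDr !(ue _).1 !(ue _).2 -[RHS]addr0 -{}H1; abel.
    rewrite amulDl !amulDr !(ue _).1 !(ue _).2 -[RHS]addr0 -{}H2; abel.
  - by rewrite opprD addrA.
(* A zero scalar part is replaced by the real number [d / 2], which costs half of the tolerance and
   keeps self-adjointness. *)
pose k' : R[i] := if k == 0 then (d / 2)%:C else k.
have k'0 : k' != 0.
  rewrite /k'; case: ifP => [_|/negbT//]; rewrite (inj_eq (@complexI R) _ 0).
  by rewrite gt_eqF // divr_gt0.
have kk' : rnorm (k - k' : R[i]^o) <= d / 2.
  rewrite /k'; case: eqP => [->|_]; last by rewrite subrr rnorm0 ltW // divr_gt0.
  by rewrite sub0r rnormN rnorm_real ger0_norm // ltW // divr_gt0.
have sk' : sa -> k'^* = k'.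
  move=> /ssa [_ sk]; rewrite /k'; case: ifP => // _.
  exact: conjc_real.
have n0 : 0 < rnorm (k' : R[i]^o).
  rewrite lt_neqAle rnorm_ge0 andbT eq_sym; apply: contra k'0 => /eqP H.
  by apply/eqP; apply: (@rnorm_eq0 _ R[i]^o); rewrite H.
have [||b [c [sb qb ab]]] := Q (k'^-1 *: a) (d / 2 / rnorm (k' : R[i]^o)).
- move=> s; have [sta _] := ssa s; rewrite starZ sta fmorphV.
  by congr (_^-1 *: _); exact: sk'.
- by rewrite !divr_gt0.
exists (k' *: b, k'); split.
- move=> s; apply: unitz_eqP => /=; last exact: sk'.
  by rewrite starZ sb //; congr (_ *: _); exact: sk'.
- exact: unitz_invertible qb.
- have -> : ((a, k) : unitization U) - (k' *: b, k') = (a - k' *: b, k - k') by [].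
  rewrite (le_lt_trans (unitization_norm_le _ _)) // [ltRHS]splitr ltr_leD //.
  have -> : a - k' *: b = k' *: (k'^-1 *: a - b) by rewrite scalerBr scalerA divff // scale1r.
  by rewrite rnormZ mulrC -ltr_pdivlMr.
Qed.
End FromQdense.

Section ToQdense.
Variables (sa : bool) (A : cstarAlgType R).

Lemma unitization_norm_bound (c : A) (k : R[i]) (b : A) :
  rnorm (c ** b + k *: b) <= unitization_norm ((c, k) : unitization A) * rnorm b.
Proof.
have [b0|b0] := leP (rnorm b) 0.
  by rewrite (rnorm_eq0 b0) amulr0 scaler0 addr0 rnorm0 mulr0.
rewrite -ler_pdivrMr //.
have bn : `|(rnorm b)^-1| = (rnorm b)^-1 by rewrite ger0_norm // invr_ge0 ltW.
have -> : rnorm (c ** b + k *: b) / rnorm b =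
    rnorm (c ** ((rnorm b)^-1%:C *: b) + k *: ((rnorm b)^-1%:C *: b)).
  rewrite amulZr !scalerA [k * _]mulrC -scalerA -scalerDr rnormZr mulrC.
  by rewrite bn.
apply: ub_le_sup; last first.
  by exists ((rnorm b)^-1%:C *: b) => //=; rewrite rnormZr bn mulVf ?gt_eqF.
exists (rnorm c + rnorm (k : R[i]^o)) => _ [x /= x1 <-].
rewrite (le_trans (rnormD _ _)) // lerD //.
  by rewrite (le_trans (rnormM _ _)) // ler_piMr // rnorm_ge0.
by rewrite rnormZ ler_piMr // rnorm_ge0.
Qed.

Lemma unitization_norm_ge0 (c : A) (k : R[i]) : 0 <= unitization_norm ((c, k) : unitization A).
Proof.
apply: (@le_trans _ _ (rnorm (c ** 0 + k *: 0))); first exact: rnorm_ge0.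
apply: ub_le_sup; last by exists 0; rewrite //= rnorm0.
exists (rnorm c + rnorm (k : R[i]^o)) => _ [x /= x1 <-].
rewrite (le_trans (rnormD _ _)) // lerD //.
  by rewrite (le_trans (rnormM _ _)) // ler_piMr // rnorm_ge0.
by rewrite rnormZ ler_piMr // rnorm_ge0.
Qed.

(* If [|1 - c|] were [< 1], the fixed point of [x |-> c + (1 - c) x] would be a
   left unit of [A]. *)
Lemma contraction_unital (c : A) (q : R) : 0 <= q -> q < 1 ->
  (forall b, rnorm (b - c ** b) <= q * rnorm b) -> unital A.
Proof.
move=> q0 q1 Hc.
pose u := fix u n : A := if n is m.+1 then c + (u m - c ** u m) else 0.
have Hu n : rnorm (u n.+1 - u n) <= rnorm c * q ^+ n.
  elim: n => [|n IH] /=; first by rewrite amulr0 !subr0 addr0 expr0 mulr1.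
  rewrite -/(u n.+1).
  have E x y : y = c + (x - c ** x) -> c + (y - c ** y) - y = (y - x) - c ** (y - x).
    by move=> yE; rewrite {3}yE; amul_ring.
  rewrite (E (u n)) //.
  by rewrite (le_trans (Hc _)) // exprS mulrCA ler_wpM2l.
have [e ue _] := geometric_cauchy_cvg q0 q1 Hu.
have ue1 : (fun n => u n.+1) @ \oo --> e by rewrite cvg_shiftS.
have ue2 : (fun n => u n.+1) @ \oo --> c + (e - c ** e).
  apply: cvgD; first exact: cvg_cst.
  by apply: cvgB => //; exact: cvg_amull.
have eE := rnorm_cvg_unique ue1 ue2.
have ceE : c ** e = c by apply/eqP; rewrite eq_sym -subr_eq0 -(inj_eq (addIr e)) add0r; apply/eqP; rewrite [RHS]eE; abel.
(* Since [c ** e = c], the element [e ** b - b] is killed by [c], and the contraction bound makes it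
   zero. *)
have el b : e ** b = b.
  apply/eqP; rewrite -subr_eq0; apply/eqP; apply: rnorm_eq0.
  have := Hc (e ** b - b); rewrite amulDr amulNr amulA ceE subrr subr0 => H.
  have : (1 - q) * rnorm (e ** b - b) <= 0 by rewrite mulrBl mul1r subr_le0.
  by rewrite pmulr_rle0 // subr_gt0.
have er b : b ** star e = b by rewrite -[in LHS](starK b) -starM el starK.
have se : star e = e by rewrite -[LHS]el er.
by exists e => b; rewrite el -{1}se er.
Qed.

(** If the norm were smaller than [|k|], left multiplication by [- k^-1 c] would be at distance less
    than 1 from the identity, and [A] would be unital by [contraction_unital]. *)
Lemma nonunital_scalar_le (c : A) (k : R[i]) : ~ unital A ->
  rnorm (k : R[i]^o) <= unitization_norm ((c, k) : unitization A).
Proof.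
move=> nu; rewrite leNgt; apply/negP => lt.
set n := unitization_norm _ in lt; apply: nu.
have k0' : 0 < rnorm (k : R[i]^o) := le_lt_trans (unitization_norm_ge0 c k) lt.
have k0 : k != 0 by apply: contraTneq k0' => ->; rewrite rnorm0 ltxx.
have n1 : rnorm (k^-1 : R[i]^o) * rnorm (k : R[i]^o) = 1.
  by rewrite -rnormZ [_ *: _]mulVf // (rnorm_real 1) normr1.
have kE : rnorm (k^-1 : R[i]^o) = (rnorm (k : R[i]^o))^-1.
  by apply: (mulIf (negbT (gt_eqF k0'))); rewrite n1 mulVf // gt_eqF.
apply: (@contraction_unital (- (k^-1 *: c)) (n / rnorm (k : R[i]^o))).
- by rewrite divr_ge0 // ?rnorm_ge0 // unitization_norm_ge0.
- by rewrite ltr_pdivrMr // mul1r.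
move=> b.
have -> : b - - (k^-1 *: c) ** b = k^-1 *: (c ** b + k *: b).
  by rewrite amulNl opprK amulZl scalerDr scalerA mulVf // scale1r addrC.
by rewrite rnormZ kE mulrC mulrAC ler_pM2r ?invr_gt0 // unitization_norm_bound.
Qed.

Lemma rank_qdense : rank_prop sa A -> qdense sa A.
Proof.
move=> [Hu Hn] a d ssa d0.
have [uA|nA] := pselect (unital A).
  have [e ue] := uA.
  have se : star e = e.
    by rewrite -[LHS](ue _).1 -[in RHS](starK e) -[in RHS](ue (star e)).1 starM starK.
  have [|b [sb [e' [b' [ue' H1 H2]]] ab]] := Hu uA (e + a) d _ d0.
    by move=> s; rewrite starD se ssa.
  have ee := unit_elt_uniq ue' ue; rewrite {}ee in H1 H2.
  exists (b - e), (b' - e); split.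
  - by move=> s; rewrite starD starN se sb.
  - split.
      rewrite amulDl !amulDr !amulNl !amulNr !(ue _).1 !(ue _).2 H1; abel.
    rewrite amulDl !amulDr !amulNl !amulNr !(ue _).1 !(ue _).2 H2; abel.
  - have -> : a - (b - e) = e + a - b by abel.
    by [].
have a3 : 0 < rnorm a + 3 by rewrite ltr_wpDl // rnorm_ge0.
(* [t <= 1 / 2] keeps [|k| >= 1 / 2], hence [|k^-1| <= 2]. The total error is at most
   [2 t + 2 t (|a| + 1)], strictly less than [2 t (|a| + 3) <= d]. *)
pose t := Num.min (1 / 2) (d / (2 * (rnorm a + 3))).
have t0 : 0 < t by rewrite lt_min !divr_gt0 // mulr_gt0.
have t1 : t <= 1 / 2 by rewrite ge_min lexx.
have t2 : t * (2 * (rnorm a + 3)) <= d by rewrite -ler_pdivlMr ?mulr_gt0 // ge_min lexx orbT.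
have [|[b k] [sb ib ab]] := Hn nA ((a, 1) : unitization A) t _ t0.
  by move=> s; apply: unitz_eqP; rewrite /= ?ssa // rmorph1.
have [k0 [c qc]] := invertible_unitz ib.
exists (k^-1 *: b), c; split=> //.
  move=> s; have [H1 H2] := sb s; rewrite starZ H1 fmorphV; congr (_^-1 *: _).
  exact: H2.
have E : ((a, 1) : unitization A) - (b, k) = (a - b, 1 - k) by [].
rewrite {}E in ab.
have k1 : rnorm (1 - k : R[i]^o) < t := le_lt_trans (nonunital_scalar_le _ _ nA) ab.
(* The operator norm is tested on [star (a - b)]: the C*-identity gives [|a - b|^2] on the left, and
   one factor [|a - b|] cancels. *)
have ab2 : rnorm (a - b) <= 2 * t.
  have [H|H] := leP (rnorm (a - b)) 0; first by rewrite (le_trans H) // mulr_ge0 // ltW.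
  rewrite -(ler_pM2r H) -[X in X * rnorm _ <= _]rnorm_star -[X in _ * X <= _]rnorm_star.
  rewrite -expr2 -rnorm_star_mul starK -[X in _ <= _ * X]rnorm_star.
  rewrite (le_trans (rnorm_le_sub _ ((a - b) ** star (a - b) + (1 - k) *: star (a - b)))) //.
  have -> x y : x - (x + y) = - y :> A by abel.
  rewrite rnormN [2 * t]mulr_natl mulr2n mulrDl lerD //.
    by rewrite (le_trans (unitization_norm_bound _ _ _)) // ler_wpM2r ?rnorm_ge0 // ltW.
  by rewrite rnormZ ler_wpM2r ?rnorm_ge0 // ltW.
have kn0 : 0 < rnorm (k : R[i]^o).
  have := rnorm_le_sub (1 : R[i]^o) k; rewrite (rnorm_real 1) normr1 => H.
  lra.
have kh : 1 / 2 <= rnorm (k : R[i]^o).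
  by have := rnorm_le_sub (1 : R[i]^o) k; rewrite (rnorm_real 1) normr1 => H; lra.
have bn : rnorm b <= rnorm a + 1.
  by rewrite (le_trans (rnorm_le_sub _ a)) // rnormC lerD2l; lra.
have n1 : rnorm (k^-1 : R[i]^o) * rnorm (k : R[i]^o) = 1.
  by rewrite -rnormZ [_ *: _]mulVf // (rnorm_real 1) normr1.
have ki2 : rnorm (k^-1 : R[i]^o) <= 2.
  rewrite -(ler_pM2r kn0) n1; lra.
have -> : a - k^-1 *: b = (a - b) + (k^-1 * (k - 1)) *: b.
  by rewrite mulrBr mulVf // mulr1 scalerBl scale1r; abel.
rewrite (le_lt_trans (rnormD _ _)) // rnormZ.
have H : rnorm (k^-1 * (k - 1) : R[i]^o) <= 2 * t.
  rewrite -[_ * _]/(k^-1 *: (k - 1 : R[i]^o)) rnormZ rnormC.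
  by rewrite ler_pM ?rnorm_ge0 // ltW.
have H2 : rnorm (k^-1 * (k - 1) : R[i]^o) * rnorm b <= 2 * t * (rnorm a + 1).
  by rewrite ler_pM ?rnorm_ge0.
nra.
Qed.
End ToQdense.
End Rank.

(** * Contractivity of star-homomorphisms *)

(** If [x / y = 1 + d] with [d > 0], Bernoulli's inequality at exponent [2^n], squared, makes the
    left side grow like [(d 2^n)^2], while the right side allows only [2 C 2^n]. A factor linear in
    the exponent is therefore harmless. *)
Lemma pow2_le (R : realType) (x y C : R) : 0 <= x -> 0 <= y -> 0 <= C ->
  (forall n, x ^+ (2 ^ n) <= C * (2 ^ n)%:R * y ^+ (2 ^ n)) -> x <= y.
Proof.
move=> x0 y0 C0 H.
have [y1|y1] := leP y 0.
  have yE : y = 0 by apply/eqP; rewrite eq_le y0 y1.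
  by have := H 0%N; rewrite expn0 !expr1 yE mulr0.
rewrite leNgt; apply/negP => yx.
pose d := x / y - 1.
have d0 : 0 < d by rewrite subr_gt0 ltr_pdivlMr // mul1r.
have zE : x / y = 1 + d by rewrite /d addrC subrK.
have Hz n : (1 + d) ^+ (2 ^ n) <= C * (2 ^ n)%:R.
  by rewrite -zE expr_div_n ler_pdivrMr ?exprn_gt0.
have Hb n : 1 + d * n%:R <= (1 + d) ^+ n.
  elim: n => [|n IH]; first by rewrite mulr0 addr0 expr0.
  rewrite exprS -natr1; have n0 : 0 <= n%:R :> R by rewrite ler0n.
  have d1 : 0 <= 1 + d by rewrite addr_ge0 // ltW.
  apply: le_trans (ler_wpM2l d1 IH); nra.
have Hc n : d ^+ 2 * (2 ^ n)%:R <= 2 * C.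
  have := Hz n.+1; rewrite expnS [(2 * 2 ^ n)%N]mulnC exprM natrM.
  have n0 : 0 < (2 ^ n)%:R :> R by rewrite ltr0n expn_gt0.
  have := Hb (2 ^ n)%N; set m := (2 ^ n)%:R in n0 *; set z := (1 + d) ^+ (2 ^ n).
  move=> h1 h2; rewrite -(ler_pM2r n0).
  have : (d * m) ^+ 2 <= z ^+ 2.
    have dm : 0 < d * m by rewrite mulr_gt0.
    by rewrite ler_pXn2r // ?nnegrE; lra.
  nra.
pose N := Num.Def.archi_bound (2 * C / d ^+ 2).
have : 2 * C / d ^+ 2 < N%:R.
  by apply: archi_boundP; apply: divr_ge0; [rewrite mulr_ge0|rewrite exprn_ge0 // ltW].
rewrite ltr_pdivrMr ?exprn_gt0 // ltNge => /negP; apply.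
apply: le_trans (Hc N); rewrite mulrC ler_pM2l ?exprn_gt0 //.
by rewrite ler_nat ltnW // ltn_expl.
Qed.

Section StarHom.
Variables (R : realType) (A B : cstarAlgType R) (f : A -> B).
Hypothesis fhom : star_hom f.

Let f0 : f 0 = 0.
Proof. by have [l _ _] := fhom; have := l (-1) 0 0; rewrite !scaleN1r !addNr. Qed.
Let fD a b : f (a + b) = f a + f b.
Proof. by have [l _ _] := fhom; have := l 1 a b; rewrite !scale1r. Qed.
Let fZ k a : f (k *: a) = k *: f a.
Proof. by have [l _ _] := fhom; have := l k a 0; rewrite f0 !addr0. Qed.
Let fM a b : f (a ** b) = f a ** f b.
Proof. by have [_ ? _] := fhom. Qed.
Let fS a : f (star a) = star (f a).
Proof. by have [_ _ ?] := fhom. Qed.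

Let half (V : lmodType R[i]) (x : V) : V := (1 / 2)%:C *: x.
Let halfE (V : lmodType R[i]) (x : V) : half x + half x = x.
Proof. by rewrite -scalerDl -rmorphD -splitr scale1r. Qed.

(* [1 + s] is a square root of [1 - h ** h]. *)
Lemma sqrt_one_sub_sq (h : A) : star h = h -> rnorm h <= 1 / 2 ->
  exists s : A, [/\ star s = s, h ** s = s ** h & s + s + s ** s = - (h ** h)].
Proof.
move=> sh h12.
(* Fixed point iteration of [x |-> - (h h + x x) / 2], which preserves the ball of radius [1 / 2]
   and contracts successive differences by [1 / 2]. *)
have [u [u0 uS]] : exists u : nat -> A, u 0%N = 0 /\ forall n, u n.+1 = - half (h ** h + u n ** u n).
  by exists (fix u n : A := if n is m.+1 then - half (h ** h + u m ** u m) else 0).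
have us n : star (u n) = u n.
  elim: n => [|n IH]; first by rewrite u0 star0.
  by rewrite uS starN starZ starD !starM sh IH; congr (- (_ *: _)); exact: conjc_real.
have uc n : h ** u n = u n ** h.
  elim: n => [|n IH]; first by rewrite u0 amul0r amulr0.
  rewrite uS amulNr amulNl amulZr amulZl amulDr amulDl; congr (- (_ *: (_ + _))).
    by rewrite amulA.
  by rewrite amulA IH -amulA IH amulA.
have hn (x : A) : rnorm (half x) = rnorm x / 2.
  by rewrite rnormZr ger0_norm ?divr_ge0 // mul1r mulrC.
have un n : rnorm (u n) <= 1 / 2.
  elim: n => [|n IH]; first by rewrite u0 rnorm0 divr_ge0.
  rewrite uS rnormN hn.
  have := rnormD (h ** h) (u n ** u n); have := rnormM h h; have := rnormM (u n) (u n).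
  have := rnorm_ge0 h; have := rnorm_ge0 (u n); nra.
have ud n : rnorm (u n.+2 - u n.+1) <= 1 / 2 * rnorm (u n.+1 - u n).
  have -> : u n.+2 - u n.+1 = half ((u n - u n.+1) ** u n + u n.+1 ** (u n - u n.+1)).
    have E (a b c : A) : - half (a + b) - - half (a + c) = half (c - b).
      by rewrite /half !scalerDr scalerN; abel.
    rewrite [u n.+2]uS {3}[u n.+1]uS E; congr half.
    move: (u n.+1) (u n) => x y; amul_ring.
  rewrite hn mul1r mulrC ler_pM2l ?invr_gt0 //.
  rewrite (le_trans (rnormD _ _)) //.
  rewrite [rnorm (_ - u n)]rnormC.
  have := rnormM (u n - u n.+1) (u n); have := rnormM (u n.+1) (u n - u n.+1).
  have := un n; have := un n.+1; have := rnorm_ge0 (u n - u n.+1).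
  nra.
have Hu n : rnorm (u n.+1 - u n) <= rnorm (u 1%N - u 0%N) * (1 / 2) ^+ n.
  elim: n => [|n IH]; first by rewrite expr0 mulr1.
  rewrite (le_trans (ud n)) // exprS mulrCA ler_wpM2l // divr_ge0 //.
have [||s us' _] := geometric_cauchy_cvg _ _ Hu; [by rewrite divr_ge0|by lra|].
exists s; split.
- apply: (@rnorm_cvg_unique _ _ (fun n => star (u n))); first exact: cvg_star.
  by under eq_fun do rewrite us.
- apply: (@rnorm_cvg_unique _ _ (fun n => h ** u n)); first exact: cvg_amull.
  under eq_fun do rewrite uc.
  exact: cvg_amulr.
have us1 : (fun n => u n.+1 + u n.+1) @ \oo --> s + s.
  by apply: cvgD; rewrite cvg_shiftS.
have us2 : (fun n => u n.+1 + u n.+1) @ \oo --> - (h ** h + s ** s).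
  under eq_fun do rewrite uS -opprD halfE.
  apply: cvgN; apply: cvgD; first exact: cvg_cst.
  exact: cvg_amul.
by rewrite (rnorm_cvg_unique us1 us2); abel.
Qed.

(** [f h] is the mean of [f h + i (1 + f s)] and [f h - i (1 + f s)]. Both multiply isometrically
    from the left, since [f h] and [f s] commute and [(f h)^2 + (1 + f s)^2 = 1]. Hence
    [|f h b| <= |b|], which is applied to [b = f h]. *)
Lemma star_hom_sa1 (h : A) : star h = h -> rnorm h <= 1 / 2 -> rnorm (f h) <= 1.
Proof.
move=> sh h12; have [s [ss hs sE]] := sqrt_one_sub_sq sh h12.
have E1 (b : B) (c : R[i]) : c * c = -1 -> c^* = - c ->
    rnorm (f h ** b + c *: (b + f s ** b)) = rnorm b.
  move=> c1 c2; apply/eqP; rewrite -(@eqrXn2 _ 2) ?rnorm_ge0 // -!rnorm_star_mul.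
  rewrite starD starZ starD !starM -!fS sh ss [Num.conj c]c2.
  have -> : (star b ** f h + - c *: (star b + star b ** f s)) **
      (f h ** b + c *: (b + f s ** b)) =
    star b ** b + star b ** (f h ** f h) ** b + star b ** (f s + f s + f s ** f s) ** b
    + c *: (star b ** (f h ** f s - f s ** f h) ** b).
    rewrite ?(amulDl, amulDr, scalerDr, amulZl, amulZr, amulNl, amulNr, scaleNr, scalerN, scalerA).
    rewrite c1 !scaleN1r ?amulA; abel.
  rewrite -!fM -!fD sE hs subrr amulr0 amul0r scaler0 addr0.
  have -> : f (- (h ** h)) = - f (h ** h) by rewrite -scaleN1r fZ scaleN1r.
  by rewrite amulNr amulNl addrK.
have E2 b : rnorm (f h ** b) <= rnorm b.
  have -> : f h ** b = half ((f h ** b + 'i *: (b + f s ** b)) + (f h ** b + (- 'i) *: (b + f s ** b))).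
    by rewrite -[LHS]halfE -scalerDr; congr (_ *: _); rewrite scaleNr; abel.
  rewrite rnormZr ger0_norm ?divr_ge0 //.
  have i2 : 'i * 'i = -1 :> R[i] by rewrite -expr2 sqrCi.
  have c1 : ('i : R[i])^* = - 'i by rewrite [LHS]conjCi.
  have := E1 b 'i i2 c1.
  have := E1 b (- 'i) _ _; rewrite mulrNN opprK i2 => /(_ erefl).
  have cN (c : R[i]) : c^* = - c -> (- c)^* = c.
    move=> cE; exact: (etrans (rmorphN (@Num.conj R[i]) c) (etrans (congr1 -%R cE) (opprK c))).
  have c2 := cN _ c1.
  move=> /(_ c2) h1 h2.
  by rewrite (le_trans (ler_wpM2l _ (rnormD _ _))) ?divr_ge0 // h1 h2; lra.
have := E2 (f h); rewrite -{1}sh fS rnorm_star_mul => H.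
have := rnorm_ge0 (f h); nra.
Qed.

Lemma rnorm_iter_sq (C : cstarAlgType R) (h : C) n : star h = h ->
  star (iter n (fun x => x ** x) h) = iter n (fun x => x ** x) h /\
  rnorm (iter n (fun x => x ** x) h) = rnorm h ^+ (2 ^ n).
Proof.
move=> sh; elim: n => [|n [IH1 IH2]] //=; split; first by rewrite starM IH1.
by rewrite -{1}IH1 rnorm_star_mul IH2 -exprM expnS mulnC.
Qed.

(** Rescaling gives the bound with constant 2. Applied to [h^(2^n)], whose norm is [|h|^(2^n)], it
    loses the constant by [pow2_le]. *)
Lemma star_hom_sa (h : A) : star h = h -> rnorm (f h) <= rnorm h.
Proof.
have H2 (x : A) : star x = x -> rnorm (f x) <= 2 * rnorm x.
  move=> sx; have [x0|x0] := leP (rnorm x) 0.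
    by rewrite (rnorm_eq0 x0) f0 !rnorm0 mulr0.
  pose c := (2 * rnorm x)^-1.
  have c0 : 0 < c by rewrite invr_gt0 mulr_gt0.
  have := @star_hom_sa1 (c%:C *: x).
  rewrite starZ sx fZ !rnormZr ger0_norm ?(ltW c0) // => H.
  have E : c * rnorm x = 1 / 2.
    by rewrite /c invfM -mulrA mulVf ?mulr1 ?mul1r // gt_eqF.
  have : c * rnorm (f x) <= 1.
    apply: H; last by rewrite E.
    by congr (_ *: _); exact: conjc_real.
  by rewrite -ler_pdivlMl // /c invrK mulr1.
move=> sh; apply: (@pow2_le _ _ _ 2); rewrite ?rnorm_ge0 // => n.
have sfh : star (f h) = f h by rewrite -fS sh.
rewrite -(rnorm_iter_sq n sfh).2 -(rnorm_iter_sq n sh).2.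
have -> : iter n (fun x => x ** x) (f h) = f (iter n (fun x => x ** x) h).
  by elim: n => //= n ->; rewrite fM.
rewrite (le_trans (H2 _ (rnorm_iter_sq n sh).1)) // ler_wpM2r ?rnorm_ge0 //.
by rewrite ler_peMr // ler1n expn_gt0.
Qed.

Lemma star_hom_contractive (a : A) : rnorm (f a) <= rnorm a.
Proof.
rewrite -(@ler_pXn2r _ 2) ?nnegrE ?rnorm_ge0 // -!rnorm_star_mul -fS -fM.
by apply: star_hom_sa; rewrite starM starK.
Qed.
End StarHom.

Section ActNorm.
Variables (R : realType) (G : topologicalGroupType) (A : cstarAlgType R).
Variable alpha : cstarAction G A.

Lemma actK g a : alpha (g^-1)%g (alpha g a) = a.
Proof. by rewrite -actM mulVg act1. Qed.

Lemma actKV g a : alpha g (alpha (g^-1)%g a) = a.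
Proof. by rewrite -actM mulgV act1. Qed.

Lemma rnorm_act g a : rnorm (alpha g a) = rnorm a.
Proof.
apply/eqP; rewrite eq_le (star_hom_contractive (act_hom alpha g)).
by rewrite -{1}(actK g a) (star_hom_contractive (act_hom alpha _)).
Qed.

Lemma actN g a : alpha g (- a) = - alpha g a.
Proof. by rewrite -scaleN1r actZ scaleN1r. Qed.

Lemma actB g a b : alpha g (a - b) = alpha g a - alpha g b.
Proof. by rewrite actD actN. Qed.
End ActNorm.

(** * Means on compact groups *)

Section Averages.
Variables (R : realType) (V : normedModType R[i]).

Definition avg (I : Type) (s : seq I) (F : I -> V) : V :=
  ((size s)%:R^-1 : R)%:C *: \sum_(i <- s) F i.

Lemma avg_const (I : Type) (s : seq I) (c : V) : (0 < size s)%N -> avg s (fun=> c) = c.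
Proof.
move=> s0; rewrite /avg big_const_seq count_predT iter_addr_0 -[c *+ _]scaler_nat scalerA.
have -> : (size s)%:R = ((size s)%:R : R)%:C by rewrite rmorph_nat.
by rewrite -rmorphM mulVf ?scale1r // pnatr_eq0 -lt0n.
Qed.

Lemma avgB (I : Type) (s : seq I) (F H : I -> V) :
  avg s F - avg s H = avg s (fun i => F i - H i).
Proof. by rewrite /avg -scalerBr -sumrB. Qed.

Lemma avg_sum_le (I : Type) (s : seq I) (F : I -> V) :
  rnorm (avg s F) <= (size s)%:R^-1 * \sum_(i <- s) rnorm (F i).
Proof.
by rewrite /avg rnormZr ger0_norm ?invr_ge0 // ler_wpM2l ?invr_ge0 // rnorm_sum.
Qed.

Lemma avg_le (I : Type) (s : seq I) (F : I -> V) (M : R) : (0 < size s)%N ->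
  (forall i, rnorm (F i) <= M) -> rnorm (avg s F) <= M.
Proof.
move=> s0 FM; rewrite (le_trans (avg_sum_le _ _)) // ler_pdivrMl ?ltr0n //.
rewrite (@le_trans _ _ (\sum_(i <- s) M)) //; first exact: ler_sum.
by rewrite big_const_seq count_predT iter_addr_0 mulr_natl.
Qed.

Lemma avg_near (I : Type) (s : seq I) (F : I -> V) (c : V) (M : R) : (0 < size s)%N ->
  (forall i, rnorm (F i - c) <= M) -> rnorm (avg s F - c) <= M.
Proof. by move=> s0 FM; rewrite -(avg_const c s0) avgB; apply: avg_le. Qed.

Lemma avg_map (I J : Type) (f : J -> I) (s : seq J) (F : I -> V) :
  avg (map f s) F = avg s (fun j => F (f j)).
Proof. by rewrite /avg size_map big_map. Qed.

Lemma avg_allpairs (I J K : Type) (f : I -> J -> K) (s : seq I) (t : seq J) (F : K -> V) :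
  avg [seq f i j | i <- s, j <- t] F = avg s (fun i => avg t (fun j => F (f i j))).
Proof.
rewrite /avg size_allpairs big_allpairs_dep natrM invfM rmorphM -scalerA; congr (_ *: _).
by rewrite scaler_sumr.
Qed.

Lemma avg_exchange (I J : Type) (s : seq I) (t : seq J) (F : I -> J -> V) :
  avg s (fun i => avg t (fun j => F i j)) = avg t (fun j => avg s (fun i => F i j)).
Proof.
rewrite /avg -!scaler_sumr !scalerA mulrC; congr (_ *: _); exact: exchange_big.
Qed.

End Averages.

Lemma avg_linear (R : realType) (V W : normedModType R[i]) (f : V -> W) (I : Type)
    (s : seq I) (F : I -> V) : linear f -> f (avg s F) = avg s (fun i => f (F i)).
Proof.
move=> lf; have f0 : f 0 = 0 by have := lf (-1) 0 0; rewrite !scaleN1r !addNr.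
have fZ k x : f (k *: x) = k *: f x by have := lf k x 0; rewrite f0 !addr0.
have fD x y : f (x + y) = f x + f y by have := lf 1 x y; rewrite !scale1r.
by rewrite /avg fZ (big_morph f fD f0).
Qed.

Section Compactness.
Variables (G : topologicalGroupType).
Hypothesis cptG : compact [set: G].

Lemma finite_nbhs_cover (U : G -> set G) : (forall p, nbhs p (U p)) ->
  exists ps : seq G, forall s, exists2 p, p \in ps & U p s.
Proof.
move=> HU.
have : cover_compact [set: G] by rewrite -compact_cover.
move=> /(_ G setT (fun p => (U p)^°))[p _|s _|D _ HD].
- exact: open_interior.
- by exists s => //; exact: HU.
exists (finmap.enum_fset D) => s; have [p pD Up] := HD s I.
by exists p => //; exact: interior_subset Up.
Qed.

Lemma near_compact (I : Type) (F : set_system I) {FF : Filter F} (P : I -> G -> Prop) :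
  (forall x : G, \forall x' \near x & i \near F, P i x') -> \forall i \near F, forall x, P i x.
Proof.
move=> H; have /compact_near_coveringP/(_ _ _ P FF) := cptG.
move=> /(_ (fun x _ => H x)); apply: filterS => i Hi x; exact: Hi.
Qed.

Lemma near_compact2 (I : Type) (F : set_system I) {FF : Filter F} (P : I -> G -> G -> Prop) :
  (forall x y : G, \forall xy \near (x, y) & i \near F, P i xy.1 xy.2) ->
  \forall i \near F, forall x y, P i x y.
Proof.
move=> H.
have cc : compact [set: G * G] by rewrite -setXTT; exact: compact_setX.
have /compact_near_coveringP/(_ _ _ (fun i xy => P i xy.1 xy.2) FF) := cc.
move=> h; have {}h := h (fun x _ => let: (a, b) := x return \forall x' \near x & i \near F, P i x'.1 x'.2 in H a b).
by apply: filterS h => i Hi x y; apply: (Hi (x, y)).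
Qed.
End Compactness.

Section GroupContinuity.
Variables (G : topologicalGroupType) (T : Type) (F : set_system T).
Context {FF : Filter F}.

Lemma cvg_mulg (f h : T -> G) (a b : G) :
  f @ F --> a -> h @ F --> b -> (fun x => f x * h x)%g @ F --> (a * b)%g.
Proof.
move=> fa hb; apply: (@continuous2_cvg _ _ _ _ F _ f h (fun x y : G => (x * y)%g) a b) fa hb.
exact: (@mulg_continuous G (a, b)).
Qed.

Lemma cvg_invg (f : T -> G) (a : G) : f @ F --> a -> (fun x => (f x)^-1)%g @ F --> (a^-1)%g.
Proof. by move=> fa; apply: (cvg_comp _ _ fa); exact: (@invg_continuous G a). Qed.
End GroupContinuity.

Section Means.
Variables (R : realType) (G : topologicalGroupType) (V : normedModType R[i]).
Hypothesis cptG : compact [set: G].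
Implicit Types F : G -> V.

Lemma cpt_rnorm_bounded F : continuous F -> exists M, forall t, rnorm (F t) <= M.
Proof.
move=> cF; have [p|ps Hps] := finite_nbhs_cover cptG (U := fun p => [set t | rnorm (F t - F p) < 1]).
  by have /rnorm_cvgP := cF p; apply.
exists (1 + \sum_(p <- ps) rnorm (F p)) => t; have [p pps] := Hps t => /= Ht.
rewrite (le_trans (rnorm_le_sub _ (F p))) // addrC lerD // ?(ltW Ht) //.
by rewrite (big_rem p) //= lerDl sumr_ge0 // => i _; exact: rnorm_ge0.
Qed.

(** The free factor [g] on the left lets the estimate survive averaging over left translates; [h]
    and [z] sit in the middle because averages are composed there. *)
Lemma uniform_translate F (d : R) : continuous F -> 0 < d ->
  exists2 hs : seq G, (0 < size hs)%N &
    forall z, exists2 h, h \in hs & forall g t, rnorm (F (g * h * t)%g - F (g * z * t)%g) <= d.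
Proof.
move=> cF d0.
have [p|ps Hps] := finite_nbhs_cover cptG
    (U := fun p => [set h | forall g t, rnorm (F (g * p * t)%g - F (g * h * t)%g) <= d]).
  apply: near_compact2 => // g t.
  have d2 : 0 < d / 2 by rewrite divr_gt0.
  have c1 : (fun x : (G * G) * G => F (x.1.1 * p * x.1.2)%g) @ nbhs ((g, t), p) --> F (g * p * t)%g.
    have h : (fun x : (G * G) * G => (x.1.1 * p * x.1.2)%g) @ nbhs ((g, t), p) --> (g * p * t)%g.
      apply: cvg_mulg; first apply: cvg_mulg.
      - apply: (cvg_comp _ _ cvg_fst); exact: cvg_fst.
      - exact: cvg_cst.
      - apply: (cvg_comp _ _ cvg_fst); exact: cvg_snd.
    exact: (cvg_comp _ _ h (cF _)).
  have c2 : (fun x : (G * G) * G => F (x.1.1 * x.2 * x.1.2)%g) @ nbhs ((g, t), p) --> F (g * p * t)%g.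
    have h : (fun x : (G * G) * G => (x.1.1 * x.2 * x.1.2)%g) @ nbhs ((g, t), p) --> (g * p * t)%g.
      apply: cvg_mulg; first apply: cvg_mulg.
      - apply: (cvg_comp _ _ cvg_fst); exact: cvg_fst.
      - exact: cvg_snd.
      - apply: (cvg_comp _ _ cvg_fst); exact: cvg_snd.
    exact: (cvg_comp _ _ h (cF _)).
  have /rnorm_cvgP/(_ _ d2) H1 := c1.
  have /rnorm_cvgP/(_ _ d2) H2 := c2.
  near=> x => /=.
  rewrite (le_trans (rnorm_tri (F (g * p * t)%g) _ _)) // [leRHS]splitr lerD // ltW //.
    by near: x.
  by rewrite rnormC; near: x.
exists ps; first by have [p + _] := Hps 1%g; case: (ps).
by move=> z; have [p pps Hp] := Hps z; exists p.
Unshelve. all: by end_near. Qed.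

Definition lavg (s : seq G) F (t : G) : V := avg s (fun g => F (g * t)%g).

Lemma lavg_lavg s s' F t :
  lavg s' (lavg s F) t = lavg [seq (g * h)%g | g <- s, h <- s'] F t.
Proof.
rewrite /lavg avg_allpairs avg_exchange; congr avg; apply/funext => g.
by congr avg; apply/funext => h; rewrite mulgA.
Qed.

Lemma lavg_continuous s F : continuous F -> continuous (lavg s F).
Proof.
move=> cF t; apply: cvgZl_tmp; elim: s => [|g s IH].
  under eq_fun do rewrite big_nil.
  by rewrite big_nil; exact: cvg_cst.
under eq_fun do rewrite big_cons.
rewrite big_cons; apply: cvgD => //.
have h : (fun x => g * x)%g @ nbhs t --> (g * t)%g by apply: cvg_mulg; [exact: cvg_cst|exact: cvg_id].
exact: (cvg_comp _ _ h (cF _)).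
Qed.

(** Averaging over a net of [N] translates shrinks an oscillation [d + K] to [d + (1 - 1 / N) K]:
    for any two points, one of the translates moves the first to within [d] of the value at the
    second, and the other [N - 1] obey the old bound. Iteration makes the second term smaller than
    [d = e / 2]. *)
Lemma osc_lavg F (e : R) : continuous F -> 0 < e ->
  exists2 s : seq G, (0 < size s)%N & forall t t', rnorm (lavg s F t - lavg s F t') <= e.
Proof.
move=> cF e0; have d0 : 0 < e / 2 by rewrite divr_gt0.
have [hs hs0 Hhs] := uniform_translate cF d0.
set d := e / 2 in d0 Hhs; set N := size hs in hs0.
have [C HC] := cpt_rnorm_bounded cF.
have N0 : 0 < N%:R :> R by rewrite ltr0n.
pose q := 1 - N%:R^-1 : R.
have q0 : 0 <= q by rewrite subr_ge0 invf_le1 // ler1n.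
have q1 : q < 1 by rewrite ltrBlDr ltrDl invr_gt0.
have step K s : (0 < size s)%N -> (forall t t', rnorm (lavg s F t - lavg s F t') <= d + K) ->
    exists2 s', (0 < size s')%N & forall t t', rnorm (lavg s' F t - lavg s' F t') <= d + q * K.
  move=> s0 Hs; exists [seq (g * h)%g | g <- s, h <- hs].
    by rewrite size_allpairs muln_gt0 s0.
  move=> t t'; rewrite -!lavg_lavg.
  have bd t1 y : rnorm (lavg hs (lavg s F) t1 - lavg s F y) <= d + q * K.
    rewrite {1}/lavg -(avg_const (lavg s F y) hs0) avgB.
    rewrite (le_trans (avg_sum_le _ _)) // ler_pdivrMl // -/N.
    (* The translate carrying [t1] close to [y] is the net point for [y t1^-1]. *)
    have [h hhs Hh] := Hhs (y * t1^-1)%g.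
    rewrite (big_rem h) //=.
    have H1 : rnorm (lavg s F (h * t1)%g - lavg s F y) <= d.
      rewrite /lavg avgB; apply: avg_le => // g.
      by have := Hh g t1; rewrite !mulgA mulgVK.
    have H2 : \sum_(g <- rem h hs) rnorm (lavg s F (g * t1)%g - lavg s F y) <= N.-1%:R * (d + K).
      rewrite (@le_trans _ _ (\sum_(g <- rem h hs) (d + K))) //; first exact: ler_sum.
      by rewrite big_const_seq count_predT iter_addr_0 size_rem // mulr_natl.
    rewrite (le_trans (lerD H1 H2)) //.
    have NE : N.-1%:R = N%:R - 1 :> R by rewrite -[in RHS](prednK hs0) -natr1 addrK.
    have -> : N%:R * (d + q * K) = N%:R * d + (N%:R - 1) * K.
      by rewrite /q; field; rewrite gt_eqF.
    by rewrite NE; lra.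
  rewrite rnormC {1}/lavg; apply: avg_near => // h.
  by rewrite rnormC; exact: bd.
have it n : exists2 s, (0 < size s)%N &
    forall t t', rnorm (lavg s F t - lavg s F t') <= d + q ^+ n * (2 * C).
  elim: n => [|n [s s0 Hs]].
    exists [:: 1%g] => // t t'.
    rewrite /lavg avgB; apply: avg_le => // g; rewrite expr0 mul1r.
    rewrite (le_trans (rnormB _ _)) // [2 * C]mulr_natl mulr2n.
    have := HC (g * t)%g; have := HC (g * t')%g; lra.
  by have [s' s'0 Hs'] := step _ _ s0 Hs; exists s' => // t t'; rewrite exprS -mulrA.
have : (fun n => q ^+ n * (2 * C)) @ \oo --> (0 : R).
  by rewrite -(mul0r (2 * C)); apply: cvgMr_tmp; apply: cvg_expr; rewrite ger0_norm.
move=> /cvgrPdist_lt/(_ d d0)[n _ Hn].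
have [s s0 Hs] := it n; exists s => // t t'.
rewrite (le_trans (Hs t t')) // [e]splitr lerD2l ltW //.
have := Hn n (leqnn n); rewrite sub0r normrN; apply: le_lt_trans; exact: ler_norm.
Qed.

(** The Haar integral after von Neumann, as a uniform limit of finite averages of translates. In
    this form it passes through bounded linear maps without measure theory. *)
Definition lmean F (c : V) := forall e : R, 0 < e ->
  exists2 s : seq G, (0 < size s)%N & forall t, rnorm (avg s (fun g => F (g * t)%g) - c) <= e.
Definition rmean F (c : V) := forall e : R, 0 < e ->
  exists2 s : seq G, (0 < size s)%N & forall t, rnorm (avg s (fun g => F (t * g)%g) - c) <= e.

(** A double average over left and right translates is close to both means at once; comparing it for
    [F] and [F'] compares the means. *)
Lemma mean_le F F' c c' M : lmean F c -> rmean F' c' ->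
  (forall t, rnorm (F t - F' t) <= M) -> rnorm (c - c') <= M.
Proof.
move=> Fc Fc' FM; apply/ler_addgt0Pr => e e0.
have e2 : 0 < e / 2 by rewrite divr_gt0.
have [s s0 Hs] := Fc _ e2; have [s' s'0 Hs'] := Fc' _ e2.
pose x := avg s' (fun h => avg s (fun g => F (g * h)%g)).
pose x' := avg s' (fun h => avg s (fun g => F' (g * h)%g)).
have H1 : rnorm (x - c) <= e / 2 by apply: avg_near.
have H2 : rnorm (x' - c') <= e / 2.
  by rewrite /x' avg_exchange; apply: avg_near.
have H3 : rnorm (x - x') <= M.
  by rewrite /x /x' avgB; apply: avg_le => // h; rewrite avgB; apply: avg_le.
have -> : c - c' = (x - x') - (x - c) + (x' - c') by abel.
rewrite (le_trans (rnormD _ _)) // [e]splitr addrA lerD //.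
by rewrite (le_trans (rnormB _ _)) // lerD.
Qed.

Lemma mean_uniq F c c' : lmean F c -> rmean F c' -> c = c'.
Proof.
move=> H1 H2; apply/eqP; rewrite -subr_eq0; apply/eqP/rnorm_eq0.
by apply: (mean_le H1 H2) => t; rewrite subrr rnorm0.
Qed.

Lemma rmean_inv F c : lmean (fun t => F (t^-1)%g) c -> rmean F c.
Proof.
move=> H e e0; have [s s0 Hs] := H e e0.
exists (map (fun g => g^-1)%g s); first by rewrite size_map.
move=> t; rewrite avg_map; have := Hs (t^-1)%g.
by under eq_fun do rewrite invgM invgK.
Qed.

End Means.

Lemma lmean_linear (R : realType) (G : topologicalGroupType) (V W : normedModType R[i])
    (f : V -> W) (C : R) (F : G -> V) c : linear f -> (forall x, rnorm (f x) <= C * rnorm x) ->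
  lmean F c -> lmean (fun t => f (F t)) (f c).
Proof.
move=> lf fC Fc e e0.
have C1 : 0 < `|C| + 1 by rewrite ltr_wpDl.
have [s s0 Hs] := Fc (e / (`|C| + 1)) (divr_gt0 e0 C1).
exists s => // t; rewrite -avg_linear //.
have -> x y : f x - f y = f (x - y) by have := lf (-1) y x; rewrite !scaleN1r [X in f X]addrC [RHS]addrC => ->.
rewrite (le_trans (fC _)) // (@le_trans _ _ ((`|C| + 1) * rnorm (avg s (fun g => F (g * t)%g) - c))) //.
  rewrite ler_wpM2r ?rnorm_ge0 // (le_trans (ler_norm _)) // lerDl //.
by rewrite -ler_pdivlMl // mulrC.
Qed.

Section MeanExists.
Variables (R : realType) (G : topologicalGroupType) (V : completeNormedModType R[i]).
Hypothesis cptG : compact [set: G].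
Implicit Types F : G -> V.

(** Averaging an average keeps its values within the old oscillation. Lists refined so that the
    oscillation falls below [2^-n] thus give a Cauchy sequence of values at 1. *)
Lemma lmean_exists F : continuous F -> exists c, lmean F c.
Proof.
move=> cF.
have step (p : seq G * nat) : exists s', (0 < size p.1)%N -> [/\ (0 < size s')%N,
    forall t t', rnorm (lavg s' F t - lavg s' F t') <= (1 / 2) ^+ p.2 &
    forall K, (forall t t', rnorm (lavg p.1 F t - lavg p.1 F t') <= K) ->
      forall t t', rnorm (lavg s' F t - lavg p.1 F t') <= K].
  case: p => s n /=.
  have [|s' s'0 Hs'] := @osc_lavg _ _ _ cptG (lavg s F) ((1 / 2) ^+ n) (lavg_continuous cF).
    by rewrite exprn_gt0 // divr_gt0.
  exists [seq (g * h)%g | g <- s, h <- s'] => s0; split.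
  - by rewrite size_allpairs muln_gt0 s0.
  - by move=> t t'; rewrite -!lavg_lavg.
  - move=> K HK t t'; rewrite -!lavg_lavg {1}/lavg; exact: avg_near.
have [nxt Hnxt] := choice step.
have [s0 s00 Hs0] := osc_lavg cptG cF ltr01.
pose sq := fix sq n := if n is m.+1 then nxt (sq m, n) else s0.
have Hsq n : (0 < size (sq n))%N /\
    forall t t', rnorm (lavg (sq n) F t - lavg (sq n) F t') <= (1 / 2) ^+ n.
  elim: n => [|n [IH1 IH2]]; first by rewrite expr0.
  by have [] := Hnxt (sq n, n.+1) IH1.
have Hd n t t' : rnorm (lavg (sq n.+1) F t - lavg (sq n) F t') <= (1 / 2) ^+ n.
  have [H1 H2] := Hsq n; have [_ _ H3] := Hnxt (sq n, n.+1) H1.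
  exact: H3.
have [|||c _ Hc] := @geometric_cauchy_cvg _ V (fun n => lavg (sq n) F 1%g) 1 (1 / 2).
- by rewrite divr_ge0.
- lra.
- by move=> n; rewrite mul1r.
exists c => e e0.
have : (fun n => (1 / 2) ^+ n) @ \oo --> (0 : R).
  by apply: cvg_expr; rewrite ger0_norm ?divr_ge0 //; lra.
have e3 : 0 < e / 3 by rewrite divr_gt0.
move=> /cvgrPdist_lt/(_ _ e3)[n _ Hn].
have := Hn n (leqnn n); rewrite sub0r normrN => /(le_lt_trans (ler_norm _)) {}Hn.
have [H1 H2] := Hsq n; exists (sq n) => // t.
have hE : (1 - 1 / 2)^-1 = 2 :> R by field.
have := Hc n; rewrite rnormC mul1r hE => Hcn.
rewrite (le_trans (rnorm_tri (lavg (sq n) F 1%g) _ _)) //.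
rewrite (le_trans (lerD Hcn (H2 1%g t))) //.
by move: ((1 / 2) ^+ n) Hn => y Hn; lra.
Qed.

Lemma mean_exists F : continuous F -> exists c, lmean F c /\ rmean F c.
Proof.
move=> cF; have [c Fc] := lmean_exists cF.
have [|c' /rmean_inv Fc'] := @lmean_exists (fun t => F (t^-1)%g).
  by move=> t; apply: (cvg_comp _ _ (cvg_invg (cvg_id))); exact: cF.
by exists c; split=> //; rewrite (mean_uniq Fc Fc').
Qed.
End MeanExists.

Section Expectation.
Variables (R : realType) (G : topologicalGroupType) (A : cstarAlgType R).
Variable alpha : cstarAction G A.
Hypothesis cptG : compact [set: G].
Implicit Types a b c x y : A.

(* The Haar integral of [t |-> alpha t a]. *)
Definition fixE (a : A) : A :=
  xget 0 [set c | lmean (fun t => alpha t a) c /\ rmean (fun t => alpha t a) c].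

Lemma fixE_mean a : lmean (fun t => alpha t a) (fixE a) /\ rmean (fun t => alpha t a) (fixE a).
Proof.
have [|c Hc] := @mean_exists _ _ _ cptG (fun t => alpha t a); first exact: act_continuous.
by apply: (@xgetPex _ 0 [set c | lmean (fun t => alpha t a) c /\ rmean (fun t => alpha t a) c]); exists c.
Qed.

Lemma fixE_fixed t a : alpha t (fixE a) = fixE a.
Proof.
apply/eqP; rewrite -subr_eq0; apply/eqP/rnorm_small_eq0 => e e0.
have e2 : 0 < e / 2 by rewrite divr_gt0.
(* The right mean is the relevant one: [alpha t] sends the average over [g] to the average of the
   values at [t * g]. *)
have [s s0 Hs] := (fixE_mean a).2 _ e2.
pose x := avg s (fun g => alpha g a).
have xE u : alpha u x = avg s (fun g => alpha (u * g)%g a).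
  rewrite /x avg_linear; last exact: actL.
  by congr avg; apply/funext => g; rewrite actM.
rewrite (le_trans (rnorm_tri (alpha t x) _ _)) // [leRHS]splitr lerD //; last by rewrite xE.
rewrite rnormC -actB rnorm_act; have := Hs 1%g.
by under eq_fun do rewrite mul1g.
Qed.

(** Averaging again cannot increase the distance from a fixed [y], so one finite average of the
    orbit already controls the integral. This is how finite sums in the sequence algebra give
    information on [fixE]. *)
Lemma fixE_near (s : seq G) (c y : A) (M : R) : (0 < size s)%N -> (forall g, alpha g y = y) ->
  rnorm (avg s (fun g => alpha g c) - y) <= M -> rnorm (fixE c - y) <= M.
Proof.
move=> s0 fy HM; apply/ler_addgt0Pr => e e0.
have [s' s'0 Hs'] := (fixE_mean c).1 _ e0.
pose x := avg s (fun g => alpha g c).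
pose z := avg s' (fun h => alpha h x).
have H1 : rnorm (z - y) <= M.
  by apply: avg_near => // h; rewrite -(fy h) -actB rnorm_act.
have H2 : rnorm (z - fixE c) <= e.
  have -> : z = avg s (fun g => avg s' (fun h => alpha (h * g)%g c)).
    rewrite avg_exchange; congr avg; apply/funext => h.
    rewrite /x avg_linear; last exact: actL.
    by congr avg; apply/funext => g; rewrite actM.
  by apply: avg_near.
by rewrite (le_trans (rnorm_tri z _ _)) // addrC lerD // rnormC.
Qed.

Lemma fixE_dist (c y : A) (M : R) : (forall g, alpha g y = y) ->
  rnorm (c - y) <= M -> rnorm (fixE c - y) <= M.
Proof.
move=> fy HM; apply: (@fixE_near [:: 1%g]) => //.
by apply: avg_near => // g; rewrite -(fy g) -actB rnorm_act.
Qed.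

Lemma fixE_close (c : A) (M : R) : (forall g, rnorm (alpha g c - c) <= M) ->
  rnorm (fixE c - c) <= M.
Proof.
move=> HM; apply/ler_addgt0Pr => e e0.
have [s s0 Hs] := (fixE_mean c).1 _ e0.
rewrite (le_trans (rnorm_tri (avg s (fun g => alpha (g * 1)%g c)) _ _)) // addrC lerD //.
  by apply: avg_near => // g; rewrite mulg1.
by rewrite rnormC.
Qed.

End Expectation.

(** * The norm of the sequence algebra *)

Lemma subalg_mapE (R : realType) (U : starAlgType R) (S : starSubalg U) (f : U -> U)
    (x : subalg_type S) : sset S (f (val x)) -> val (subalg_map f x) = f (val x).
Proof. by move=> Sf; rewrite /subalg_map insubdK // unfold_in inE. Qed.

Section SeqNorm.
Variables (R : realType) (A : cstarAlgType R).
Local Notation Ainf := (A_infty A).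
Implicit Types (a b : linf A) (x y z : Ainf).

Lemma linfD a b n : val (a + b) n = val a n + val b n. Proof. by []. Qed.
Lemma linfB a b n : val (a - b) n = val a n - val b n. Proof. by []. Qed.
Lemma linfZ (k : R[i]) a n : val (k *: a) n = k *: val a n. Proof. by []. Qed.
Lemma linfM a b n : val (a ** b) n = val a n ** val b n. Proof. by []. Qed.
Lemma linfS a n : val (star a) n = star (val a n). Proof. by []. Qed.
Lemma linf_ext a b : (forall n, val a n = val b n) -> a = b.
Proof. by move=> H; apply: val_inj; apply/funext. Qed.

Lemma etaD a b : Defs.eta a + Defs.eta b = Defs.eta (a + b). Proof. by rewrite /Defs.eta quot_piD. Qed.
Lemma etaZ (k : R[i]) a : k *: Defs.eta a = Defs.eta (k *: a). Proof. exact: quot_piZ. Qed.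
Lemma etaM a b : Defs.eta a ** Defs.eta b = Defs.eta (a ** b). Proof. exact: quot_piM. Qed.
Lemma etaS a : star (Defs.eta a) = Defs.eta (star a). Proof. exact: quot_pi_star. Qed.
Lemma etaN a : - Defs.eta a = Defs.eta (- a).
Proof. by rewrite -scaleN1r etaZ scaleN1r. Qed.
Lemma etaB a b : Defs.eta a - Defs.eta b = Defs.eta (a - b). Proof. by rewrite etaN etaD. Qed.
Lemma etaK x : Defs.eta (repr x) = x. Proof. exact: quot_piK. Qed.

Lemma eta_eq0P a : Defs.eta a = 0 <-> val a @ \oo --> (0 : A).
Proof.
have -> : (0 : Ainf) = Defs.eta 0 by rewrite /Defs.eta /quot_pi raddf0.
by rewrite /Defs.eta quot_eqP /= subr0.
Qed.

Lemma linf_bounded a : exists2 M : R, 0 <= M & forall n, rnorm (val a n) <= M.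
Proof.
have [M HM] := subalg_valP a; exists (complex.Re M).
  by rewrite -lecR; have := le_trans (normr_ge0 _) (HM 0%N); rewrite !lecE /= => /andP[_ ->]; rewrite eqxx.
by move=> n; have := HM n; rewrite rnormE lecE /= => /andP[_].
Qed.

Lemma linf_of_bounded (u : nat -> A) (M : R) : (forall n, rnorm (u n) <= M) ->
  exists a : linf A, val a = u.
Proof.
move=> H; have Su : sset (ell_infty A) u by exists M%:C => n; rewrite rnormE lecR.
by exists (mk_subalg Su).
Qed.

Definition nearle a (M : R) := forall e : R, 0 < e -> \forall n \near \oo, rnorm (val a n) <= M + e.

(** The limit superior of the norms of a representative, that is, the C*-norm of the quotient, which
    so far carries only its algebraic structure. The infimum is attained ([snorm_nearle]). *)
Definition snorm x : R := inf [set M | 0 <= M /\ nearle (repr x) M].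

Lemma nearle_eta a b M : Defs.eta a = Defs.eta b -> nearle a M -> nearle b M.
Proof.
move=> ab aM e e0; have e2 : 0 < e / 2 by rewrite divr_gt0.
have : Defs.eta (b - a) = 0 by rewrite -etaB ab subrr.
move=> /eta_eq0P/rnorm_cvgP/(_ _ e2) H; have {}aM := aM _ e2.
have {}H : \forall n \near \oo, rnorm (val b n - val a n) <= e / 2.
  by apply: filterS H => m; rewrite subr0 linfB => /ltW.
near=> n; rewrite (le_trans (rnorm_le_sub _ (val a n))) // [e]splitr addrA lerD //.
  by near: n.
by near: n.
Unshelve. all: by end_near. Qed.

Let set_bnd x : has_inf [set M | 0 <= M /\ nearle (repr x) M].
Proof.
split; last by exists 0 => M [].
have [M M0 HM] := linf_bounded (repr x); exists M; split=> // e e0.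
by apply: nearW => n; rewrite (le_trans (HM n)) // lerDl ltW.
Qed.

Lemma snorm_ge0 x : 0 <= snorm x.
Proof. by apply: lb_le_inf; [case: (set_bnd x)|move=> M []]. Qed.

Lemma snorm_nearle a : nearle a (snorm (Defs.eta a)).
Proof.
apply: (@nearle_eta (repr (Defs.eta a))); first exact: etaK.
move=> e e0; have e2 : 0 < e / 2 by rewrite divr_gt0.
have [M [M0 HM] lt] := inf_adherent e2 (set_bnd (Defs.eta a)).
apply: filterS (HM _ e2) => n; move=> /le_trans; apply.
by rewrite [e in leRHS]splitr addrA lerD2r ltW.
Qed.

Lemma nearle_snorm a M : 0 <= M -> nearle a M -> snorm (Defs.eta a) <= M.
Proof.
move=> M0 H; apply: ge_inf; first by case: (set_bnd (Defs.eta a)).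
by split=> //; apply: nearle_eta H; rewrite etaK.
Qed.

Lemma snorm_le_nearle a M : snorm (Defs.eta a) <= M -> nearle a M.
Proof.
move=> aM e e0; apply: filterS (snorm_nearle a e0) => n.
by move=> /le_trans; apply; rewrite lerD2r.
Qed.

Lemma snorm_ind (P : Ainf -> Prop) : (forall a, P (Defs.eta a)) -> forall x, P x.
Proof. exact: quot_ind. Qed.

Lemma snorm_all a M : (forall n, rnorm (val a n) <= M) -> snorm (Defs.eta a) <= M.
Proof.
move=> H; apply: nearle_snorm; first by apply: le_trans (H 0%N); exact: rnorm_ge0.
by move=> e e0; apply: nearW => n; rewrite (le_trans (H n)) // lerDl ltW.
Qed.

Lemma snormD x y : snorm (x + y) <= snorm x + snorm y.
Proof.
elim/snorm_ind: x => a; elim/snorm_ind: y => b; rewrite etaD.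
apply: nearle_snorm; first by rewrite addr_ge0 // snorm_ge0.
move=> e e0; have e2 : 0 < e / 2 by rewrite divr_gt0.
apply: filterS2 (snorm_nearle a e2) (snorm_nearle b e2) => n an bn.
rewrite (le_trans (rnormD _ _)) // (le_trans (lerD an bn)) //.
by rewrite [e in leRHS]splitr addrACA.
Qed.

Lemma snormZ (k : R[i]) x : snorm (k *: x) <= rnorm (k : R[i]^o) * snorm x.
Proof.
elim/snorm_ind: x => a; rewrite etaZ.
apply: nearle_snorm; first by rewrite mulr_ge0 // ?snorm_ge0 ?rnorm_ge0.
move=> e e0; have k0 : 0 < rnorm (k : R[i]^o) + 1 by rewrite ltr_wpDl // rnorm_ge0.
apply: filterS (snorm_nearle a (divr_gt0 e0 k0)) => n an.
rewrite rnormZ (le_trans (ler_wpM2l (rnorm_ge0 _) an)) // mulrDr lerD2l.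
by rewrite mulrCA ger_pMr // ler_pdivrMr // mul1r lerDl.
Qed.

Lemma snormN x : snorm (- x) = snorm x.
Proof.
have H y : snorm (- y) <= snorm y.
  by rewrite -scaleN1r (le_trans (snormZ _ _)) // rnormN (rnorm_real 1) normr1 mul1r.
by apply/eqP; rewrite eq_le H -{1}[x]opprK H.
Qed.

Lemma snormB x y : snorm (x - y) <= snorm x + snorm y.
Proof. by rewrite -(snormN y) snormD. Qed.

Lemma snorm_tri y x z : snorm (x - z) <= snorm (x - y) + snorm (y - z).
Proof.
have -> : x - z = (x - y) + (y - z) by abel.
exact: snormD.
Qed.

Lemma snorm_le_sub x y : snorm x <= snorm y + snorm (x - y).
Proof.
have {1}-> : x = y + (x - y) by abel.
exact: snormD.
Qed.

Lemma snormM x y : snorm (x ** y) <= snorm x * snorm y.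
Proof.
elim/snorm_ind: x => a; elim/snorm_ind: y => b; rewrite etaM.
set K := snorm (Defs.eta a); set L := snorm (Defs.eta b).
have K0 : 0 <= K by exact: snorm_ge0. have L0 : 0 <= L by exact: snorm_ge0.
apply: nearle_snorm; first by rewrite mulr_ge0.
move=> e e0; pose d := Num.min 1 (e / (K + L + 1)).
have s0 : 0 < K + L + 1 by rewrite ltr_wpDl // addr_ge0.
have d0 : 0 < d by rewrite lt_min ltr01 divr_gt0.
have d1 : d <= 1 by rewrite ge_min lexx.
have d2 : d * (K + L + 1) <= e by rewrite -ler_pdivlMr // ge_min lexx orbT.
apply: filterS2 (snorm_nearle a d0) (snorm_nearle b d0) => n an bn.
rewrite (le_trans (rnormM _ _)) // (le_trans (ler_pM _ _ an bn)) ?rnorm_ge0 //.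
rewrite -/K -/L; nra.
Qed.

Lemma snorm_star x : snorm (star x) = snorm x.
Proof.
have H y : snorm (star y) <= snorm y.
  elim/snorm_ind: y => a; rewrite etaS; apply: nearle_snorm; first exact: snorm_ge0.
  move=> e e0; apply: filterS (snorm_nearle a e0) => n.
  by rewrite linfS rnorm_star.
by apply/eqP; rewrite eq_le H -{1}[x]starK H.
Qed.

Lemma snorm_cstar x : snorm (star x ** x) = snorm x ^+ 2.
Proof.
apply/eqP; rewrite eq_le (le_trans (snormM _ _)) ?snorm_star ?expr2 // -expr2.
rewrite -ler_sqrt ?snorm_ge0 // sqrtr_sqr ger0_norm ?snorm_ge0 //.
elim/snorm_ind: x => a; rewrite etaS etaM; apply: nearle_snorm; first exact: sqrtr_ge0.
move=> e e0; set K := snorm _; have K0 : 0 <= K by exact: snorm_ge0.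
apply: filterS (snorm_nearle (star a ** a) (mulr_gt0 e0 e0)) => n.
rewrite linfM linfS rnorm_star_mul -/K => H.
rewrite -(@ler_pXn2r _ 2) ?nnegrE ?rnorm_ge0 ?addr_ge0 ?sqrtr_ge0 ?(ltW e0) //.
rewrite (le_trans H) // sqrrD sqr_sqrtr // -addrA lerD2l expr2 lerDr.
by rewrite mulrn_wge0 // mulr_ge0 ?sqrtr_ge0 // ltW.
Qed.

Lemma snorm_eq0 x : snorm x <= 0 -> x = 0.
Proof.
elim/snorm_ind: x => a a0; apply/eta_eq0P/rnorm_cvgP => e e0.
have e2 : 0 < e / 2 by rewrite divr_gt0.
apply: filterS (snorm_le_nearle a0 e2) => n; rewrite add0r subr0 => /le_lt_trans; apply.
by rewrite [ltRHS]splitr ltrDl.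
Qed.

Lemma snorm_sum (I : Type) (s : seq I) (F : I -> Ainf) :
  snorm (\sum_(i <- s) F i) <= \sum_(i <- s) snorm (F i).
Proof.
elim/big_rec2: _ => [|i b a _ IH].
  by have := snormZ 0 0; rewrite scale0r (rnorm_real 0) normr0 mul0r.
by rewrite (le_trans (snormD _ _)) // lerD2l.
Qed.

Lemma snorm0 : snorm 0 = 0.
Proof. by apply/eqP; rewrite eq_le snorm_ge0 andbT; have := @snorm_sum unit [::] (fun=> 0); rewrite !big_nil. Qed.

Lemma snorm_const (d : A) : snorm (const_seq d) = rnorm d.
Proof.
apply/eqP; rewrite eq_le snorm_all //=.
apply/ler_addgt0Pr => e e0.
have [n _ Hn] := snorm_nearle (mk_subalg (const_bounded d)) e0.
exact: (Hn n (leqnn n)).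
Qed.

Lemma const_seqD (d d' : A) : const_seq (d + d') = const_seq d + const_seq d'.
Proof. by rewrite /const_seq etaD; congr Defs.eta; apply: val_inj. Qed.
Lemma const_seqZ k (d : A) : const_seq (k *: d) = k *: const_seq d.
Proof. by rewrite /const_seq etaZ; congr Defs.eta; apply: val_inj. Qed.
Lemma const_seqM (d d' : A) : const_seq (d ** d') = const_seq d ** const_seq d'.
Proof. by rewrite /const_seq etaM; congr Defs.eta; apply: val_inj. Qed.
Lemma const_seq0 : const_seq (0 : A) = 0.
Proof. by rewrite -(scale0r (0 : A)) const_seqZ scale0r. Qed.
End SeqNorm.

Section SeqAct.
Variables (R : realType) (G : topologicalGroupType) (A : cstarAlgType R).
Variable alpha : cstarAction G A.
Implicit Types (a b : linf A) (x y z : A_infty A).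

Lemma act_linfE g a n : val (act_linf alpha g a) n = alpha g (val a n).
Proof.
rewrite /act_linf subalg_mapE //; have [M _ HM] := linf_bounded a.
by exists M%:C => m; rewrite rnormE lecR rnorm_act.
Qed.

Lemma act_infty_eta g a : act_infty alpha g (Defs.eta a) = Defs.eta (act_linf alpha g a).
Proof.
rewrite /act_infty /Defs.eta quot_map_pi // => y z /= /rnorm_cvgP H.
apply/rnorm_cvgP => e /H; apply: filterS => n.
have -> : (sval (act_linf alpha g y) - sval (act_linf alpha g z)) n = alpha g ((sval y - sval z) n).
  by rewrite -[LHS]/(val (act_linf alpha g y) n - val (act_linf alpha g z) n) !act_linfE -actB.
by rewrite !subr0 rnorm_act.
Qed.

Lemma act_inftyD g x y : act_infty alpha g (x + y) = act_infty alpha g x + act_infty alpha g y.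
Proof.
elim/snorm_ind: x => a; elim/snorm_ind: y => b; rewrite etaD !act_infty_eta etaD; congr Defs.eta.
by apply: linf_ext => n; rewrite linfD !act_linfE -actD.
Qed.
Lemma act_inftyZ g k x : act_infty alpha g (k *: x) = k *: act_infty alpha g x.
Proof.
elim/snorm_ind: x => a; rewrite etaZ !act_infty_eta etaZ; congr Defs.eta.
by apply: linf_ext => n; rewrite linfZ !act_linfE -actZ.
Qed.
Lemma act_inftyM g x y : act_infty alpha g (x ** y) = act_infty alpha g x ** act_infty alpha g y.
Proof.
elim/snorm_ind: x => a; elim/snorm_ind: y => b; rewrite etaM !act_infty_eta etaM; congr Defs.eta.
by apply: linf_ext => n; rewrite linfM !act_linfE -actMul.
Qed.
Lemma act_inftyN g x : act_infty alpha g (- x) = - act_infty alpha g x.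
Proof. by rewrite -scaleN1r act_inftyZ scaleN1r. Qed.
Lemma act_infty_const g d : act_infty alpha g (const_seq d) = const_seq (alpha g d).
Proof.
rewrite act_infty_eta; congr Defs.eta.
by apply: linf_ext => n; rewrite act_linfE.
Qed.
Lemma act_infty0 g : act_infty alpha g 0 = 0.
Proof. by rewrite -(const_seq0 A) act_infty_const act0. Qed.
Lemma snorm_act g x : snorm (act_infty alpha g x) <= snorm x.
Proof.
elim/snorm_ind: x => a; rewrite act_infty_eta; apply: nearle_snorm; first exact: snorm_ge0.
by move=> e e0; apply: filterS (snorm_nearle a e0) => n; rewrite act_linfE rnorm_act.
Qed.

(** Since the action is isometric, equicontinuity at the unit alone is the same as membership in
    [ell_infty_cont]. *)
Definition equicont a := forall e : R, 0 < e ->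
  \forall h \near (1%g : G), forall n, rnorm (alpha h (val a n) - val a n) <= e.

Lemma ell_infty_equicont a : ell_infty_cont alpha a -> equicont a.
Proof.
move=> Ha e e0; have := Ha 1%g e e0; apply: filterS => h Hh n.
apply: ltW; apply: le_lt_trans Hh; rewrite /linf_norm.
have -> : alpha h (val a n) - val a n = val (act_linf alpha h a - act_linf alpha 1%g a) n.
  by rewrite [RHS]/(val (act_linf alpha h a) n - val (act_linf alpha 1%g a) n) !act_linfE act1.
apply: ub_le_sup; last by exists n.
have [M _ HM] := linf_bounded (act_linf alpha h a - act_linf alpha 1%g a).
by exists M => _ [m _ <-].
Qed.

Lemma equicont_ell_infty a : equicont a -> ell_infty_cont alpha a.
Proof.
move=> Ha g e e0; have e2 : 0 < e / 2 by rewrite divr_gt0.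
have c1 : (fun h : G => g^-1 * h)%g @ nbhs g --> (1%g : G).
  by rewrite -(mulVg g); apply: cvg_mulg; [exact: cvg_cst|exact: cvg_id].
have H1 : \forall h \near g, forall n, rnorm (alpha (g^-1 * h)%g (val a n) - val a n) <= e / 2.
  exact: (c1 _ (Ha _ e2)).
apply: filterS H1 => h Hh.
apply: (@le_lt_trans _ _ (e / 2)); last by rewrite [ltRHS]splitr ltrDl.
apply: ge_sup; first by exists (rnorm (val (act_linf alpha h a - act_linf alpha g a) 0%N)), 0%N.
move=> _ [n _ <-].
rewrite linfB !act_linfE.
by rewrite -(rnorm_act alpha g^-1%g) actB actK -actM.
Qed.

Lemma equicont_fixed a : (forall n g, alpha g (val a n) = val a n) -> equicont a.
Proof. by move=> H e e0; apply: nearW => h n; rewrite H subrr rnorm0 ltW. Qed.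

Lemma equicontD a b : equicont a -> equicont b -> equicont (a + b).
Proof.
move=> Ha Hb e e0; have e2 : 0 < e / 2 by rewrite divr_gt0.
apply: filterS2 (Ha _ e2) (Hb _ e2) => h ah bh n.
rewrite linfD actD.
have -> (u v u' v' : A) : u + v - (u' + v') = (u - u') + (v - v') by abel.
by rewrite (le_trans (rnormD _ _)) // [leRHS]splitr lerD.
Qed.

Lemma equicontM a b : equicont a -> equicont b -> equicont (a ** b).
Proof.
move=> Ha Hb e e0; have [M M0 HM] := linf_bounded a; have [L L0 HL] := linf_bounded b.
have M1 : 0 < M + L + 1 by rewrite ltr_wpDl // addr_ge0.
have e2 : 0 < e / (M + L + 1) by rewrite divr_gt0.
apply: filterS2 (Ha _ e2) (Hb _ e2) => h ah bh n.
rewrite linfM actMul.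
have -> : alpha h (val a n) ** alpha h (val b n) - val a n ** val b n =
  alpha h (val a n) ** (alpha h (val b n) - val b n) + (alpha h (val a n) - val a n) ** val b n.
  by amul_ring.
rewrite (le_trans (rnormD _ _)) //.
rewrite (le_trans (lerD (rnormM _ _) (rnormM _ _))) // rnorm_act.
rewrite (@le_trans _ _ (M * (e / (M + L + 1)) + (e / (M + L + 1)) * L)) //.
  by rewrite lerD // ler_pM // ?rnorm_ge0.
rewrite mulrC -mulrDr mulrAC ler_pdivrMr // ler_pM2l // lerDl //.
Qed.

Lemma equicont_const (d : A) : equicont (mk_subalg (const_bounded d)).
Proof.
move=> e e0; have /rnorm_cvgP := @act_continuous _ _ _ alpha d 1%g.
by rewrite act1 => /(_ e e0); apply: filterS => h /ltW H n.
Qed.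

Hypothesis cptG : compact [set: G].

(** For a single [g] the bound holds from some index on; equicontinuity spreads it to a
    neighbourhood of [g], and compactness yields one index for all [g]. *)
Lemma equicont_uniform a (M : R) : equicont a ->
  (forall g, snorm (act_infty alpha g (Defs.eta a) - Defs.eta a) <= M) ->
  forall e, 0 < e -> \forall n \near \oo, forall g, rnorm (alpha g (val a n) - val a n) <= M + e.
Proof.
move=> Ha HM e e0; apply: near_compact => // g.
have e2 : 0 < e / 2 by rewrite divr_gt0.
have c1 : (fun x : G * nat => g^-1 * x.1)%g @ filter_prod (nbhs g) \oo --> (1%g : G).
  rewrite -(mulVg g); apply: cvg_mulg; [exact: cvg_cst|exact: cvg_fst].
have H1 : \forall x \near filter_prod (nbhs g) \oo,
    forall n, rnorm (alpha (g^-1 * x.1)%g (val a n) - val a n) <= e / 2.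
  exact: (c1 _ (Ha _ e2)).
have H2 : \forall n \near \oo, rnorm (alpha g (val a n) - val a n) <= M + e / 2.
  have := HM g; rewrite act_infty_eta etaB => /snorm_le_nearle/(_ _ e2).
  apply: filterS => n.
  by rewrite linfB act_linfE.
have H3 : \forall x \near filter_prod (nbhs g) \oo, rnorm (alpha g (val a x.2) - val a x.2) <= M + e / 2.
  exact: (cvg_snd H2).
near=> x.
have Hn : rnorm (alpha g (val a x.2) - val a x.2) <= M + e / 2 by near: x.
have Hh : forall n, rnorm (alpha (g^-1 * x.1)%g (val a n) - val a n) <= e / 2 by near: x.
set h := x.1; set n := x.2.
rewrite (le_trans (rnorm_tri (alpha g (val a n)) _ _)) // addrC [e]splitr addrA lerD //.
by rewrite -(rnorm_act alpha g^-1%g) actB actK -actM.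
Unshelve. all: by end_near. Qed.
End SeqAct.

(** * Invariant approximate units and separable invariant subalgebras *)

Section FixedApproximateUnit.
Variables (R : realType) (G : topologicalGroupType) (A : cstarAlgType R).
Variable alpha : cstarAction G A.
Hypothesis cptG : compact [set: G].

Lemma act_unit_uniform (e : nat -> A) (d : A) : (forall n, rnorm (e n) <= 1) ->
  (forall a : A, (fun n => e n ** a) @ \oo --> a) -> (forall a : A, (fun n => a ** e n) @ \oo --> a) ->
  forall r, 0 < r -> \forall n \near \oo, forall g,
    rnorm (alpha g (e n) ** d - d) <= r /\ rnorm (d ** alpha g (e n) - d) <= r.
Proof.
move=> e1 el er r r0; apply: near_compact => // g.
have r2 : 0 < r / 2 by rewrite divr_gt0.
have r4 : 0 < r / 2 / 2 by rewrite !divr_gt0.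
set d' := alpha g^-1%g d.
have c1 : (fun x : G * nat => alpha x.1^-1%g d) @ filter_prod (nbhs g) \oo --> d'.
  have h : (fun x : G * nat => x.1^-1)%g @ filter_prod (nbhs g) \oo --> (g^-1)%g.
    by apply: cvg_invg; exact: cvg_fst.
  exact: (cvg_comp _ _ h (@act_continuous _ _ _ alpha d _)).
have /rnorm_cvgP/(_ _ r4) H1 := c1.
have /rnorm_cvgP/(_ _ r2) H2 := el d'; have /rnorm_cvgP/(_ _ r2) H3 := er d'.
have {}H2 : \forall x \near filter_prod (nbhs g) \oo, rnorm (e x.2 ** d' - d') < r / 2.
  exact: (cvg_snd H2).
have {}H3 : \forall x \near filter_prod (nbhs g) \oo, rnorm (d' ** e x.2 - d') < r / 2.
  exact: (cvg_snd H3).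
near=> x.
have td : rnorm (alpha x.1^-1%g d - d') < r / 2 / 2 by near: x.
have hl : rnorm (e x.2 ** d' - d') < r / 2 by near: x.
have hr : rnorm (d' ** e x.2 - d') < r / 2 by near: x.
have e1x := e1 x.2; set t := alpha x.1^-1%g d in td *; split.
  rewrite -(rnorm_act alpha x.1^-1%g) actB actMul actK -/t.
  have -> : e x.2 ** t - t = e x.2 ** (t - d') - (t - d') + (e x.2 ** d' - d') by amul_ring.
  rewrite (le_trans (rnormD _ _)) // (le_trans (lerD (rnormB _ _) (ltW hl))) //.
  have := rnormM (e x.2) (t - d'); have := rnorm_ge0 (t - d'); nra.
rewrite -(rnorm_act alpha x.1^-1%g) actB actMul actK -/t.
have -> : t ** e x.2 - t = (t - d') ** e x.2 - (t - d') + (d' ** e x.2 - d') by amul_ring.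
rewrite (le_trans (rnormD _ _)) // (le_trans (lerD (rnormB _ _) (ltW hr))) //.
have := rnormM (t - d') (e x.2); have := rnorm_ge0 (t - d'); nra.
Unshelve. all: by end_near. Qed.

Lemma lmean_near (V : normedModType R[i]) (F : G -> V) c y M : lmean F c ->
  (forall t, rnorm (F t - y) <= M) -> rnorm (c - y) <= M.
Proof.
move=> Fc FM; apply/ler_addgt0Pr => e e0; have [s s0 Hs] := Fc _ e0.
rewrite (le_trans (rnorm_tri (avg s (fun g => F (g * 1)%g)) _ _)) // addrC lerD //.
  exact: avg_near.
by rewrite rnormC.
Qed.

(** An approximate unit averaged over [G]; it stays one because the estimates are uniform along
    orbits. Being fixed, its class is available in [F_cont], where it serves to identify the image
    of the constant function 1. *)
Lemma fixed_approximate_unit : sigma_unital A -> exists u : linf A,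
  (forall n g, alpha g (val u n) = val u n) /\
  forall d, Defs.eta u ** const_seq d = const_seq d /\ const_seq d ** Defs.eta u = const_seq d.
Proof.
move=> [e [_ e1 el er]].
have un n : rnorm (fixE alpha (e n)) <= 1.
  rewrite -[fixE _ _]subr0; apply: fixE_dist => //; first by move=> g; rewrite act0.
  by rewrite subr0.
have [u uE] := linf_of_bounded un.
exists u; split=> [n g|d]; first by rewrite uE fixE_fixed.
have H := act_unit_uniform d e1 el er.
split; apply/eqP; rewrite -subr_eq0; apply/eqP; rewrite /const_seq etaM etaB.
  apply/eta_eq0P/rnorm_cvgP => r r0; have r2 : 0 < r / 2 by rewrite divr_gt0.
  apply: filterS (H _ r2) => n Hn; rewrite subr0 linfB linfM uE /=.
  apply: (@le_lt_trans _ _ (r / 2)); last by rewrite [ltRHS]splitr ltrDl.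
  apply: (@lmean_near _ (fun t => alpha t (e n) ** d)) => [|t]; last by case: (Hn t).
  apply: (@lmean_linear _ _ _ _ (fun x => x ** d) (rnorm d)); last exact: (fixE_mean _ cptG _).1.
    by move=> k x y; rewrite amulDl amulZl.
  by move=> x; rewrite mulrC rnormM.
apply/eta_eq0P/rnorm_cvgP => r r0; have r2 : 0 < r / 2 by rewrite divr_gt0.
apply: filterS (H _ r2) => n Hn; rewrite subr0 linfB linfM uE /=.
apply: (@le_lt_trans _ _ (r / 2)); last by rewrite [ltRHS]splitr ltrDl.
apply: (@lmean_near _ (fun t => d ** alpha t (e n))) => [|t]; last by case: (Hn t).
apply: (@lmean_linear _ _ _ _ (fun x => d ** x) (rnorm d)); last exact: (fixE_mean _ cptG _).1.
  by move=> k x y; rewrite amulDr amulZr.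
by move=> x; rewrite rnormM.
Qed.
End FixedApproximateUnit.

Lemma rnorm_complex_le (R : realType) (a b : R) : rnorm (a +i* b : R[i]^o) <= `|a| + `|b|.
Proof.
rewrite /rnorm normc_def /= -(ler_pXn2r (ltn0Sn 1)) ?nnegrE ?sqrtr_ge0 ?addr_ge0 //.
rewrite sqr_sqrtr ?addr_ge0 ?sqr_ge0 // sqrrD !real_normK ?num_real //.
by rewrite -addrA lerD2l lerDr mulrn_wge0 // mulr_ge0.
Qed.

Section SeparableHull.
Variables (R : realType) (G : topologicalGroupType) (A : cstarAlgType R).
Variable alpha : cstarAction G A.
Variable c : nat -> A.
Variable Gam : set G.
Hypotheses (cGam : countable Gam) (dGam : forall (g : G) U, nbhs g U -> exists2 h, Gam h & U h).

Definition ratc (m : nat) : R[i] :=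
  let pq := odflt (0, 0) (unpickle m : option (rat * rat)) in (ratr pq.1 +i* ratr pq.2).

Lemma ratc_dense (k : R[i]) (e : R) : 0 < e -> exists m, rnorm (k - ratc m : R[i]^o) < e.
Proof.
move=> e0; case: k => a b; have e2 : 0 < e / 2 by rewrite divr_gt0.
have [|p] := @rat_in_itvoo R (a - e / 2) a; first by rewrite ltrBlDr ltrDl.
rewrite in_itv /= => /andP[p1 p2].
have [|q] := @rat_in_itvoo R (b - e / 2) b; first by rewrite ltrBlDr ltrDl.
rewrite in_itv /= => /andP[q1 q2].
exists (pickle (p, q)); rewrite /ratc pickleK /=.
have -> : (a +i* b) - (ratr p +i* ratr q) = ((a - ratr p) +i* (b - ratr q)) :> R[i] by [].
rewrite (le_lt_trans (rnorm_complex_le _ _)) // !gtr0_norm ?subr_gt0 //; lra.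
Qed.

(** A single natural number encodes every operation, with scalars taken from an enumeration of
    complex rationals, so that each stage is visibly the image of a countable set. *)
Definition hull_op (n : nat) (x y : A) : A :=
  match n with 0%N => x + y | 1%N => x ** y | 2%N => star x | m.+3 => ratc m *: x end.

Fixpoint hull_stage (k : nat) : set A :=
  if k is k'.+1 then hull_stage k' `|`
    (fun p : nat * (A * A) => hull_op p.1 p.2.1 p.2.2) @`
      ([set: nat] `*` (hull_stage k' `*` hull_stage k'))
  else (fun p : G * nat => alpha p.1 (c p.2)) @` (Gam `*` [set: nat]) `|` [set 0].

Definition hull : set A := \bigcup_k hull_stage k.

Let countable_image (T U : Type) (f : T -> U) (S : set T) : countable S -> countable (f @` S).
Proof. by move=> cS; exact: card_le_trans (card_image_le f S) cS. Qed.

Let countableU2 (T : Type) (S S' : set T) : countable S -> countable S' -> countable (S `|` S').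
Proof.
move=> cS cS'; rewrite (_ : S `|` S' = \bigcup_(b in [set: bool]) (if b then S else S')).
  by apply: bigcup_countable => [|[]] //; exact: finite_set_countable.
apply/seteqP; split=> [x [Sx|Sx]|x [[] _ Sx]]; [by exists true|by exists false|by left|by right].
Qed.

Lemma hull_countable : countable hull.
Proof.
apply: bigcup_countable => // k _; elim: k => [|k IH] /=.
  apply: countableU2; first exact/countable_image/countableX.
  by apply: finite_set_countable; exact: finite_set1.
by apply: countableU2 => //; apply/countable_image/countableX => //; exact: countableX.
Qed.

Let stage_mono k l : hull_stage k `<=` hull_stage (l + k)%N.
Proof. by elim: l => [|l IH] x kx //; left; exact: IH. Qed.

Lemma hull_closed_op n x y : hull x -> hull y -> hull (hull_op n x y).
Proof.
move=> [k _ kx] [l _ ly]; exists (k + l).+1 => //; right; exists (n, (x, y)) => //.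
split=> //; split => /=; last exact: stage_mono.
by rewrite addnC; exact: stage_mono.
Qed.

Lemma hull_gen g n : Gam g -> hull (alpha g (c n)).
Proof. by move=> Gg; exists 0%N => //; left; exists (g, n). Qed.

Lemma hull0 : hull 0.
Proof. by exists 0%N => //; right. Qed.

Definition sep_hull : starSubalg A.
Proof.
refine (@StarSubalg R A (closure hull) _ _ _ _ _).
- exact: subset_closure hull0.
- move=> a b /rnorm_closureP Ha /rnorm_closureP Hb; apply/rnorm_closureP => e e0.
  have e2 : 0 < e / 2 by rewrite divr_gt0.
  have [x hx xa] := Ha _ e2; have [y hy yb] := Hb _ e2.
  exists (x + y); first exact: (hull_closed_op 0 hx hy).
  have -> : x + y - (a + b) = (x - a) + (y - b) by abel.
  by rewrite (le_lt_trans (rnormD _ _)) // [ltRHS]splitr ltrD.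
- move=> k a /rnorm_closureP Ha; apply/rnorm_closureP => e e0.
  have k0 : 0 < rnorm (k : R[i]^o) + 1 by rewrite ltr_wpDl // rnorm_ge0.
  have a0 : 0 < rnorm a + 1 by rewrite ltr_wpDl // rnorm_ge0.
  pose d := Num.min 1 (e / 2 / (rnorm (k : R[i]^o) + 1)).
  have d0 : 0 < d by rewrite lt_min ltr01 !divr_gt0.
  have [x hx xa] := Ha _ d0.
  have [m Hm] := ratc_dense k (divr_gt0 (divr_gt0 e0 (ltr0n _ 2)) a0).
  exists (ratc m *: x); first exact: (hull_closed_op m.+3 hx hx).
  have -> : ratc m *: x - k *: a = k *: (x - a) - (k - ratc m) *: x.
    by rewrite scalerBr scalerBl; abel.
  rewrite (le_lt_trans (rnormB _ _)) // !rnormZ [e]splitr ltrD //.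
    rewrite (@le_lt_trans _ _ ((rnorm (k : R[i]^o) + 1) * rnorm (x - a))) //.
      by rewrite ler_wpM2r ?rnorm_ge0 // lerDl.
    by rewrite mulrC -ltr_pdivlMr // (lt_le_trans xa) // ge_min lexx orbT.
  rewrite (@le_lt_trans _ _ (rnorm (k - ratc m : R[i]^o) * (rnorm a + 1))) //; last first.
    by rewrite -ltr_pdivlMr.
  rewrite ler_wpM2l ?rnorm_ge0 // (le_trans (rnorm_le_sub _ a)) // lerD2l.
  by rewrite (le_trans (ltW xa)) // ge_min lexx.
- move=> a b /rnorm_closureP Ha /rnorm_closureP Hb; apply/rnorm_closureP => e e0.
  have s0 : 0 < rnorm a + rnorm b + 1 by rewrite ltr_wpDl // addr_ge0 // rnorm_ge0.
  pose d := Num.min 1 (e / (rnorm a + rnorm b + 1)).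
  have d0 : 0 < d by rewrite lt_min ltr01 divr_gt0.
  have d1 : d <= 1 by rewrite ge_min lexx.
  have dE : d * (rnorm a + rnorm b + 1) <= e by rewrite -ler_pdivlMr // ge_min lexx orbT.
  have [x hx xa] := Ha _ d0; have [y hy yb] := Hb _ d0.
  exists (x ** y); first exact: (hull_closed_op 1 hx hy).
  have -> : x ** y - a ** b = (x - a) ** (y - b) + (x - a) ** b + a ** (y - b) by amul_ring.
  rewrite (le_lt_trans (rnormD _ _)) // (le_lt_trans (lerD (rnormD _ _) (lexx _))) //.
  have := rnormM (x - a) (y - b); have := rnormM (x - a) b; have := rnormM a (y - b).
  have := rnorm_ge0 (x - a); have := rnorm_ge0 (y - b); have := rnorm_ge0 a; have := rnorm_ge0 b.
  move: (rnorm (x - a)) (rnorm (y - b)) xa yb (rnorm a) (rnorm b) dE.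
  move: (rnorm _) (rnorm _) (rnorm _) => X Y Z p q pd qd na nb dE na0 nb0 q0 p0 H1 H2 H3.
  have : p * nb <= d * nb by rewrite ler_wpM2r // ltW.
  have : na * q <= na * d by rewrite ler_wpM2l // ltW.
  have : p * q < d.
    by apply: le_lt_trans pd; rewrite ler_piMr // ltW // (lt_le_trans qd).
  lra.
- move=> a /rnorm_closureP Ha; apply/rnorm_closureP => e e0.
  have [x hx xa] := Ha _ e0.
  exists (star x); first exact: (hull_closed_op 2 hx hx).
  by rewrite -starN -starD rnorm_star.
Defined.

Lemma sep_hull_gen n : sset sep_hull (c n).
Proof.
apply/rnorm_closureP => e e0; have := @act_continuous _ _ _ alpha (c n) 1%g.
rewrite /continuous_at act1 => /rnorm_cvgP/(_ e e0) H; have [g Gg Hg] := dGam H.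
by exists (alpha g (c n)) => //; exact: hull_gen.
Qed.

(** Only orbits under the countable dense set [Gam] were put in. A generator moved by an arbitrary
    [g] is a limit of such points; this passes through the stages because the action respects every
    operation, and then to the closure. *)
Lemma sep_hull_act g d : sset sep_hull d -> sset sep_hull (alpha g d).
Proof.
have H k x : hull_stage k x -> sset sep_hull (alpha g x).
  elim: k x => [|k IH] x /=.
    move=> [[[h n] [Gh _] <-]|->]; last by rewrite act0; exact: (subalg0 sep_hull).
    rewrite /= -actM; apply/rnorm_closureP => e e0.
    have := @act_continuous _ _ _ alpha (c n) (g * h)%g.
    move=> /rnorm_cvgP/(_ e e0) H; have [t Gt Ht] := dGam H.
    by exists (alpha t (c n)) => //; exact: hull_gen.
  move=> [/IH//|[[n [u v]] [_ [/= /IH Hu /IH Hv]] <-]] /=.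
  case: n => [|[|[|m]]] /=.
  - by rewrite actD; exact: (@subalgD _ _ sep_hull).
  - by rewrite actMul; exact: (@subalgM _ _ sep_hull).
  - by rewrite actStar; exact: (@subalg_star _ _ sep_hull).
  - by rewrite actZ; exact: (@subalgZ _ _ sep_hull).
move=> /rnorm_closureP Hd; apply/rnorm_closureP => e e0.
have e2 : 0 < e / 2 by rewrite divr_gt0.
have [x [k _ kx] xd] := Hd _ e2; have /rnorm_closureP/(_ _ e2)[y hy yx] := H _ _ kx.
exists y => //; rewrite (le_lt_trans (rnorm_tri (alpha g x) _ _)) // [ltRHS]splitr ltrD //.
by rewrite -actB rnorm_act.
Qed.

Lemma sep_hull_separable : separable_set (sset sep_hull).
Proof.
exists hull; split=> //; first exact: hull_countable.
exact: subset_closure.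
Qed.

Lemma sep_hull_closed : closed (sset sep_hull).
Proof. exact: closed_closure. Qed.
End SeparableHull.

Lemma second_countable_dense (G : topologicalGroupType) :
  second_countable (T := G) ->
  exists2 Gam : set G, countable Gam & forall (g : G) U, nbhs g U -> exists2 h, Gam h & U h.
Proof.
move=> [B cB [_ bB]].
exists ((fun U : set G => xget 1%g U) @` B); first exact: card_le_trans (card_image_le _ _) cB.
move=> g U /bB[V [BV Vg] VU]; exists (xget 1%g V); first by exists V.
by apply: VU; apply: xgetPex; exists g.
Qed.

Lemma separable_invariant_hull (R : realType) (G : topologicalGroupType) (A : cstarAlgType R)
    (alpha : cstarAction G A) (c : nat -> A) : second_countable (T := G) ->
  exists D : starSubalg A, [/\ closed (sset D), separable_set (sset D),
    forall g d, sset D d -> sset D (alpha g d) & forall n, sset D (c n)].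
Proof.
move=> /second_countable_dense[Gam cG dG]; exists (sep_hull alpha c Gam); split.
- exact: sep_hull_closed.
- exact: sep_hull_separable.
- by move=> g d; exact: sep_hull_act.
- exact: sep_hull_gen.
Qed.

(** * Lifts of Rokhlin homomorphisms *)

Lemma subalg_val_scale (R : realType) (U : starAlgType R) (S : starSubalg U) (k : R[i])
  (a : subalg_type S) : val (k *: a) = k *: val a.
Proof. by []. Qed.

Lemma fun_scaleE (R : realType) (T : Type) (U : starAlgType R) (k : R[i]) (u : T -> U) t :
  (k *: u) t = k *: u t.
Proof. by []. Qed.

Lemma subalg_val_mul (R : realType) (U : starAlgType R) (S : starSubalg U) (a b : subalg_type S) :
  val (a ** b) = val a ** val b.
Proof. by []. Qed.

Lemma fun_mulE (R : realType) (T : Type) (U : starAlgType R) (u v : T -> U) t :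
  (u ** v) t = u t ** v t.
Proof. by []. Qed.

Lemma real_continuousC (R : realType) (T : topologicalType) (r : T -> R) : continuous r ->
  continuous (fun t => (r t)%:C : R[i]^o).
Proof.
move=> cr t; apply/(@rnorm_cvgP _ R[i]^o) => e e0.
have /cvgrPdist_lt/(_ e e0) := cr t; apply: filterS => x.
by rewrite -rmorphB rnorm_real distrC.
Qed.

Section ContinuousScalars.
Variables (R : realType) (G : topologicalGroupType).
Local Notation CGR := (CG R G).

Lemma CG_cvg (f : CGR) (t : G) : (fun x : G => (val f x : R[i]^o)) @ t --> (val f t : R[i]^o).
Proof. exact: (subalg_valP f t). Qed.

Lemma CG_ext (f h : CGR) : (forall t, val f t = val h t) -> f = h.
Proof. by move=> H; apply: val_inj; apply/funext. Qed.

Lemma CG_addE (f h : CGR) t : val (f + h) t = val f t + val h t. Proof. by []. Qed.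
Lemma CG_scaleE k (f : CGR) t : val (k *: f) t = k * (val f t : R[i]).
Proof. by rewrite subalg_val_scale fun_scaleE. Qed.
Lemma CG_mulE (f h : CGR) t : val (f ** h) t = (val f t : R[i]) * (val h t : R[i]).
Proof. by rewrite subalg_val_mul fun_mulE. Qed.
Lemma CG_starE (f : CGR) t : val (star f) t = Num.conj (val f t : R[i]). Proof. by []. Qed.

Lemma left_translationE g (f : CGR) t : val (left_translation g f) t = val f (g^-1 * t)%g.
Proof.
rewrite /left_translation subalg_mapE //; move=> x.
have h : (fun x => g^-1 * x)%g @ nbhs x --> (g^-1 * x)%g.
  by apply: cvg_mulg; [exact: cvg_cst|exact: cvg_id].
exact: (cvg_comp _ _ h (@CG_cvg f _)).
Qed.

Lemma real_CG (r : G -> R) : continuous r -> exists f : CGR, forall t, val f t = (r t)%:C.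
Proof.
move=> cr.
have S : sset (cont_subalg R G) (fun t => (r t)%:C) by exact: real_continuousC.
by exists (mk_subalg S).
Qed.

Definition CG_const (k : R[i]) : CGR.
Proof. by refine (@mk_subalg R _ (cont_subalg R G) (fun=> k) _) => t; exact: cvg_cst. Defined.

Lemma CG_constE k t : val (CG_const k) t = k. Proof. by []. Qed.

Lemma CG_const1_unit : is_unit_elt (CG_const 1).
Proof.
move=> f; split; apply: CG_ext => t; rewrite CG_mulE CG_constE; [exact: mul1r|exact: mulr1].
Qed.

Lemma CG_val_continuous_re (f : CGR) : continuous (fun t => complex.Re (val f t : R[i])).
Proof.
move=> t; apply/cvgrPdist_lt => e e0.
have /rnorm_cvgP/(_ e e0) := @CG_cvg f t; apply: filterS => x.
rewrite distrC; apply: le_lt_trans; rewrite -raddfB /=.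
by have := normc_ge_Re (val f x - val f t : R[i]); rewrite (rnormE (val f x - val f t : R[i]^o)) lecR.
Qed.
End ContinuousScalars.

Section RokhlinLift.
Variables (R : realType) (G : topologicalGroupType) (A : cstarAlgType R).
Variable alpha : cstarAction G A.

(** The Rokhlin homomorphism determines the class of [q f] only modulo the annihilator of [D], hence
    each identity is stated after multiplication by an element of [D]. Equicontinuity records that
    the values lie in [F_cont]. *)
Record rokhlin_lift (D : starSubalg A) (q : CG R G -> linf A) : Prop := RokhlinLift {
  q_equicont : forall f, equicont alpha (q f);
  q_comm : forall f d, sset D d -> Defs.eta (q f) ** const_seq d = const_seq d ** Defs.eta (q f);
  q_lin : forall k f h d, sset D d ->
    Defs.eta (q (k *: f + h)) ** const_seq d = (k *: Defs.eta (q f) + Defs.eta (q h)) ** const_seq d;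
  q_mul : forall f h d, sset D d ->
    Defs.eta (q (f ** h)) ** const_seq d = Defs.eta (q f) ** Defs.eta (q h) ** const_seq d;
  q_star : forall f d, sset D d ->
    Defs.eta (q (star f)) ** const_seq d = star (Defs.eta (q f)) ** const_seq d;
  q_one : forall d, sset D d -> Defs.eta (q (CG_const G 1)) ** const_seq d = const_seq d;
  q_act : forall g f d, sset D d ->
    Defs.eta (q (left_translation g f)) ** const_seq d =
    act_infty alpha g (Defs.eta (q f)) ** const_seq d
}.

Lemma kappa_eq (D : starSubalg A) (x y : subalg_type (commutant D)) d :
  kappa x = kappa y -> sset D d -> val x ** const_seq d = val y ** const_seq d.
Proof.
move=> /quot_eqP /= H /H[+ _]; rewrite amulDl amulNl => /eqP.
by rewrite subr_eq0 => /eqP.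
Qed.

Lemma rokhlin_lift_exists (D : starSubalg A) : compact [set: G] -> sigma_unital A ->
  rokhlin_property alpha -> closed (sset D) -> separable_set (sset D) ->
  (forall g d, sset D d -> sset D (alpha g d)) -> exists q, rokhlin_lift D q.
Proof.
move=> cptG sA rA cD sD iD.
have [phi [phom phic phi1 phia]] := rA D cD sD iD.
have [plin pmul pstar] := phom.
have ex f : exists p : subalg_type (commutant D) * linf A,
    [/\ equicont alpha p.2, Defs.eta p.2 = val p.1 & kappa p.1 = phi f].
  have [x [a ca ax] xf] := phic f.
  by exists (x, a); split=> //; exact: ell_infty_equicont.
have [p Hp] := choice ex.
pose X f := (p f).1; exists (fun f => (p f).2).
have XE f : Defs.eta (p f).2 = val (X f) by case: (Hp f).
have kX f : kappa (X f) = phi f by case: (Hp f).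
split.
- by move=> f; case: (Hp f).
- by move=> f d Dd; rewrite XE; exact: (subalg_valP (X f)).
- move=> k f h d Dd; rewrite !XE.
  have E : kappa (X (k *: f + h)) = kappa (k *: X f + X h).
    rewrite kX plin -!kX /kappa.
    by rewrite (quot_piD (annihilator D)) [_ *: _](quot_piZ (annihilator D)).
  exact: (kappa_eq E Dd).
- move=> f h d Dd; rewrite !XE.
  have E : kappa (X (f ** h)) = kappa (X f ** X h).
    by rewrite kX pmul -!kX; exact: (quot_piM (annihilator D)).
  exact: (kappa_eq E Dd).
- move=> f d Dd; rewrite !XE.
  have E : kappa (X (star f)) = kappa (star (X f)).
    by rewrite kX pstar -!kX; exact: (quot_pi_star (annihilator D)).
  exact: (kappa_eq E Dd).
- move=> d Dd; rewrite XE.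
  (* The image of 1 is only known to act as a unit on [F_cont]. It is tested on the class of an
     invariant approximate unit, which is then absorbed by [const_seq d]. *)
  have [u [fu ud]] := fixed_approximate_unit alpha cptG sA.
  have Sw : sset (commutant D) (Defs.eta u).
    by move=> d' _; case: (ud d') => -> ->.
  pose w := mk_subalg Sw.
  have Fw : F_cont alpha (kappa w).
    exists w => //; exists u => //; apply: equicont_ell_infty; exact: equicont_fixed.
  have [H _] := phi1 (CG_const G 1) (kappa w) (@CG_const1_unit R G) Fw.
  have E : kappa (X (CG_const G 1) ** w) = kappa w.
    by rewrite -[RHS]H -kX; exact: (esym (quot_piM (annihilator D) _ _)).
  have := kappa_eq E Dd.
  by rewrite -[val (X _ ** w)]/(val (X (CG_const G 1)) ** val w) -amulA !(ud d).1.
- move=> g f d Dd; rewrite !XE.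
  have Sx (x : subalg_type (commutant D)) : sset (commutant D) (act_infty alpha g (val x)).
    move=> d' Dd'; rewrite -(actKV alpha g d') -act_infty_const -!act_inftyM.
    by congr act_infty; apply: (subalg_valP x); exact: iD.
  have E : kappa (X (left_translation g f)) =
      kappa (subalg_map (act_infty alpha g) (X f)).
    (* [F_act] is computed on a representative; that the action preserves the annihilator uses the
       invariance of [D] under [g^-1]. *)
    rewrite kX phia -kX /F_act; apply: quot_map_pi => y z H d' Dd'.
    have H' := H _ (iD g^-1%g _ Dd').
    rewrite -[X in X ** _ = 0]/(val (subalg_map (act_infty alpha g) y) - val (subalg_map (act_infty alpha g) z)).
    rewrite -[X in _ /\ _ ** X = 0]/(val (subalg_map (act_infty alpha g) y) - val (subalg_map (act_infty alpha g) z)).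
    rewrite !subalg_mapE // -act_inftyN -act_inftyD -(actKV alpha g d') -act_infty_const -!act_inftyM.
    by case: H' => H1 H2; rewrite [X in act_infty alpha g X = 0]H1 [X in _ /\ act_infty alpha g X = 0]H2 act_infty0.
  by rewrite (kappa_eq E Dd) subalg_mapE.
Qed.
End RokhlinLift.

(** [rho p] acts as a distance from [p]. The function [2 - rho p / d], clipped to the interval from
    0 to 1, equals 1 where [rho p <= d] and vanishes where [rho p >= 2 d]. *)
Lemma bump_cover (R : realType) (G : topologicalGroupType) (rho : G -> G -> R) (d : R) :
  compact [set: G] -> (forall p, continuous (rho p)) -> (forall p, rho p p = 0) -> 0 < d ->
  exists (ps : seq G) (u : G -> G -> R),
    [/\ forall p, continuous (u p), forall p s, 0 <= u p s <= 1,
        forall p s, u p s != 0 -> rho p s < 2 * d & forall s, exists2 p, p \in ps & u p s = 1].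
Proof.
move=> cptG crho rho0 d0.
have [p|ps Hps] := finite_nbhs_cover cptG (U := fun p => [set s | rho p s < d]).
  have /cvgrPdist_lt/(_ _ d0) := crho p p; rewrite rho0.
  by apply: filterS => s; rewrite sub0r normrN; apply: le_lt_trans; exact: ler_norm.
exists ps, (fun p s => Num.min 1 (Num.max 0 (2 - rho p s / d))); split.
- move=> p s.
  have c1 : {for s, continuous (fun s => 2 - rho p s / d : R^o)}.
    by apply: cvgB; [exact: cvg_cst|apply: cvgMr_tmp; exact: crho].
  have c2 := @continuous_max R G (fun=> 0 : R^o) _ s (@cst_continuous _ _ (0 : R^o) s) c1.
  exact: (@continuous_min R G (fun=> 1 : R^o) _ s (@cst_continuous _ _ (1 : R^o) s) c2).
- by move=> p s; rewrite le_min ler01 le_max lexx ge_min lexx.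
- move=> p s; apply: contraNT; rewrite -leNgt => H.
  rewrite (_ : Num.max 0 (2 - rho p s / d) = 0) ?min_r //.
  by apply: max_l; rewrite subr_le0 ler_pdivlMr.
- move=> s; have [p pps /= Hp] := Hps s; exists p => //.
  apply: min_l; rewrite le_max; apply/orP; right.
  have : rho p s / d < 1 by rewrite ltr_pdivrMr // mul1r.
  lra.
Qed.

(** * Contractivity of the map from tensors C(G) (x) D to the sequence algebra *)

Section Tensors.
Variables (R : realType) (G : topologicalGroupType) (A : cstarAlgType R).
Variable alpha : cstarAction G A.
Variable D : starSubalg A.
Hypothesis iD : forall g d, sset D d -> sset D (alpha g d).
Variable q : CG R G -> linf A.
Hypothesis Hq : rokhlin_lift alpha D q.
Local Notation Q f := (Defs.eta (q f)).
Local Notation c_ := (@const_seq R A).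
Local Notation one := (CG_const G (1 : R[i])).
Implicit Types (x y z : A_infty A) (f h : CG R G).

(* [Tens x K]: [x] is the image of the elementary-tensor sum with values
   [K : G -> A] under [f (x) d |-> Q f ** d]. *)
Inductive Tens : A_infty A -> (G -> A) -> Prop :=
| Tens0 : Tens 0 (fun=> 0)
| TensS f d x K : sset D d -> Tens x K ->
    Tens (Q f ** c_ d + x) (fun s => (val f s : R[i]) *: d + K s).

Definition tens (t : seq (CG R G * A)) : A_infty A := \sum_(p <- t) Q p.1 ** c_ p.2.
Definition tev (t : seq (CG R G * A)) (s : G) : A := \sum_(p <- t) (val p.1 s : R[i]) *: p.2.

Lemma Tens_ext x y K L : Tens x K -> x = y -> (forall s, K s = L s) -> Tens y L.
Proof. by move=> H <- /funext <-. Qed.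

Lemma Tens_seq x K : Tens x K -> exists t : seq (CG R G * A),
  [/\ forall p, p \in t -> sset D p.2, x = tens t & forall s, K s = tev t s].
Proof.
elim=> [|f d {}x {}K Dd _ [t [Dt -> KE]]].
  by exists [::]; split=> // [|s]; rewrite /tens /tev big_nil.
exists ((f, d) :: t); split.
- by move=> p; rewrite inE => /orP[/eqP->|/Dt].
- by rewrite /tens big_cons.
- by move=> s; rewrite /tev big_cons KE.
Qed.

Lemma Tens_bounded x K : compact [set: G] -> Tens x K -> exists2 M, 0 <= M & forall s, rnorm (K s) <= M.
Proof.
move=> cptG; elim=> [|f d {}x {}K Dd _ [M M0 KM]]; first by exists 0 => // s; rewrite rnorm0.
have [B HB] := cpt_rnorm_bounded cptG (@CG_cvg R G f).
exists (B * rnorm d + M).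
  by rewrite addr_ge0 // mulr_ge0 ?rnorm_ge0 // (le_trans _ (HB 1%g)) ?rnorm_ge0.
by move=> s; rewrite (le_trans (rnormD _ _)) // lerD // rnormZ ler_wpM2r ?rnorm_ge0.
Qed.

Lemma TensD x y K L : Tens x K -> Tens y L -> Tens (x + y) (fun s => K s + L s).
Proof.
move=> Tx Ty; elim: Tx => [|f d {}x {}K Dd Tx IH].
  by apply: (Tens_ext Ty); [rewrite add0r|move=> s; rewrite add0r].
by apply: (Tens_ext (TensS f Dd IH)) => [|s]; rewrite addrA.
Qed.

Lemma Tens1 f d : sset D d -> Tens (Q f ** c_ d) (fun s => (val f s : R[i]) *: d).
Proof.
by move=> Dd; apply: (Tens_ext (TensS f Dd Tens0)) => [|s]; rewrite addr0.
Qed.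

(** The relations of a lift are known only against [const_seq d]; since [Q f] commutes with it, they
    apply in each summand [Q f ** c_ d]. *)
Lemma Tens_eq x K (X Y : A_infty A) : (forall d, sset D d -> X ** c_ d = Y ** c_ d) ->
  Tens x K -> X ** x = Y ** x.
Proof.
move=> XY; elim=> [|f d {}x {}K Dd _ IH]; first by rewrite !amulr0.
by rewrite !amulDr IH (q_comm Hq) // !amulA XY.
Qed.

Lemma Qmul f h x K : Tens x K -> Q (f ** h) ** x = Q f ** (Q h ** x).
Proof. by move=> T; rewrite amulA; apply: Tens_eq T => d; exact: (q_mul Hq). Qed.

Lemma Qlin k f h x K : Tens x K -> Q (k *: f + h) ** x = k *: (Q f ** x) + Q h ** x.
Proof. by move=> T; rewrite -amulZl -amulDl; apply: Tens_eq T => d; exact: (q_lin Hq). Qed.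

Lemma Qstar f x K : Tens x K -> Q (star f) ** x = star (Q f) ** x.
Proof. by apply: Tens_eq => d; exact: (q_star Hq). Qed.

Lemma Q0 x K : Tens x K -> Q 0 ** x = 0.
Proof. by move=> T; have := Qlin (-1) 0 0 T; rewrite scaler0 addr0 scaleN1r addNr. Qed.

Lemma QD f h x K : Tens x K -> Q (f + h) ** x = Q f ** x + Q h ** x.
Proof. by move=> T; have := Qlin 1 f h T; rewrite !scale1r. Qed.

Lemma QZ k f x K : Tens x K -> Q (k *: f) ** x = k *: (Q f ** x).
Proof. by move=> T; have := Qlin k f 0 T; rewrite (Q0 T) !addr0. Qed.

Lemma Q1 x K : Tens x K -> Q one ** x = x.
Proof.
elim=> [|f d {}x {}K Dd _ IH]; first by rewrite amulr0.
by rewrite amulDr IH; congr (_ + _); rewrite (q_comm Hq) // amulA (q_one Hq).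
Qed.

Lemma Qcomm f x K : Tens x K -> Q f ** x = x ** Q f.
Proof.
elim=> [|h d {}x {}K Dd _ IH]; first by rewrite amulr0 amul0r.
rewrite amulDr amulDl IH; congr (_ + _).
have comm : f ** h = h ** f.
  by apply: CG_ext => t; rewrite !CG_mulE mulrC.
by rewrite amulA -(q_mul Hq) // comm (q_mul Hq) // -[RHS]amulA -(q_comm Hq) // amulA.
Qed.

Lemma TensQ f x K : Tens x K -> Tens (Q f ** x) (fun s => (val f s : R[i]) *: K s).
Proof.
elim=> [|h d {}x {}K Dd _ IH].
  by apply: (Tens_ext Tens0) => [|s]; rewrite ?amulr0 ?scaler0.
apply: (Tens_ext (TensS (f ** h) Dd IH)) => [|s].
  by rewrite amulDr amulA (q_mul Hq).
by rewrite CG_mulE scalerDr scalerA.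
Qed.

Lemma Tens_const d : sset D d -> Tens (c_ d) (fun=> d).
Proof.
move=> Dd; apply: (Tens_ext (Tens1 one Dd)) => [|s]; first exact: (q_one Hq).
by rewrite CG_constE scale1r.
Qed.

Lemma TensZ k x K : Tens x K -> Tens (k *: x) (fun s => k *: K s).
Proof.
move=> T; apply: (Tens_ext (TensQ (CG_const G k) T)) => // .
have -> : CG_const G k = k *: one by apply: CG_ext => t; rewrite CG_scaleE !CG_constE mulr1.
by rewrite (QZ _ _ T) (Q1 T).
Qed.

Lemma TensN x K : Tens x K -> Tens (- x) (fun s => - K s).
Proof. by move=> /(TensZ (-1)) T; apply: (Tens_ext T) => [|s]; rewrite scaleN1r. Qed.

Lemma TensB x y K L : Tens x K -> Tens y L -> Tens (x - y) (fun s => K s - L s).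
Proof. by move=> Tx /TensN Ty; exact: TensD. Qed.

Lemma Tens_constM d y L : sset D d -> Tens y L -> Tens (c_ d ** y) (fun s => d ** L s).
Proof.
move=> Dd; elim=> [|f' d' {}y {}L Dd' Ty IH].
  by apply: (Tens_ext Tens0) => [|s]; rewrite amulr0.
apply: (Tens_ext (TensS f' (subalgM Dd Dd') IH)) => [|s].
  by rewrite amulDr const_seqM !amulA (q_comm Hq).
by rewrite amulDr amulZr.
Qed.

Lemma TensM x y K L : Tens x K -> Tens y L -> Tens (x ** y) (fun s => K s ** L s).
Proof.
move=> Tx Ty; elim: Tx => [|f d {}x {}K Dd Tx IH].
  by apply: (Tens_ext Tens0) => [|s]; rewrite amul0r.
apply: (Tens_ext (TensD (TensQ f (Tens_constM Dd Ty)) IH)) => [|s].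
  by rewrite amulDl amulA.
by rewrite amulDl amulZl.
Qed.

Lemma Tens_star x K : Tens x K -> Tens (star x) (fun s => star (K s)).
Proof.
elim=> [|f d {}x {}K Dd _ IH].
  by apply: (Tens_ext Tens0) => [|s]; rewrite star0.
apply: (Tens_ext (TensS (star f) (subalg_star Dd) IH)) => [|s].
  rewrite starD; congr (_ + _); rewrite (q_star Hq); last exact: subalg_star.
  by rewrite (q_comm Hq) // starM const_star.
by rewrite starD starZ CG_starE.
Qed.

Lemma Tens_act g x K : Tens x K ->
  Tens (act_infty alpha g x) (fun s => alpha g (K (g^-1 * s)%g)).
Proof.
elim=> [|f d {}x {}K Dd _ IH].
  by apply: (Tens_ext Tens0) => [|s]; rewrite ?act_infty0 ?act0.
apply: (Tens_ext (TensS (left_translation g f) (iD g Dd) IH)) => [|s].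
  by rewrite act_inftyD act_inftyM act_infty_const (q_act Hq) //; exact: iD.
by rewrite actD actZ left_translationE.
Qed.

Lemma Q_unitary u x K : star u ** u = one -> Tens x K -> snorm (Q u ** x) = snorm x.
Proof.
move=> uu T; apply/eqP; rewrite -(@eqrXn2 _ 2) ?snorm_ge0 // -!snorm_cstar.
rewrite starM -amulA -(Qstar u (TensQ u T)) -(Qmul _ _ T) uu (Q1 T).
by [].
Qed.

(* A real [f] with [|f| <= 1] is the mean of a unitary and its adjoint. *)
Lemma Q_contractive f x K (r : G -> R) : (forall s, val f s = (r s)%:C) ->
  (forall s, `|r s| <= 1) -> Tens x K -> snorm (Q f ** x) <= snorm x.
Proof.
move=> fr r1 T.
have cr : continuous r.
  have -> : r = (fun t => complex.Re (val f t : R[i])) by apply/funext => t; rewrite fr.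
  exact: CG_val_continuous_re.
have r2 s : r s ^+ 2 <= 1 by rewrite -[r s ^+ 2]real_normK ?num_real // expr_le1.
have cg : continuous (fun s => Num.sqrt (1 - r s ^+ 2)).
  move=> s; apply: (@continuous_comp _ _ _ (fun s => 1 - r s ^+ 2) (@Num.sqrt R)); last exact: sqrt_continuous.
  by apply: cvgB; [exact: cvg_cst|apply: cvgM; exact: cr].
have [g gE] := real_CG cg.
pose j : R[i] := 0 +i* 1.
pose u := f + j *: g; pose u' := f + (- j) *: g.
have us : star u = u'.
  apply: CG_ext => s; rewrite CG_starE !CG_addE !CG_scaleE fr gE.
  by apply/eqP; rewrite eq_complex /=; apply/andP; split; apply/eqP; ring.
have g2 s : Num.sqrt (1 - r s ^+ 2) ^+ 2 = 1 - r s ^+ 2 by rewrite sqr_sqrtr // subr_ge0.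
have uu : star u ** u = one.
  apply: CG_ext => s; rewrite us CG_mulE !CG_addE !CG_scaleE fr gE CG_constE.
  apply/eqP; rewrite eq_complex /=; apply/andP; split; apply/eqP; last by ring.
  by have := g2 s; move: (Num.sqrt _) => w h; ring: h.
have uu' : star u' ** u' = one.
  apply: CG_ext => s; rewrite -us starK us CG_mulE !CG_addE !CG_scaleE fr gE CG_constE.
  apply/eqP; rewrite eq_complex /=; apply/andP; split; apply/eqP; last by ring.
  by have := g2 s; move: (Num.sqrt _) => w h; ring: h.
have fE : f = (1 / 2)%:C *: (u + u').
  apply: CG_ext => s; rewrite CG_scaleE !CG_addE !CG_scaleE fr gE.
  by apply/eqP; rewrite eq_complex /=; apply/andP; split; apply/eqP; field.
rewrite fE (QZ _ _ T) (QD _ _ T) (le_trans (snormZ _ _)) // rnorm_real ger0_norm ?divr_ge0 //.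
rewrite (le_trans (ler_wpM2l _ (snormD _ _))) ?divr_ge0 // (Q_unitary uu T) (Q_unitary uu' T).
lra.
Qed.

(** Real and imaginary parts cost [B] each. This crude bound only serves to control small errors in
    the coefficient functions. *)
Lemma Q_bound f x K (B : R) : (forall s, rnorm (val f s : R[i]^o) <= B) -> Tens x K ->
  snorm (Q f ** x) <= 2 * B * snorm x.
Proof.
move=> fB T.
have B0 : 0 <= B by apply: le_trans (fB 1%g); exact: rnorm_ge0.
have H (r : G -> R) h (C : R) : 0 < C -> (forall s, val h s = (r s)%:C) ->
    (forall s, `|r s| <= C) -> snorm (Q h ** x) <= C * snorm x.
  move=> C0 hr rC.
  have hE : h = C%:C *: ((C^-1)%:C *: h).
    by apply: CG_ext => s; rewrite !CG_scaleE mulrA -rmorphM divff ?gt_eqF // mul1r.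
  rewrite hE (QZ _ _ T) (le_trans (snormZ _ _)) // rnorm_real gtr0_norm // ler_pM2l //.
  apply: (@Q_contractive _ _ _ (fun s => C^-1 * r s)) T => s.
    by rewrite CG_scaleE hr rmorphM.
  by rewrite normrM gtr0_norm ?invr_gt0 // ler_pdivrMl // mulr1.
have Re_le (z : R[i]) : `|complex.Re z| <= rnorm (z : R[i]^o).
  by have := normc_ge_Re z; rewrite (rnormE (z : R[i]^o)) lecR.
have [h1 h1E] := real_CG (@CG_val_continuous_re _ _ f).
pose mj : R[i] := 0 -i* 1.
have [h2 h2E] := real_CG (@CG_val_continuous_re _ _ (mj *: f)).
have fE : f = (0 +i* 1) *: h2 + h1.
  apply: CG_ext => s; rewrite CG_addE CG_scaleE h1E h2E CG_scaleE.
  by case: (val f s : R[i]) => a b; apply/eqP; rewrite eq_complex /=; apply/andP; split; apply/eqP; ring.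
apply/ler_addgt0Pr => e e0.
have x1 : 0 < 2 * (snorm x + 1) by rewrite mulr_gt0 // ltr_wpDl // snorm_ge0.
(* [C] exceeds [B] so that it can be divided by even when [B = 0]. *)
pose C := B + e / (2 * (snorm x + 1)).
have C0 : 0 < C by rewrite ltr_wpDl // divr_gt0.
have BC : B <= C by rewrite lerDl ltW // divr_gt0.
have N1 : snorm (Q h1 ** x) <= C * snorm x.
  by apply: (H _ _ _ C0 h1E) => s; rewrite (le_trans (Re_le _)) // (le_trans (fB s)).
have N2 : snorm (Q h2 ** x) <= C * snorm x.
  apply: (H _ _ _ C0 h2E) => s; rewrite (le_trans (Re_le _)) // CG_scaleE.
  rewrite -[mj * _]/(mj *: (val f s : R[i]^o)) rnormZ /mj.
  have -> : rnorm (0 -i* 1 : R[i]^o) = 1.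
    by rewrite /rnorm normc_def /= expr0n /= add0r sqrrN expr1n sqrtr1.
  by rewrite mul1r (le_trans (fB s)).
rewrite fE (Qlin _ _ _ T) (le_trans (snormD _ _)) //.
rewrite (le_trans (lerD (snormZ _ _) (lexx _))) //.
have -> : rnorm (0 +i* 1 : R[i]^o) = 1.
  by rewrite /rnorm normc_def /= expr0n /= add0r expr1n sqrtr1.
rewrite mul1r (le_trans (lerD N2 N1)) //.
have eE : e = (2 * (snorm x + 1)) * (e / (2 * (snorm x + 1))) by rewrite mulrCA divff ?mulr1 // gt_eqF.
rewrite [X in _ <= _ + X]eE /C; have := divr_ge0 (ltW e0) (ltW x1).
move: (e / _) => w w0; rewrite -subr_ge0.
have -> : 2 * B * snorm x + 2 * (snorm x + 1) * w - ((B + w) * snorm x + (B + w) * snorm x) = 2 * w.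
  by ring.
by rewrite mulr_ge0.
Qed.

Section Binomial.
Variables (h g : CG R G) (rh : G -> R).
Hypotheses (hE : forall s, val h s = (rh s)%:C) (gE : forall s, val g s = (1 - rh s)%:C)
  (rh01 : forall s, 0 <= rh s <= 1).

Definition CG_pow (f : CG R G) n : CG R G := iter n (fun k => f ** k) one.

Lemma CG_powE f n s : val (CG_pow f n) s = (val f s : R[i]) ^+ n.
Proof. by elim: n => // n IH; rewrite exprS -IH -CG_mulE. Qed.

Definition binom_mon n k : CG R G := CG_pow h k ** CG_pow g (n - k).

Lemma binom_monE n k s : val (binom_mon n k) s = (rh s ^+ k * (1 - rh s) ^+ (n - k))%:C.
Proof. by rewrite CG_mulE !CG_powE hE gE rmorphM !rmorphXn. Qed.

Lemma binom_mon_h n k : binom_mon n k ** h = binom_mon n.+1 k.+1.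
Proof.
apply: CG_ext => s; rewrite CG_mulE !binom_monE hE -rmorphM subSS exprS.
by congr (_%:C); ring.
Qed.

Lemma binom_mon_g n k : (k <= n)%N -> binom_mon n k ** g = binom_mon n.+1 k.
Proof.
move=> kn; apply: CG_ext => s; rewrite CG_mulE !binom_monE gE -rmorphM subSn // exprS.
by congr (_%:C); ring.
Qed.

(* [z] is a sum of words of length [n] in [Q h ** a] and [Q g ** b], grouped by
   the number [k] of occurrences of [h]; only [n + 1] groups occur. *)
Definition binom_word n z := exists Z : nat -> A_infty A,
  [/\ forall k, exists K, Tens (Z k) K, forall k, snorm (Z k) <= 'C(n, k)%:R &
      z = \sum_(k < n.+1) Q (binom_mon n k) ** Z k].

Variables (a b : A_infty A) (Ka Kb : G -> A).
Hypotheses (Ta : Tens a Ka) (Tb : Tens b Kb) (a1 : snorm a <= 1) (b1 : snorm b <= 1).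

Lemma binom_word1 : binom_word 1 (Q h ** a + Q g ** b).
Proof.
exists (fun k => if k is k'.+1 then if k' is 0%N then a else 0 else b); split.
- by move=> [|[|k]]; eexists; [exact: Tb|exact: Ta|exact: Tens0].
- by move=> [|[|k]] //; rewrite snorm0 ler0n.
rewrite big_ord_recr big_ord1 /= addrC; congr (_ + _).
  congr (_ ** _); congr (Defs.eta (q _)); apply: CG_ext => s.
  by rewrite binom_monE hE subnn expr1 expr0 mulr1.
congr (_ ** _); congr (Defs.eta (q _)); apply: CG_ext => s.
by rewrite binom_monE gE subn0 expr1 expr0 mul1r.
Qed.

(** Pascal's rule: a word with [k + 1] occurrences of [h] arises by appending [a] to one with [k] of
    them, or [b] to one with [k + 1]. The functions [h] and [g] are collected in front because they
    are central. *)
Lemma binom_wordS n z : binom_word n z -> binom_word n.+1 (z ** (Q h ** a + Q g ** b)).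
Proof.
move=> [Z [TZ NZ zE]].
exists (fun k => (if k is k'.+1 then Z k' ** a else 0) + Z k ** b); split.
- move=> k; have [K1 T1] := TZ k; have [K2 T2] := TZ k.-1.
  case: k T1 T2 => [|k] /= T1 T2; eexists.
    exact: (TensD Tens0 (TensM T1 Tb)).
  exact: (TensD (TensM T2 Ta) (TensM T1 Tb)).
- have M1 k c : snorm c <= 1 -> snorm (Z k ** c) <= 'C(n, k)%:R.
    move=> c1; rewrite (le_trans (snormM _ _)) // -[leRHS]mulr1 ler_pM ?snorm_ge0 //.
  move=> [|k].
    by rewrite add0r bin0; have := M1 0%N b b1; rewrite bin0.
  by rewrite (le_trans (snormD _ _)) // binS natrD addrC lerD // M1.
(* The vanishing of the binomial coefficient kills the term beyond the range, so that the two
   shifted sums have the same index set. *)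
have Zn : Z n.+1 = 0.
  by apply: snorm_eq0; have := NZ n.+1; rewrite bin_small.
pose M k := Q (binom_mon n.+1 k).
have -> : \sum_(k < n.+2) M k ** ((if k : nat is k'.+1 then Z k' ** a else 0) + Z k ** b) =
    \sum_(k < n.+1) (M k.+1 ** (Z k ** a) + M k ** (Z k ** b)).
  under eq_bigr do rewrite amulDr.
  rewrite big_split /= big_ord_recl amulr0 add0r.
  rewrite [X in _ + X]big_ord_recr /= Zn amul0r amulr0 addr0 -big_split.
  by apply: eq_bigr => k _.
rewrite zE -[X in _ = X]/(\sum_(k < n.+1) _).
have -> u : (\sum_(k < n.+1) Q (binom_mon n k) ** Z k) ** u = \sum_(k < n.+1) (Q (binom_mon n k) ** Z k) ** u.
  by rewrite (big_morph (fun v => v ** u) (id1 := 0) (op1 := +%R)) ?amul0r // => v w; rewrite amulDl.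
apply: eq_bigr => k _; have [K T] := TZ k.
rewrite amulDr -!amulA /M; congr (_ + _).
  rewrite -binom_mon_h (Qmul _ _ (TensM T Ta)) [Z k ** (Q h ** a)]amulA -(Qcomm h T).
  by rewrite [Q h ** (Z k ** a)]amulA.
rewrite -binom_mon_g -1?ltnS // (Qmul _ _ (TensM T Tb)) [Z k ** (Q g ** b)]amulA -(Qcomm g T).
by rewrite [Q g ** (Z k ** b)]amulA.
Qed.

(** ['C(n, k) h^k (1 - h)^(n - k)] is one term of the expansion of [(h + (1 - h))^n = 1], hence
    takes values between 0 and 1 and acts contractively. Each of the [n + 1] groups thus contributes
    at most 1. *)
Lemma binom_word_le n z : binom_word n z -> snorm z <= n.+1%:R.
Proof.
move=> [Z [TZ NZ ->]]; rewrite (le_trans (snorm_sum _ _)) //.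
rewrite (@le_trans _ _ (\sum_(k < n.+1) 1)) //; last by rewrite sumr_const card_ord.
apply: ler_sum => k _; have [K T] := TZ k.
have kn : (k <= n)%N by rewrite -ltnS.
have C0 : 0 < 'C(n, k)%:R :> R by rewrite ltr0n bin_gt0.
set C := 'C(n, k)%:R in C0.
have mE : binom_mon n k = (C^-1)%:C *: (C%:C *: binom_mon n k).
  by apply: CG_ext => s; rewrite !CG_scaleE mulrA -rmorphM mulVf ?gt_eqF // mul1r.
rewrite mE (QZ _ _ T) (le_trans (snormZ _ _)) // rnorm_real gtr0_norm ?invr_gt0 //.
rewrite ler_pdivrMl // mulr1 (le_trans _ (NZ k)) //.
apply: (@Q_contractive _ _ _ (fun s => C * (rh s ^+ k * (1 - rh s) ^+ (n - k)))) T => s.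
  by rewrite CG_scaleE binom_monE -rmorphM.
have /andP[r0 r1] := rh01 s.
rewrite ger0_norm; last by rewrite !mulr_ge0 ?ler0n // exprn_ge0 // subr_ge0.
have : (1 - rh s + rh s) ^+ n = 1 by rewrite subrK expr1n.
rewrite exprDn => E; rewrite -[X in _ <= X]E (bigD1 (Ordinal (kn : k < n.+1)%N)) //= -mulr_natl.
rewrite [rh s ^+ k * _]mulrC lerDl sumr_ge0 // => i _.
by rewrite mulrn_wge0 // mulr_ge0 // exprn_ge0 // subr_ge0.
Qed.
End Binomial.

(** The power [y^(n + 1)]; the shift avoids a unit. *)
Definition apow (y : A_infty A) n := iter n (fun z => z ** y) y.

Lemma apowD y m n : apow y m ** apow y n = apow y (m + n).+1.
Proof. by elim: n => [|n IH] /=; rewrite ?addn0 // addnS amulA IH. Qed.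

Lemma apow_sa y n : star y = y -> star (apow y n) = apow y n /\
  (forall j, snorm (apow y (2 ^ j).-1) = snorm y ^+ (2 ^ j)).
Proof.
move=> sy; have comm m : y ** apow y m = apow y m ** y.
  by elim: m => // m IH; rewrite /= amulA IH.
have sa m : star (apow y m) = apow y m.
  by elim: m => //= m IH; rewrite starM sy IH comm.
split=> // j; elim: j => [|j IH]; first by rewrite expr1.
have j0 : (0 < 2 ^ j)%N by rewrite expn_gt0.
have -> : (2 ^ j.+1).-1 = ((2 ^ j).-1 + (2 ^ j).-1).+1.
  by rewrite expnS mul2n -addnn; case: (2 ^ j)%N j0 => // k _; rewrite addSn addnS.
by rewrite -apowD -{1}sa snorm_cstar IH -exprM expnS mulnC.
Qed.

(** The triangle inequality would give only [2 M]. For [w] the combination with [M = 1], powers of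
    [star w ** w] are words, with norm at most linear in the exponent. By the C*-identity their
    norms are powers of [|w|^2], and [pow2_le] gives [|w| <= 1]. *)
Lemma snorm_convex h (g : CG R G) (rh : G -> R) (a b : A_infty A) Ka Kb (M : R) : (forall s, val h s = (rh s)%:C) ->
  (forall s, val g s = (1 - rh s)%:C) -> (forall s, 0 <= rh s <= 1) ->
  Tens a Ka -> Tens b Kb -> 0 < M -> snorm a <= M -> snorm b <= M ->
  snorm (Q h ** a + Q g ** b) <= M.
Proof.
move=> hE gE rh01.
have real_star f (r : G -> R) : (forall s, val f s = (r s)%:C) -> star f = f.
  by move=> fr; apply: CG_ext => s; rewrite CG_starE fr; exact: conjc_real.
have main a' b' K L : Tens a' K -> Tens b' L -> snorm a' <= 1 -> snorm b' <= 1 ->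
    snorm (Q h ** a' + Q g ** b') <= 1.
  move=> Ta Tb a1 b1; set w := _ + _.
  have sQ f c C : star f = f -> Tens c C -> star (Q f ** c) = Q f ** star c.
    move=> sf Tc; rewrite (Qcomm f Tc) starM -{1}sf -(Qstar _ (Tens_star Tc)).
    by rewrite starK.
  pose w' := Q h ** star a' + Q g ** star b'.
  have wE : star w = w'.
    by rewrite starD (sQ _ _ _ (real_star _ _ hE) Ta) (sQ _ _ _ (real_star _ _ gE) Tb).
  have word m : binom_word h g (m.+1).*2 (apow (w' ** w) m).
    have a1' : snorm (star a') <= 1 by rewrite snorm_star.
    have b1' : snorm (star b') <= 1 by rewrite snorm_star.
    have W1 := binom_word1 hE gE (Tens_star Ta) (Tens_star Tb) a1' b1'.
    have WS n z H := binom_wordS hE gE Ta Tb a1 b1 (n := n) (z := z) H.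
    have WS' n z H := binom_wordS hE gE (Tens_star Ta) (Tens_star Tb) a1' b1' (n := n) (z := z) H.
    elim: m => [|m IH]; first exact: WS W1.
    rewrite [apow _ _]/= amulA; exact: WS (WS' _ _ IH).
  have sy : star (w' ** w) = w' ** w by rewrite -wE starM starK.
  have y1 : snorm (w' ** w) <= 1.
    (* The [2^j]-th power is a word of length [2 * 2^j], hence has [2 * 2^j + 1 <= 3 * 2^j]
       groups. *)
    apply: (@pow2_le _ _ _ 3) => //; first exact: snorm_ge0.
    move=> j; rewrite -(apow_sa 0 sy).2 expr1n mulr1.
    rewrite (le_trans (binom_word_le hE gE rh01 (word _))) // prednK ?expn_gt0 //.
    rewrite -natrM ler_nat; have := expn_gt0 2 j; rewrite -muln2.
    by move: (2 ^ j)%N => n n0; rewrite mulnC -addn1 -[X in (_ <= X * _)%N]/(2 + 1)%N mulnDl mul1n leq_add2l.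
  by move: y1; rewrite -wE snorm_cstar expr_le1 ?snorm_ge0.
move=> Ta Tb M0 aM bM.
have Mi : 0 < M^-1 by rewrite invr_gt0.
have sc (c : A_infty A) : snorm c <= M -> snorm ((M^-1)%:C *: c) <= 1.
  by move=> cM; rewrite (le_trans (snormZ _ _)) // rnorm_real gtr0_norm // ler_pdivrMl // mulr1.
have -> : Q h ** a + Q g ** b = M%:C *: (Q h ** ((M^-1)%:C *: a) + Q g ** ((M^-1)%:C *: b)).
  by rewrite !amulZr -scalerDr scalerA -rmorphM divff ?gt_eqF // scale1r.
rewrite (le_trans (snormZ _ _)) // rnorm_real gtr0_norm // ler_piMr ?(ltW M0) //.
by apply: (main _ _ _ _ (TensZ (M^-1)%:C Ta) (TensZ (M^-1)%:C Tb)); exact: sc.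
Qed.

Section Nested.
Variables (u : G -> CG R G) (ru : G -> G -> R).
Hypotheses (uE : forall p s, val (u p) s = (ru p s)%:C) (ru01 : forall p s, 0 <= ru p s <= 1).

Definition CG_compl f : CG R G := one + (-1) *: f.

Lemma CG_complE p s : val (CG_compl (u p)) s = (1 - ru p s)%:C.
Proof. by rewrite CG_addE CG_scaleE CG_constE uE mulN1r rmorphB rmorph1. Qed.

(* [sum_p f(p) w_p] for the partition [w_p = u p * prod_{p' before p} (1 - u p')]. *)
Definition nested (ps : seq G) f : CG R G :=
  foldr (fun p acc => (val f p : R[i]) *: u p + CG_compl (u p) ** acc) 0 ps.

Lemma nested_close ps f (d : R) s : (forall p, ru p s != 0 -> rnorm (val f s - val f p : R[i]^o) <= d) ->
  (exists2 p, p \in ps & ru p s = 1) -> rnorm (val f s - val (nested ps f) s : R[i]^o) <= d.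
Proof.
move=> H; elim: ps => [[]//|p ps IH] [p' p'ps up'].
rewrite -[nested (p :: ps) f]/((val f p : R[i]) *: u p + CG_compl (u p) ** nested ps f).
rewrite CG_addE CG_scaleE CG_mulE CG_complE uE.
have dp : ru p s * rnorm (val f s - val f p : R[i]^o) <= ru p s * d.
  have [->|/H Hp] := eqVneq (ru p s) 0; first by rewrite !mul0r.
  by rewrite ler_wpM2l //; case/andP: (ru01 p s).
have [r0 r1] := andP (ru01 p s).
set fs := (val f s : R[i]); set fp := (val f p : R[i]); set n := (val (nested ps f) s : R[i]).
have E : fs - (fp * (ru p s)%:C + (1 - ru p s)%:C * n) =
  (ru p s)%:C * (fs - fp) + (1 - ru p s)%:C * (fs - n).
  by rewrite rmorphB rmorph1; ring.
have H2 : (1 - ru p s) * rnorm (fs - n : R[i]^o) <= (1 - ru p s) * d.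
  have [->|ne] := eqVneq (ru p s) 1; first by rewrite subrr !mul0r.
  rewrite ler_wpM2l ?subr_ge0 //; apply: IH; exists p' => //.
  by move: p'ps; rewrite inE => /orP[/eqP pp|//]; move: ne; rewrite -pp up' eqxx.
rewrite -[X in rnorm X]/(fs - (fp * (ru p s)%:C + (1 - ru p s)%:C * n) : R[i]^o) E.
rewrite (le_trans (rnormD _ _)) //.
rewrite -[X in rnorm X + _]/((ru p s)%:C *: (fs - fp : R[i]^o)) -[X in _ + rnorm X]/((1 - ru p s)%:C *: (fs - n : R[i]^o)).
rewrite !rnormZr (ger0_norm r0) (@ger0_norm _ (1 - ru p s)) ?subr_ge0 //.
rewrite (le_trans (lerD dp H2)) //; lra.
Qed.

Lemma nested_tens t ps : (forall p, p \in t -> sset D p.2) ->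
  exists K, Tens (tens [seq (nested ps p.1, p.2) | p <- t]) K.
Proof.
elim: t => [|[f d] t IH] H /=.
  by exists (fun=> 0); rewrite /tens big_nil; exact: Tens0.
have [|K TK] := IH; first by move=> p pt; apply: H; rewrite inE pt orbT.
rewrite /tens big_cons /=; eexists; apply: TensS TK.
by apply: (H (f, d)); rewrite inE eqxx.
Qed.

Lemma tev_D t s : (forall p, p \in t -> sset D p.2) -> sset D (tev t s).
Proof.
elim: t => [|[f d] t IH] H; first by rewrite /tev big_nil; exact: subalg0.
rewrite /tev big_cons /=; apply: subalgD.
  by apply: subalgZ; apply: (H (f, d)); rewrite inE eqxx.
by apply: IH => p pt; apply: H; rewrite inE pt orbT.
Qed.

(** Nesting reduces the whole partition to repeated two-term convex combinations, so [snorm_convex]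
    applies step by step; the new term each time is the constant [tev t p], whose norm is at most
    [M]. *)
Lemma nested_snorm t ps (M : R) : 0 < M -> (forall p, p \in t -> sset D p.2) ->
  (forall s, rnorm (tev t s) <= M) -> snorm (tens [seq (nested ps p.1, p.2) | p <- t]) <= M.
Proof.
move=> M0 Dt tM; elim: ps => [|p ps IH].
  rewrite /tens big_map big_seq big1 ?snorm0 ?(ltW M0) // => i it /=.
  by rewrite (Q0 (Tens_const (Dt _ it))).
have [K TK] := nested_tens ps Dt.
have Tp := Tens_const (tev_D p Dt).
have -> : tens [seq (nested (p :: ps) p0.1, p0.2) | p0 <- t] =
    Q (u p) ** c_ (tev t p) + Q (CG_compl (u p)) ** tens [seq (nested ps p0.1, p0.2) | p0 <- t].
  rewrite /tens /tev !big_map /=.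
  elim: t Dt {tM IH TK Tp K} => [|[f d] t IH] Dt.
    by rewrite !big_nil const_seq0 !amulr0 addr0.
  have Dd : sset D d by apply: (Dt (f, d)); rewrite inE eqxx.
  have Td := Tens_const Dd.
  rewrite !big_cons IH /=; last by move=> i it; apply: Dt; rewrite inE it orbT.
  rewrite (QD _ _ Td) (QZ _ _ Td) (Qmul _ _ Td) const_seqD const_seqZ !amulDr amulZr.
  by rewrite addrACA.
apply: (snorm_convex (uE p) (CG_complE p) (ru01 p) Tp TK M0) => //.
by rewrite snorm_const.
Qed.
End Nested.

(** The coefficient functions are replaced by their values at the centres of a fine nested
    partition. Applied to differences, the bound shows that [x] depends only on [K], whatever its
    presentation as a sum of elementary tensors. *)
Theorem Tens_norm x K (M : R) : compact [set: G] -> Tens x K -> (forall s, rnorm (K s) <= M) ->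
  snorm x <= M.
Proof.
move=> cptG /Tens_seq[t [Dt -> KE]] KM.
have {}KM s : rnorm (tev t s) <= M by rewrite -KE.
have M0 : 0 <= M by apply: le_trans (KM 1%g); exact: rnorm_ge0.
apply/ler_addgt0Pr => e e0; have e2 : 0 < e / 2 by rewrite divr_gt0.
pose S := \sum_(p <- t) rnorm p.2.
have S0 : 0 <= S by apply: sumr_ge0 => p _; exact: rnorm_ge0.
(* Coefficients vary by at most [2 d] on a bump and [Q_bound] contributes a factor 2, so the error
   is at most [4 d S <= e / 2]. *)
pose d := e / 2 / (2 * 2 * (S + 1)).
have d0 : 0 < d by rewrite !divr_gt0 // !mulr_gt0 // ltr_wpDl.
pose rho p s := \sum_(v <- t) rnorm (val v.1 s - val v.1 p : R[i]^o).
have crho p : continuous (rho p).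
  move=> s; rewrite /rho; elim: (t) => [|v l IH].
    rewrite (_ : (fun s => _) = (fun=> 0)); first exact: cvg_cst.
    by apply/funext => ?; rewrite big_nil.
  rewrite (_ : (fun s => _) = (fun s => rnorm (val v.1 s - val v.1 p : R[i]^o) +
      \sum_(v <- l) rnorm (val v.1 s - val v.1 p : R[i]^o))); last first.
    by apply/funext => ?; rewrite big_cons.
  apply: cvgD => //.
  apply/cvgrPdist_lt => r r0; have /rnorm_cvgP/(_ r r0) := @CG_cvg R G v.1 s.
  apply: filterS => y Hy; apply: le_lt_trans Hy.
  have H1 := rnorm_tri (val v.1 y : R[i]^o) (val v.1 s) (val v.1 p).
  have H2 := rnorm_tri (val v.1 s : R[i]^o) (val v.1 y) (val v.1 p).
  have H3 := rnormC (val v.1 s : R[i]^o) (val v.1 y).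
  rewrite H3 in H1; rewrite ler_norml; apply/andP; split; lra.
have rho0 p : rho p p = 0 by rewrite /rho big1 // => v _; rewrite subrr rnorm0.
have [ps [ru [cu u01 urho cov]]] := bump_cover cptG crho rho0 d0.
have [u uE] := choice (fun p => real_CG (cu p)).
set z := tens [seq (nested u ps p.1, p.2) | p <- t].
have zM : snorm z <= M + e / 2.
  apply: (nested_snorm uE u01) => //; first by rewrite ltr_wpDl.
  by move=> s; rewrite (le_trans (KM s)) // lerDl ltW.
rewrite (le_trans (snorm_le_sub _ z)) // [e]splitr addrA lerD //.
have bd p : p \in t -> snorm (Q p.1 ** c_ p.2 - Q (nested u ps p.1) ** c_ p.2) <= 2 * (2 * d) * rnorm p.2.
  move=> pt; have Td := Tens_const (Dt _ pt).
  have -> : Q p.1 ** c_ p.2 - Q (nested u ps p.1) ** c_ p.2 = Q (p.1 + (-1) *: nested u ps p.1) ** c_ p.2.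
    by rewrite (QD _ _ Td) (QZ _ _ Td) scaleN1r.
  rewrite -snorm_const; apply: (Q_bound _ Td) => s.
  rewrite CG_addE CG_scaleE mulN1r.
  apply: (nested_close uE u01) => [g|]; last exact: cov.
  move=> /urho H; apply: ltW; apply: le_lt_trans H.
  by rewrite /rho (big_rem p) //= lerDl sumr_ge0 // => v _; exact: rnorm_ge0.
rewrite /z /tens big_map -sumrB (le_trans (snorm_sum _ _)) //.
rewrite (@le_trans _ _ (\sum_(p <- t) 2 * (2 * d) * rnorm p.2)) //.
  by rewrite !big_seq; apply: ler_sum.
rewrite -mulr_sumr -/S /d.
have -> : 2 * (2 * (e / 2 / (2 * 2 * (S + 1)))) * S = e / 2 * (S / (S + 1)).
  by field; rewrite gt_eqF // ltr_wpDl.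
rewrite ler_piMr ?(ltW e2) // ler_pdivrMr ?mul1r ?lerDl // ltr_wpDl //.
Qed.
End Tensors.

(** * Fixed point algebras *)

Section Nest.
Variables (R : realType) (G : topologicalGroupType) (V : normedModType R[i]).
Variables (ru : G -> G -> R).
Hypothesis ru01 : forall p s, 0 <= ru p s <= 1.

Definition nest (K : G -> V) (ps : seq G) (s : G) : V :=
  foldr (fun p acc => (ru p s)%:C *: K p + (1 - ru p s)%:C *: acc) 0 ps.

Lemma nest_close K ps (d : R) s : (forall p, ru p s != 0 -> rnorm (K s - K p) <= d) ->
  (exists2 p, p \in ps & ru p s = 1) -> rnorm (K s - nest K ps s) <= d.
Proof.
move=> H; elim: ps => [[]//|p ps IH] [p' p'ps up'] /=.
have dp : ru p s * rnorm (K s - K p) <= ru p s * d.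
  have [->|/H Hp] := eqVneq (ru p s) 0; first by rewrite !mul0r.
  by rewrite ler_wpM2l //; case/andP: (ru01 p s).
have [r0 r1] := andP (ru01 p s); set n := nest K ps s.
have -> : K s - ((ru p s)%:C *: K p + (1 - ru p s)%:C *: n) =
  (ru p s)%:C *: (K s - K p) + (1 - ru p s)%:C *: (K s - n).
  by rewrite !scalerBr rmorphB rmorph1 !scalerBl !scale1r; abel.
have H2 : (1 - ru p s) * rnorm (K s - n) <= (1 - ru p s) * d.
  have [->|ne] := eqVneq (ru p s) 1; first by rewrite subrr !mul0r.
  rewrite ler_wpM2l ?subr_ge0 //; apply: IH; exists p' => //.
  by move: p'ps; rewrite inE => /orP[/eqP pp|//]; move: ne; rewrite -pp up' eqxx.
rewrite (le_trans (rnormD _ _)) // !rnormZr (ger0_norm r0) (@ger0_norm _ (1 - ru p s)) ?subr_ge0 //.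
rewrite (le_trans (lerD dp H2)) //; lra.
Qed.
End Nest.

Lemma rnorm_continuous_dist (R : realType) (G : topologicalGroupType) (V : normedModType R[i])
  (K : G -> V) (v : V) : continuous K -> continuous (fun s => rnorm (K s - v)).
Proof.
move=> cK s; apply/cvgrPdist_lt => r r0; have /rnorm_cvgP/(_ r r0) := cK s.
apply: filterS => y Hy; apply: le_lt_trans Hy.
have H1 := rnorm_tri (K y) (K s) v; have H2 := rnorm_tri (K s) (K y) v.
have H3 := rnormC (K s) (K y).
rewrite H3 in H1; rewrite ler_norml; apply/andP; split; lra.
Qed.

Section Diagonal.
Variables (R : realType) (A : cstarAlgType R).

(** Completeness of the sequence algebra, in a form where the limit is assembled from entries of the
    [w k], so that entrywise properties such as invariance are inherited exactly. *)
Lemma linf_diagonal (w : nat -> linf A) (C : R) : 0 <= C ->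
  (forall k, snorm (Defs.eta (w k.+1) - Defs.eta (w k)) < C * (1 / 2) ^+ k) ->
  exists u : linf A, (forall n, exists k, val u n = val (w k) n) /\
    forall k, snorm (Defs.eta u - Defs.eta (w k)) <= C * (1 / 2) ^+ k * 2.
Proof.
move=> C0 Hw.
pose P j n := rnorm (val (w j.+1) n - val (w j) n) <= C * (1 / 2) ^+ j.
(* [kap n] is the number of consecutive steps whose estimate already holds at entry [n], capped by
   [n]; it exceeds any given [k] for large [n]. *)
pose kap n := find (fun j => ~~ P j n) (iota 0 n).
have kP n j : (j < kap n)%N -> P j n.
  move=> jk; have := before_find 0%N jk; have jn : (j < n)%N.
    by apply: leq_trans jk _; have := find_size (fun j => ~~ P j n) (iota 0 n); rewrite size_iota.
  by rewrite nth_iota // add0n => /negbFE.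
have kge n k : (k <= n)%N -> (forall j, (j < k)%N -> P j n) -> (k <= kap n)%N.
  move=> kn Hk; rewrite leqNgt; apply/negP => lt.
  have hs : has (fun j => ~~ P j n) (iota 0 n).
    by rewrite has_find size_iota; apply: leq_trans lt kn.
  have := nth_find 0%N hs; rewrite -/(kap n) nth_iota ?add0n; last exact: leq_trans lt kn.
  by rewrite Hk.
have dist n k m : (forall j, (j < k + m)%N -> P j n) ->
    rnorm (val (w (k + m)%N) n - val (w k) n) <= C * (1 / 2) ^+ k * 2 * (1 - (1 / 2) ^+ m).
  elim: m => [|m IH] H; first by rewrite addn0 subrr rnorm0 expr0 subrr mulr0.
  rewrite addnS (le_trans (rnorm_tri (val (w (k + m)%N) n) _ _)) //.
  have H1 : P (k + m)%N n by apply: H; rewrite addnS.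
  rewrite (le_trans (lerD H1 (IH _))) //.
    by move=> j jk; apply: H; rewrite addnS; apply: leqW.
  rewrite exprD exprS -subr_ge0.
  have -> : C * (1 / 2) ^+ k * 2 * (1 - 1 / 2 * (1 / 2) ^+ m) - (C * ((1 / 2) ^+ k * (1 / 2) ^+ m) + C * (1 / 2) ^+ k * 2 * (1 - (1 / 2) ^+ m)) = 0 by field.
  by [].
have dist' n k m : (k <= m)%N -> (forall j, (j < m)%N -> P j n) ->
    rnorm (val (w m) n - val (w k) n) <= C * (1 / 2) ^+ k * 2.
  move=> km H; rewrite -(subnKC km) (le_trans (dist n k _ _)) ?subnKC //.
  have t1 : 1 - (1 / 2) ^+ (m - k) <= 1 :> R by rewrite lerBlDr lerDl exprn_ge0 ?divr_ge0.
  by apply: ler_piMr => //; rewrite !mulr_ge0 // exprn_ge0 // divr_ge0.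
have [M M0 HM] := linf_bounded (w 0%N).
have [u uE] : exists u : linf A, val u = fun n => val (w (kap n)) n.
  apply: (@linf_of_bounded _ _ _ (M + C * (1 / 2) ^+ 0 * 2)) => n.
  by rewrite (le_trans (rnorm_le_sub _ (val (w 0%N) n))) // lerD // dist' // => j; exact: kP.
exists u; split=> [n|k]; first by exists (kap n); rewrite uE.
rewrite etaB; apply: nearle_snorm.
  by rewrite !mulr_ge0 // exprn_ge0 // divr_ge0.
move=> e e0.
have HP j : \forall n \near \oo, P j n.
  have d0 : 0 < C * (1 / 2) ^+ j - snorm (Defs.eta (w j.+1) - Defs.eta (w j)) by rewrite subr_gt0.
  have := Hw j; rewrite etaB in d0 * => _.
  apply: filterS (snorm_nearle (w j.+1 - w j) d0) => n.
  rewrite linfB => H; apply: (le_trans H).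
  by move: (snorm _) (C * _) => X Y; lra.
have HPk : \forall n \near \oo, forall j, (j < k)%N -> P j n.
  elim: k => [|k IH]; first by apply: nearW.
  apply: filterS2 IH (HP k) => n H1 H2 j; rewrite ltnS leq_eqVlt => /orP[/eqP->//|]; exact: H1.
near=> n; rewrite linfB uE /= (@le_trans _ _ (C * (1 / 2) ^+ k * 2)) //; last by rewrite lerDl ltW.
apply: dist' => [|j]; last exact: kP.
apply: kge; first by near: n; exact: nbhs_infty_ge.
by near: n.
Unshelve. all: by end_near. Qed.
End Diagonal.

Section Representation.
Variables (R : realType) (G : topologicalGroupType) (A : cstarAlgType R).
Variable alpha : cstarAction G A.
Hypothesis cptG : compact [set: G].
Variable D : starSubalg A.
Hypothesis iD : forall g d, sset D d -> sset D (alpha g d).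
Variable q : CG R G -> linf A.
Hypothesis Hq : rokhlin_lift alpha D q.
Local Notation Q f := (Defs.eta (q f)).
Local Notation c_ := (@const_seq R A).
Local Notation Tens := (Tens D q).
Implicit Types (x y z : A_infty A).

(** The closure of [Tens]. It reaches functions such as [s |-> alpha s d], which need not be finite
    sums of elementary tensors. *)
Definition Rep x (K : G -> A) := forall e : R, 0 < e -> exists y L,
  [/\ Tens y L, forall s, rnorm (K s - L s) <= e & snorm (x - y) <= e].

Lemma Rep_Tens x K : Tens x K -> Rep x K.
Proof.
move=> T e e0; exists x, K; split=> // [s|]; first by rewrite subrr rnorm0 ltW.
by rewrite subrr snorm0 ltW.
Qed.

Lemma Rep_ext x K L : (forall s, K s = L s) -> Rep x K -> Rep x L.
Proof. by move=> /funext ->. Qed.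

Lemma Rep_norm x K M : Rep x K -> (forall s, rnorm (K s) <= M) -> snorm x <= M.
Proof.
move=> H KM; apply/ler_addgt0Pr => e e0; have e2 : 0 < e / 2 by rewrite divr_gt0.
have [y [L [T KL xy]]] := H _ e2.
rewrite (le_trans (snorm_le_sub x y)) // [e]splitr addrA lerD //.
apply: (Tens_norm Hq cptG T) => s.
by rewrite (le_trans (rnorm_le_sub _ (K s))) // rnormC lerD.
Qed.

Lemma Rep_bounded x K : Rep x K -> exists2 M, 0 <= M & forall s, rnorm (K s) <= M.
Proof.
move=> H; have [y [L [T KL _]]] := H 1 ltr01; have [M M0 LM] := Tens_bounded cptG T.
exists (M + 1); first by rewrite addr_ge0.
by move=> s; rewrite (le_trans (rnorm_le_sub _ (L s))) // lerD.
Qed.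

Lemma RepD x y K L : Rep x K -> Rep y L -> Rep (x + y) (fun s => K s + L s).
Proof.
move=> Hx Hy e e0; have e2 : 0 < e / 2 by rewrite divr_gt0.
have [x' [K' [Tx KK xx]]] := Hx _ e2; have [y' [L' [Ty LL yy]]] := Hy _ e2.
exists (x' + y'), (fun s => K' s + L' s); split; first exact: TensD.
  move=> s; have -> : K s + L s - (K' s + L' s) = (K s - K' s) + (L s - L' s) by abel.
  by rewrite (le_trans (rnormD _ _)) // [e]splitr lerD.
have -> : x + y - (x' + y') = (x - x') + (y - y') by abel.
by rewrite (le_trans (snormD _ _)) // [e]splitr lerD.
Qed.

Lemma RepM x y K L : Rep x K -> Rep y L -> Rep (x ** y) (fun s => K s ** L s).
Proof.
move=> Hx Hy e e0.
have [M M0 KM] := Rep_bounded Hx; have [N N0 LN] := Rep_bounded Hy.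
have s0 : 0 < M + N + 1 by rewrite ltr_wpDl // addr_ge0.
pose d := Num.min 1 (e / (M + N + 1)).
have d0 : 0 < d by rewrite lt_min ltr01 divr_gt0.
have d1 : d <= 1 by rewrite ge_min lexx.
have dE : d * (M + N + 1) <= e by rewrite -ler_pdivlMr // ge_min lexx orbT.
have [x' [K' [Tx KK xx]]] := Hx _ d0; have [y' [L' [Ty LL yy]]] := Hy _ d0.
have est (a b m n : R) : 0 <= a -> 0 <= b -> 0 <= m -> a <= d -> b <= d -> m <= M -> 0 <= n ->
    n <= N + 1 -> m * b + a * n <= e.
  by move=> a0 b0 m0 ad bd mM n0 nN; nra.
exists (x' ** y'), (fun s => K' s ** L' s); split; first exact: (TensM Hq).
  move=> s; have -> : K s ** L s - K' s ** L' s = K s ** (L s - L' s) + (K s - K' s) ** L' s by amul_ring.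
  rewrite (le_trans (rnormD _ _)) // (le_trans (lerD (rnormM _ _) (rnormM _ _))) //.
  apply: est; rewrite ?rnorm_ge0 //.
  by rewrite (le_trans (rnorm_le_sub _ (L s))) // rnormC lerD // (le_trans (LL s)).
have -> : x ** y - x' ** y' = x ** (y - y') + (x - x') ** y' by amul_ring.
rewrite (le_trans (snormD _ _)) // (le_trans (lerD (snormM _ _) (snormM _ _))) //.
apply: est; rewrite ?snorm_ge0 //; first exact: (Rep_norm Hx).
apply: (Tens_norm Hq cptG Ty) => s.
by rewrite (le_trans (rnorm_le_sub _ (L s))) // rnormC lerD // (le_trans (LL s)).
Qed.

Lemma Rep_star x K : Rep x K -> Rep (star x) (fun s => star (K s)).
Proof.
move=> Hx e e0; have [x' [K' [Tx KK xx]]] := Hx _ e0.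
exists (star x'), (fun s => star (K' s)); split; first exact: (Tens_star Hq).
  by move=> s; rewrite -starN -starD rnorm_star.
by rewrite -starN -starD snorm_star.
Qed.

Lemma RepZ k x K : Rep x K -> Rep (k *: x) (fun s => k *: K s).
Proof.
move=> Hx e e0; have k0 : 0 < rnorm (k : R[i]^o) + 1 by rewrite ltr_wpDl // rnorm_ge0.
have [x' [K' [Tx KK xx]]] := Hx _ (divr_gt0 e0 k0).
have est (a : R) : 0 <= a -> a <= e / (rnorm (k : R[i]^o) + 1) -> rnorm (k : R[i]^o) * a <= e.
  move=> a0; rewrite ler_pdivlMr // mulrC mulrDl mul1r => H.
  by apply: le_trans H; rewrite lerDl.
exists (k *: x'), (fun s => k *: K' s); split; first exact: (TensZ Hq).
  by move=> s; rewrite -scalerBr rnormZ est // rnorm_ge0.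
by rewrite -scalerBr (le_trans (snormZ _ _)) // est // snorm_ge0.
Qed.

Lemma RepB x y K L : Rep x K -> Rep y L -> Rep (x - y) (fun s => K s - L s).
Proof.
move=> Hx Hy; rewrite -(scaleN1r y).
by apply: (Rep_ext _ (RepD Hx (RepZ (-1) Hy))) => s; rewrite scaleN1r.
Qed.

Lemma Rep_mull (X : A_infty A) (f : CG R G) :
  (forall x K, Tens x K -> Tens (X ** x) (fun s => (val f s : R[i]) *: K s)) ->
  forall x K, Rep x K -> Rep (X ** x) (fun s => (val f s : R[i]) *: K s).
Proof.
move=> TX x K Hx e e0.
have [B HB] := cpt_rnorm_bounded cptG (@CG_cvg R G f).
have B0 : 0 <= B by apply: le_trans (HB 1%g); exact: rnorm_ge0.
have k0 : 0 < B + snorm X + 1 by rewrite ltr_wpDl // addr_ge0 // snorm_ge0.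
have [x' [K' [Tx KK xx]]] := Hx _ (divr_gt0 e0 k0).
have est (a b : R) : 0 <= a -> a <= e / (B + snorm X + 1) -> 0 <= b ->
    b <= B + snorm X -> b * a <= e.
  move=> a0; rewrite ler_pdivlMr // => H b0 bB; apply: le_trans H.
  by rewrite mulrC ler_wpM2l // (le_trans bB) // lerDl.
exists (X ** x'), (fun s => (val f s : R[i]) *: K' s); split; first exact: TX.
  by move=> s; rewrite -scalerBr rnormZ est ?rnorm_ge0 // (le_trans (HB s)) // lerDl snorm_ge0.
rewrite -amulNr -amulDr (le_trans (snormM _ _)) // est ?snorm_ge0 // lerDr //.
Qed.

Lemma RepQ f x K : Rep x K -> Rep (Q f ** x) (fun s => (val f s : R[i]) *: K s).
Proof. by apply: Rep_mull => {}x {}K; exact: (TensQ Hq). Qed.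

Lemma RepQstar f x K : Rep x K -> Rep (star (Q f) ** x) (fun s => (val (star f) s : R[i]) *: K s).
Proof.
apply: Rep_mull => {}x {}K T.
by apply: (Tens_ext (TensQ Hq (star f) T)) => //; exact: (Qstar Hq _ T).
Qed.

Lemma Rep_sum (I : Type) (r : seq I) (X : I -> A_infty A) (K : I -> G -> A) :
  (forall i, Rep (X i) (K i)) -> Rep (\sum_(i <- r) X i) (fun s => \sum_(i <- r) K i s).
Proof.
move=> H; elim: r => [|i r IH].
  rewrite big_nil; apply: (@Rep_ext 0 (fun=> 0)); first by move=> s; rewrite big_nil.
  by apply: Rep_Tens; exact: Tens0.
by rewrite big_cons; apply: (Rep_ext _ (RepD (H i) IH)) => s; rewrite big_cons.
Qed.

Lemma Rep_act g x K : Rep x K -> Rep (act_infty alpha g x) (fun s => alpha g (K (g^-1 * s)%g)).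
Proof.
move=> Hx e /Hx[x' [K' [Tx KK xx]]].
exists (act_infty alpha g x'), (fun s => alpha g (K' (g^-1 * s)%g)); split.
- exact: (Tens_act iD Hq).
- by move=> s; rewrite -actB rnorm_act.
- by rewrite -act_inftyN -act_inftyD (le_trans (snorm_act _ _ _)).
Qed.

(** Identities between functions on [G] become identities in the sequence algebra; every algebraic
    relation is transported in this way. *)
Lemma Rep_uniq x y K : Rep x K -> Rep y K -> x = y.
Proof.
move=> Hx Hy; apply/eqP; rewrite -subr_eq0; apply/eqP/snorm_eq0.
by apply: (Rep_norm (RepB Hx Hy)) => s; rewrite subrr rnorm0.
Qed.

Lemma Tens_approx (K : G -> A) (e : R) : continuous K -> (forall s, sset D (K s)) -> 0 < e ->
  exists y L, Tens y L /\ forall s, rnorm (K s - L s) <= e.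
Proof.
move=> cK DK e0; have e2 : 0 < e / 2 by rewrite divr_gt0.
have [||ps [ru [cu u01 urho cov]]] := @bump_cover R G (fun p s => rnorm (K s - K p)) (e / 2) cptG _ _ e2.
- by move=> p; exact: rnorm_continuous_dist.
- by move=> p; rewrite subrr rnorm0.
have [u uE] := choice (fun p => real_CG (cu p)).
have [y Ty] : exists y, Tens y (nest ru K ps).
  elim: {cov} ps => [|p ps [y Ty]]; first by exists 0; exact: Tens0.
  exists (Q (u p) ** c_ (K p) + Q (CG_compl (u p)) ** y).
  apply: (Tens_ext (TensD (Tens1 q (u p) (DK p)) (TensQ Hq (CG_compl (u p)) Ty))) => // s.
  by rewrite (CG_complE uE) uE.
exists y, (nest ru K ps); split=> // s; apply: nest_close => // p /urho/ltW.
by rewrite mulrC divfK.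
Qed.

Lemma Tens_lift y L : Tens y L -> exists2 v : linf A, Defs.eta v = y & equicont alpha v.
Proof.
elim=> [|f d {}y {}L Dd _ [v vy ev]].
  exists 0; first by rewrite /Defs.eta /quot_pi raddf0.
  by apply: equicont_fixed => n g; exact: act0.
exists (q f ** mk_subalg (const_bounded d) + v); first by rewrite -etaD -etaM vy.
apply: equicontD => //; apply: equicontM; first exact: (q_equicont Hq).
exact: equicont_const.
Qed.

(** The function [s |-> alpha s d] is invariant under [K |-> alpha g (K (g^-1 s))], so the lift of a
    nearby tensor is asymptotically almost fixed, uniformly in [g]. Entrywise averaging makes it
    exactly fixed at small cost, and a diagonal sequence removes the remaining error. *)
Lemma psi_exists d : sset D d -> exists u : linf A,
  (forall n g, alpha g (val u n) = val u n) /\ Rep (Defs.eta u) (fun s => alpha s d).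
Proof.
move=> Dd; pose K s := alpha s d.
have cK : continuous K by exact: act_continuous.
have h0 k : 0 < (1 / 2) ^+ k :> R by rewrite exprn_gt0 // divr_gt0.
have ex k : exists p : A_infty A * (G -> A), Tens p.1 p.2 /\ forall s, rnorm (K s - p.2 s) <= (1 / 2) ^+ k.
  have [y [L H]] := Tens_approx cK (fun s => iD s Dd) (h0 k).
  by exists (y, L).
have [p Hp] := choice ex.
have exw k : exists w : linf A, (forall n g, alpha g (val w n) = val w n) /\
    snorm (Defs.eta w - (p k).1) <= 2 * (1 / 2) ^+ k.
  have [T KL] := Hp k; have [v vy ev] := Tens_lift T.
  have [M M0 HM] := linf_bounded v.
  have [w wE] : exists w : linf A, val w = fun n => fixE alpha (val v n).
    apply: (@linf_of_bounded _ _ _ M) => n; rewrite -[fixE _ _]subr0; apply: fixE_dist => //.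
      by move=> g; rewrite act0.
    by rewrite subr0.
  exists w; split; first by move=> n g; rewrite wE fixE_fixed.
  rewrite -vy etaB; apply: nearle_snorm; first by rewrite mulr_ge0 // ltW.
  move=> e e0; have := @equicont_uniform _ _ _ alpha cptG v (2 * (1 / 2) ^+ k) ev.
  have H g : snorm (act_infty alpha g (Defs.eta v) - Defs.eta v) <= 2 * (1 / 2) ^+ k.
    rewrite vy; apply: (Tens_norm Hq cptG (TensB Hq (Tens_act iD Hq g T) T)) => s.
    have -> : alpha g ((p k).2 (g^-1 * s)%g) - (p k).2 s =
        - alpha g (K (g^-1 * s)%g - (p k).2 (g^-1 * s)%g) + (K s - (p k).2 s).
      rewrite actB -[alpha g (K _)]actM mulVKg; abel.
    by rewrite (le_trans (rnormD _ _)) // rnormN rnorm_act mulr_natl mulr2n lerD.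
  move=> /(_ H e e0); apply: filterS => n Hn.
  by rewrite linfB wE; exact: fixE_close.
have [w Hw] := choice exw.
(* In units of [2^-k], the three distances below are at most 1, 3/2 and 2, which is less than 5. *)
have [||u [uw Hu]] := @linf_diagonal _ _ w 5; first by [].
  move=> k; have [_ H1] := Hw k.+1; have [_ H2] := Hw k.
  have [T1 KL1] := Hp k.+1; have [T2 KL2] := Hp k.
  have H3 : snorm ((p k.+1).1 - (p k).1) <= (1 / 2) ^+ k.+1 + (1 / 2) ^+ k.
    apply: (Tens_norm Hq cptG (TensB Hq T1 T2)) => s.
    by rewrite (le_trans (rnorm_tri (K s) _ _)) // lerD // rnormC.
  have -> : Defs.eta (w k.+1) - Defs.eta (w k) = (Defs.eta (w k.+1) - (p k.+1).1) +
      ((p k.+1).1 - (p k).1) - (Defs.eta (w k) - (p k).1) by abel.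
  rewrite (le_lt_trans (snormB _ _)) // (le_lt_trans (lerD (snormD _ _) (lexx _))) //.
  have := h0 k; move: H1 H2 H3; rewrite exprS; move: ((1 / 2) ^+ k) => t.
  move: (snorm _) (snorm _) (snorm _) => X Y Z; lra.
exists u; split.
  by move=> n g; have [k ->] := uw n; case: (Hw k) => -> .
move=> e e0.
(* The distance from [u] to [w k] is at most [5 * 2] times [2^-k], and that from [w k] to the tensor
   at most [2] times [2^-k]. *)
have : (fun k => 12 * (1 / 2) ^+ k) @ \oo --> (0 : R).
  rewrite -(mulr0 (12 : R)); apply: cvgMl_tmp; apply: cvg_expr.
  by rewrite ger0_norm ?divr_ge0 //; lra.
move=> /cvgrPdist_lt/(_ _ e0)[k _ Hk].
have := Hk k (leqnn k); rewrite sub0r normrN => /(le_lt_trans (ler_norm _)) {}Hk.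
have [T KL] := Hp k; have [_ H2] := Hw k.
exists (p k).1, (p k).2; split=> //.
  by move=> s; rewrite (le_trans (KL s)) //; have := h0 k; lra.
rewrite (le_trans (snorm_tri (Defs.eta (w k)) _ _)) //.
have := Hu k; move: H2 Hk (h0 k); move: ((1 / 2) ^+ k) (snorm _) (snorm _) => t X Y; lra.
Qed.
End Representation.

(** Everything needed for a countable family [c] at once. [psi] takes the value 0 outside [D], so
    that its entries are fixed without a side condition. *)
Lemma rokhlin_data (R : realType) (G : topologicalGroupType) (A : cstarAlgType R)
    (alpha : cstarAction G A) (c : nat -> A) :
  sigma_unital A -> compact [set: G] -> second_countable (T := G) -> rokhlin_property alpha ->
  exists (D : starSubalg A) (q : CG R G -> linf A) (psi : A -> linf A),
    [/\ forall n, sset D (c n), forall g d, sset D d -> sset D (alpha g d), rokhlin_lift alpha D q,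
        forall d n g, alpha g (val (psi d) n) = val (psi d) n &
        forall d, sset D d -> Rep D q (Defs.eta (psi d)) (fun s => alpha s d)].
Proof.
move=> sA cptG scG rA.
have [D [cD sD iD Dc]] := separable_invariant_hull alpha c scG.
have [q Hq] := rokhlin_lift_exists cptG sA rA cD sD iD.
have ex d : exists u : linf A, (forall n g, alpha g (val u n) = val u n) /\
    (sset D d -> Rep D q (Defs.eta u) (fun s => alpha s d)).
  have [Dd|nD] := pselect (sset D d); last first.
    by exists 0; split=> // n g; exact: act0.
  by have [u [fu Hu]] := psi_exists cptG iD Hq Dd; exists u.
have [psi Hpsi] := choice ex.
exists D, q, psi; split=> //; first by move=> d n g; case: (Hpsi d) => ->.
by move=> d; case: (Hpsi d).
Qed.

(** [alpha g c] is again a quasi-inverse of [b], and quasi-inverses are unique. *)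
Lemma qinv_fixed (R : realType) (G : topologicalGroupType) (A : cstarAlgType R)
    (alpha : cstarAction G A) (b c : A) : qinv b c -> (forall g, alpha g b = b) ->
  forall g, alpha g c = c.
Proof.
move=> [H1 H2] fb g; apply: (@qinv_uniq _ _ b) => //.
by rewrite -{1 2}(fb g) -actMul -!actD H2 act0.
Qed.

Theorem fixed_qdense (R : realType) (sa : bool) (G : topologicalGroupType) (A : cstarAlgType R)
    (alpha : cstarAction G A) :
  sigma_unital A -> compact [set: G] -> second_countable (T := G) -> rokhlin_property alpha ->
  qdense sa A -> qdense sa (subalg_type (fixed_algebra alpha)).
Proof.
move=> sA cptG scG rA Q a e ssa e0.
have fa g : alpha g (val a) = val a by exact: (subalg_valP a).
have [|b [c [sb qbc ab]]] := Q (val a) e _ e0.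
  by move=> /ssa sta; rewrite -[in RHS]sta.
have [D [q [psi [Dc iD Hq fpsi Hpsi]]]] :=
  rokhlin_data (fun n => nth 0 [:: val a; b; c] n) sA cptG scG rA.
have Da : sset D (val a) := Dc 0%N.
have Db : sset D b := Dc 1%N.
have Dc' : sset D c := Dc 2%N.
have Rb := Hpsi _ Db; have Rc := Hpsi _ Dc'.
have Ra : Rep D q (const_seq (val a)) (fun=> val a) by exact/Rep_Tens/(Tens_const Hq).
pose h : R[i] := (1 / 2)%:C.
(* The entries of [psi b] are only asymptotically self-adjoint. Symmetrizing makes them exactly so
   without changing the class, because [psi b] and its adjoint represent the same function. *)
pose u : linf A := if sa then h *: (psi b + star (psi b)) else psi b.
have uE : Defs.eta u = Defs.eta (psi b).
  rewrite /u; case: ifP => // sat; rewrite -etaZ -etaD -etaS.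
  have -> : star (Defs.eta (psi b)) = Defs.eta (psi b).
    have RS : Rep D q (star (Defs.eta (psi b))) (fun s => alpha s b).
      by apply: (Rep_ext _ (Rep_star Hq Rb)) => s; rewrite -actStar sb.
    exact: (Rep_uniq cptG Hq RS Rb).
  exact: scale_half.
have fu n g : alpha g (val u n) = val u n.
  by rewrite /u; case: ifP => // _; rewrite linfZ linfD linfS actZ actD actStar !fpsi.
have su : sa -> forall n, star (val u n) = val u n.
  move=> sat n; rewrite /u sat linfZ linfD linfS starZ starD starK addrC; congr (_ *: _).
  exact: conjc_real.
have E1 : Defs.eta (u + psi c + u ** psi c) = 0.
  rewrite -!etaD -etaM uE; apply: (Rep_uniq cptG Hq (K := fun=> 0)); last exact/Rep_Tens/Tens0.
  apply: (Rep_ext _ (RepD (RepD Rb Rc) (RepM cptG Hq Rb Rc))) => s.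
  by rewrite -actMul -!actD qbc.1 act0.
have E2 : Defs.eta (u + psi c + psi c ** u) = 0.
  rewrite -!etaD -etaM uE; apply: (Rep_uniq cptG Hq (K := fun=> 0)); last exact/Rep_Tens/Tens0.
  apply: (Rep_ext _ (RepD (RepD Rb Rc) (RepM cptG Hq Rc Rb))) => s.
  by rewrite -actMul -!actD qbc.2 act0.
have E3 : snorm (Defs.eta u - const_seq (val a)) <= rnorm (val a - b).
  rewrite uE; apply: (Rep_norm cptG Hq (RepB Hq Rb Ra)) => s.
  have -> : alpha s b - val a = alpha s (b - val a) by rewrite actB fa.
  by rewrite rnorm_act rnormC.
have /eta_eq0P/rnorm_cvgP/(_ _ ltr01) N1 := E1.
have /eta_eq0P/rnorm_cvgP/(_ _ ltr01) N2 := E2.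
rewrite /const_seq etaB in E3.
have d0 : 0 < (e - rnorm (val a - b)) / 2 by rewrite divr_gt0 // subr_gt0.
have N3 := snorm_le_nearle E3 d0.
near \oo => n.
have H1 : rnorm (val u n + val (psi c) n + val u n ** val (psi c) n) < 1.
  by rewrite -[X in rnorm X]subr0; near: n; exact: N1.
have H2 : rnorm (val u n + val (psi c) n + val (psi c) n ** val u n) < 1.
  by rewrite -[X in rnorm X]subr0; near: n; exact: N2.
have H3 : rnorm (val u n - val a) <= rnorm (val a - b) + (e - rnorm (val a - b)) / 2.
  by near: n; exact: N3.
have [c' qc'] := approx_qinv H1 H2.
have fc' := qinv_fixed qc' (fu n).
have Su : sset (fixed_algebra alpha) (val u n) by exact: fu.
have Sc : sset (fixed_algebra alpha) c' by exact: fc'.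
exists (mk_subalg Su), (mk_subalg Sc); split.
- by move=> sat; apply: val_inj; exact: su.
- by split; apply: val_inj; [exact: qc'.1|exact: qc'.2].
- rewrite -[rnorm _]/(rnorm (val a - val u n)) rnormC; apply: le_lt_trans H3 _; lra.
Unshelve. all: by end_near. Qed.

(** * The Hahn-Banach theorem and the weak integral *)

Section HahnBanach.
Variables (R : realType) (V : normedModType R[i]) (a : V).
Implicit Types (f : set (V * R)) (x y : V) (r s k : R).

Let rs k x : V := k%:C *: x.

(* [f] is the graph of a real-linear functional defined on a real subspace and
   dominated by the norm. *)
Definition hb_graph f : Prop :=
  [/\ forall x r s, f (x, r) -> f (x, s) -> r = s,
      forall x y r s k, f (x, r) -> f (y, s) -> f (rs k x + y, k * r + s) &
      forall x r, f (x, r) -> r <= rnorm x].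

Definition hb_base : set (V * R) := [set p | exists k, p = (rs k a, k * rnorm a)].

Lemma hb_base_graph : hb_graph hb_base.
Proof.
have rsB k l : rs k a = rs l a -> k * rnorm a = l * rnorm a.
  move=> /eqP; rewrite -subr_eq0 /rs -scalerBl -rmorphB => /eqP E.
  have : rnorm ((k - l)%:C *: a) = 0 by rewrite E rnorm0.
  rewrite rnormZr => /eqP; rewrite mulf_eq0 normr_eq0 subr_eq0 => /orP[/eqP->//|/eqP->].
  by rewrite !mulr0.
split.
- by move=> x r s [k [-> ->]] [l [E ->]]; exact: rsB.
- move=> x y r s k [l [-> ->]] [m [-> ->]]; exists (k * l + m).
  by rewrite /rs scalerA -rmorphM -scalerDl -rmorphD mulrA -mulrDl.
- by move=> x r [k [-> ->]]; rewrite /rs rnormZr ler_wpM2r ?rnorm_ge0 // ler_norm.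
Qed.

(** The value [c] at the new vector must satisfy [s - |y - x| <= c <= |z + x| - t] for all [(y, s)]
    and [(z, t)] in the graph. The triangle inequality leaves room, and the supremum of the left
    sides is chosen. *)
Lemma hb_extend f x : hb_graph f -> f !=set0 -> ~ (exists r, f (x, r)) ->
  exists g, [/\ hb_graph g, f `<=` g & exists r, g (x, r)].
Proof.
move=> [fu fl fb] [[y0 r0] f0] nx.
have f00 : f (0, 0).
  by have := fl _ _ _ _ (-1) f0 f0; rewrite /rs rmorphN1 scaleN1r mulN1r !addNr.
have fB y z r s : f (y, r) -> f (z, s) -> f (z - y, s - r).
  by move=> fy fz; have := fl _ _ _ _ (-1) fy fz; rewrite /rs rmorphN1 scaleN1r mulN1r ![- _ + _]addrC.
have fD y z r s : f (y, r) -> f (z, s) -> f (y + z, r + s).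
  by move=> fy fz; have := fl _ _ _ _ 1 fy fz; rewrite /rs rmorph1 scale1r mul1r.
have fZ k y r : f (y, r) -> f (rs k y, k * r).
  by move=> fy; have := fl _ _ _ _ k fy f00; rewrite !addr0.
pose S := [set t | exists y s, f (y, s) /\ t = s - rnorm (y - x)].
have Sub z t : f (z, t) -> ubound S (rnorm (z + x) - t).
  move=> fz _ [y [s [fy ->]]]; have := fb _ _ (fD _ _ _ _ fy fz).
  have -> : y + z = (y - x) + (z + x) by abel.
  by have := rnormD (y - x) (z + x); lra.
have S0 : S !=set0 by exists (0 - rnorm (0 - x)), 0, 0.
pose c := sup S.
have c1 y s : f (y, s) -> s - rnorm (y - x) <= c.
  move=> fy; apply: ub_le_sup; last by exists y, s.
  by exists (rnorm (0 + x) - 0); exact: Sub.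
have c2 z t : f (z, t) -> c <= rnorm (z + x) - t.
  by move=> fz; apply: ge_sup => //; exact: Sub.
exists [set p | exists y s k, f (y, s) /\ p = (y + rs k x, s + k * c)]; split.
- split.
  + move=> w r r' [y [s [k [fy [-> ->]]]]] [y' [s' [k' [fy' [E ->]]]]].
    have [kk|kk] := eqVneq k k'.
      move: E; rewrite kk => /addIr yy; congr (_ + _).
      by apply: (fu y) => //; rewrite yy.
    case: nx; exists ((k - k')^-1 * (s' - s)).
    have -> : x = rs (k - k')^-1 (y' - y).
      have -> : y' - y = rs (k - k') x.
        rewrite /rs rmorphB scalerBl; apply/eqP; rewrite subr_eq addrAC eq_sym subr_eq addrC.
        by apply/eqP.
      by rewrite /rs scalerA -rmorphM mulVf ?subr_eq0 // scale1r.
    by apply: fZ; exact: fB.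
  + move=> w w' r r' l [y [s [k [fy [-> ->]]]]] [y' [s' [k' [fy' [-> ->]]]]].
    exists (rs l y + y'), (l * s + s'), (l * k + k'); split; first exact: fl.
    congr pair; last by ring.
    by rewrite /rs rmorphD rmorphM scalerDl scalerDr scalerA; abel.
  + move=> w r [y [s [k [fy [-> ->]]]]].
    have [k0|k0|k0] := ltrgt0P k.
    * have H := c2 _ _ (fZ k^-1 _ _ fy).
      have -> : y + rs k x = rs k (rs k^-1 y + x).
        by rewrite /rs scalerDr scalerA -rmorphM divff ?gt_eqF // scale1r.
      rewrite /rs rnormZr gtr0_norm //.
      have : k * c <= k * (rnorm (rs k^-1 y + x) - k^-1 * s) by rewrite ler_pM2l.
      by rewrite mulrBr mulrA divff ?gt_eqF // mul1r; rewrite /rs; lra.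
    * have H := c1 _ _ (fZ (- k)^-1 _ _ fy).
      have kn : 0 < - k by rewrite oppr_gt0.
      have -> : y + rs k x = rs (- k) (rs (- k)^-1 y - x).
        rewrite /rs scalerBr scalerA -rmorphM divff ?gt_eqF // scale1r.
        by rewrite rmorphN scaleNr opprK.
      rewrite /rs rnormZr gtr0_norm //.
      have : (- k) * ((- k)^-1 * s - rnorm (rs (- k)^-1 y - x)) <= (- k) * c by rewrite ler_pM2l.
      by rewrite mulrBr mulrA divff ?gt_eqF // mul1r; rewrite /rs; lra.
    * by rewrite k0 /rs scale0r mul0r !addr0; exact: fb.
- move=> [y s] fy; exists y, s, 0; split=> //.
  by rewrite /rs scale0r mul0r !addr0.
- by exists c, 0, 0, 1; split=> //; rewrite /rs scale1r mul1r !add0r.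
Qed.

Lemma hahn_banach_real : exists u : V -> R,
  [/\ forall x y k, u (rs k x + y) = k * u x + u y, forall x, u x <= rnorm x & u a = rnorm a].
Proof.
pose P f := (f = set0 \/ hb_base `<=` f) /\ hb_graph f.
have [F FP totF|f [[f0b gf] fmax]] := @Zorn_bigcup _ P.
  split.
    have [[X [FX bX]]|H] := pselect (exists X, F X /\ hb_base `<=` X).
      by right=> p /bX; exists X.
    left; apply/seteqP; split=> // p [X FX Xp].
    have [[XE|bX] _] := FP _ FX; first by move: Xp; rewrite XE.
    by case: H; exists X.
  have two X Y : F X -> F Y -> exists Z, [/\ F Z, X `<=` Z & Y `<=` Z].
    by move=> FX FY; have [XY|YX] := totF _ _ FX FY; [exists Y|exists X]; split.
  split.
  - move=> x r s [X FX Xr] [Y FY Ys]; have [Z [FZ XZ YZ]] := two _ _ FX FY.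
    have [_ [H _ _]] := FP _ FZ; apply: (H x); [exact: XZ|exact: YZ].
  - move=> x y r s k [X FX Xr] [Y FY Ys]; have [Z [FZ XZ YZ]] := two _ _ FX FY.
    have [_ [_ H _]] := FP _ FZ; exists Z => //; apply: H; [exact: XZ|exact: YZ].
  - by move=> x r [X FX Xr]; have [_ [_ _ H]] := FP _ FX; exact: H Xr.
have base0 : hb_base (a, rnorm a) by exists 1; rewrite /rs scale1r mul1r.
have fbase : hb_base `<=` f.
  case: f0b => // f0; case: (fmax hb_base).
    split; first by rewrite f0.
    by rewrite f0 => /(_ _ base0).
  by split; [right|exact: hb_base_graph].
have tot x : exists r, f (x, r).
  apply: contrapT => nx; have [|g [gg fg [r gr]]] := hb_extend gf _ nx.
    by exists (a, rnorm a); exact: fbase.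
  apply: (fmax g); last by split=> //; right=> p /fbase /fg.
  by split=> // gf'; apply: nx; exists r; exact: gf'.
have [u Hu] := choice tot; have [fu fl fb] := gf.
exists u; split.
- by move=> x y k; apply: (fu (rs k x + y)) => //; exact: fl.
- by move=> x; exact: fb.
- by apply: (fu a) => //; exact: fbase.
Qed.

Lemma separating_functional : a != 0 ->
  exists phi : V -> R[i]^o, [/\ linear phi, continuous phi & phi a != 0].
Proof.
move=> a0; have [u [ul ub ua]] := hahn_banach_real.
have u0 : u 0 = 0.
  by have := ul 0 0 (-1); rewrite /rs rmorphN1 scaleN1r addNr mulN1r addNr.
have uD x y : u (x + y) = u x + u y by have := ul x y 1; rewrite /rs scale1r mul1r.
have uZ k x : u (k%:C *: x) = k * u x by have := ul x 0 k; rewrite !addr0 u0 addr0.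
pose j : R[i] := 0 +i* 1.
(* The usual complexification [u(x) - i u(i x)] of a real functional. *)
pose phi x : R[i]^o := u x -i* u (j *: x).
have lphi : linear phi.
  move=> [k l] x y; rewrite /phi.
  have E1 : (k +i* l) *: x = k%:C *: x + l%:C *: (j *: x).
    rewrite scalerA -scalerDl; congr (_ *: _).
    by apply/eqP; rewrite eq_complex /=; apply/andP; split; apply/eqP; ring.
  have E2 : j *: ((k +i* l) *: x + y) = k%:C *: (j *: x) + (- l)%:C *: x + j *: y.
    rewrite scalerDr !scalerA -scalerDl; congr (_ *: _ + _).
    by apply/eqP; rewrite eq_complex /=; apply/andP; split; apply/eqP; ring.
  rewrite E2 E1 !uD !uZ.
  by apply/eqP; rewrite eq_complex /=; apply/andP; split; apply/eqP; ring.
have bphi x : rnorm (phi x) <= 2 * rnorm x.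
  have un y : `|u y| <= rnorm y.
    rewrite ler_norml ub andbT lerNl -rnormN; apply: le_trans (ub _).
    by have := uD y (- y); rewrite subrr u0 => /eqP; rewrite eq_sym addr_eq0 => /eqP ->; rewrite opprK.
  have jn : rnorm (j *: x) = rnorm x.
    rewrite rnormZ; have -> : rnorm (j : R[i]^o) = 1; last by rewrite mul1r.
    by rewrite /rnorm normc_def /= expr0n /= add0r expr1n sqrtr1.
  rewrite (le_trans (rnorm_complex_le _ _)) // normrN mulr_natl mulr2n lerD //.
  by rewrite -jn.
exists phi; split=> //.
- move=> x; apply/rnorm_cvgP => e e0; apply/rnorm_nbhsP; exists (e / 2); first by rewrite divr_gt0.
  move=> y yx; have -> : phi y - phi x = phi (y - x).
    by have := lphi (-1) x y; rewrite !scaleN1r [X in phi X]addrC [RHS]addrC => ->.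
  by apply: le_lt_trans (bphi _) _; rewrite mulrC -ltr_pdivlMr.
- apply: contra_neq a0 => /eqP; rewrite eq_complex /= ua => /andP[/eqP a0 _].
  by apply: rnorm_eq0; rewrite a0.
Qed.
End HahnBanach.

(** * Haar measure and means *)

Section Integrals.
Variables (R : realType) (G : topologicalGroupType).
Variable mu : probability (g_sigma_algebraType (@open G)) R.
Hypotheses (cptG : compact [set: G]) (linv : left_invariant mu).
Local Notation int r := (Rintegral mu setT r).
Local Notation GT := (g_sigma_algebraType (@open G)).

Lemma open_measurable_group (U : set G) : open U -> measurable (U : set GT).
Proof. by move=> oU; exact: sub_sigma_algebra. Qed.

Lemma continuous_integrable (r : G -> R) : continuous r -> mu.-integrable setT (EFin \o r).
Proof.
move=> cr; have /= mr : measurable_fun (setT : set GT) (r : GT -> R).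
  refine (@measurability _ _ GT R setT r _ (measurable_realfun.RGenOpens.measurableE R) _).
  move=> _ [_ [a [b ->]] <-].
  rewrite setTI; apply: open_measurable_group; move/continuousP: cr; apply.
  exact: interval_open.
have [M HM] : exists M, forall t, rnorm ((r t)%:C : R[i]^o) <= M.
  by apply: cpt_rnorm_bounded => //; exact: real_continuousC.
apply: measurable_bounded_integrable => //.
  by rewrite [X in (X < _)%E](probability_setT mu : _ = 1%E) ltry.
exists M; split; first exact: num_real.
by move=> N MN x _ /=; have := HM x; rewrite rnorm_real => /le_trans; apply; exact: ltW.
Qed.

Lemma translate_continuous (T : topologicalType) (r : G -> T) s :
  continuous r -> continuous (fun t => r (s * t)%g).
Proof.
move=> cr t; have h : (fun x => s * x)%g @ nbhs t --> (s * t)%g.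
  by apply: cvg_mulg; [exact: cvg_cst|exact: cvg_id].
exact: (cvg_comp _ _ h (cr _)).
Qed.

Lemma int_translate (r : G -> R) s : continuous r -> int (fun t => r (s * t)%g) = int r.
Proof.
move=> cr; pose phi : GT -> GT := fun t => (s * t)%g.
have mphi : measurable_fun setT phi.
  have E : @measurable _ GT = <<s @open G >> by [].
  refine (@measurability _ _ GT GT setT phi _ E _) => _ [U oU <-].
  rewrite setTI; apply: open_measurable_group; have /continuousP := @translate_continuous G id s (fun x => @cvg_id _ (nbhs x)); exact.
have ir := continuous_integrable cr.
have ir' := continuous_integrable (@translate_continuous _ r s cr).
rewrite /Rintegral; congr fine.
have := @integral_pushforward _ _ GT GT R phi mphi mu setT (EFin \o r).
rewrite preimage_setT => <- //.
  by apply: eq_measure_integral => B mB _; rewrite -[RHS](linv s mB).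
exact/measurable_int/ir.
Qed.

(** By invariance the integral does not change when [r] is replaced by its average over translates,
    which lies uniformly within [e] of [c]. *)
Lemma int_lavg (r : G -> R) (s : seq G) (c e : R) : continuous r -> (0 < size s)%N ->
  (forall t, `|(size s)%:R^-1 * \sum_(g <- s) r (g * t)%g - c| <= e) -> `|int r - c| <= e.
Proof.
move=> cr s0 H.
have [cS IS] : continuous (fun t => \sum_(g <- s) r (g * t)%g) /\
    int (fun t => \sum_(g <- s) r (g * t)%g) = (size s)%:R * int r.
  elim: s {s0 H} => [|g s [c1 I1]].
    under eq_fun do rewrite big_nil; split; first by move=> t; exact: cvg_cst.
    by rewrite Rintegral_cst // !mul0r.
  have cg := @translate_continuous _ r g cr.
  under eq_fun do rewrite big_cons; split; first by move=> t; apply: cvgD; [exact: cg|exact: c1].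
  rewrite RintegralD //; [|exact: continuous_integrable|exact: continuous_integrable].
  by rewrite I1 int_translate // -[(size (g :: s))]/(size s).+1 -natr1; ring.
pose X t := (size s)%:R^-1 * \sum_(g <- s) r (g * t)%g.
have cX : continuous X by move=> t; apply: cvgMl_tmp; exact: cS.
have IX : int X = int r.
  rewrite /X RintegralZl //; last exact: continuous_integrable.
  by rewrite IS mulrA mulVf ?mul1r // pnatr_eq0 -lt0n.
have Ic k : int (fun=> k) = k by rewrite Rintegral_cst // [X in _ * fine X](probability_setT mu : _ = 1%E) mulr1.
have cc k : mu.-integrable setT (EFin \o (fun _ : GT => k)).
  by apply: (@continuous_integrable (fun=> k)) => t; exact: cvg_cst.
have iX := continuous_integrable cX.
have H1 : c - e <= int X.
  rewrite -[leLHS]Ic; apply: le_Rintegral => // t _.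
  by have := H t; rewrite ler_norml => /andP[]; rewrite -/(X t); lra.
have H2 : int X <= c + e.
  rewrite -[leRHS]Ic; apply: le_Rintegral => // t _.
  by have := H t; rewrite ler_norml => /andP[]; rewrite -/(X t); lra.
by rewrite -IX ler_norml; apply/andP; split; lra.
Qed.

Lemma rnorm_Re (z : R[i]) : `|complex.Re z| <= rnorm (z : R[i]^o).
Proof. by have := normc_ge_Re z; rewrite (rnormE (z : R[i]^o)) lecR. Qed.

Lemma rnorm_Im (z : R[i]) : `|complex.Im z| <= rnorm (z : R[i]^o).
Proof.
have -> : complex.Im z = complex.Re (- 'i%C * z) by case: z => a b /=; ring.
apply: le_trans (rnorm_Re _) _; rewrite -[_ * z]/((- 'i%C : R[i]) *: (z : R[i]^o)) rnormZ.
by rewrite /rnorm normc_def /= oppr0 expr0n /= add0r sqrrN expr1n sqrtr1 mul1r.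
Qed.

Lemma complex_integral_mean (h : G -> R[i]^o) c : continuous h -> lmean h c ->
  complex_integral mu h = c.
Proof.
move=> ch hc.
have part (P : R[i] -> R) : {morph P : a b / a + b} -> (forall (k : R) z, P (k%:C * z) = k * P z) ->
    (forall z, `|P z| <= rnorm (z : R[i]^o)) -> int (fun t => P (h t)) = P c.
  move=> PD PZ Pn; have P0 : P 0 = 0 by have := PZ 0 0; rewrite !mul0r.
  have PB a b : P a - P b = P (a - b).
    by rewrite PD; congr (_ + _); have := PZ (-1) b; rewrite rmorphN1 !mulN1r.
  have cP : continuous (fun t => P (h t)).
    move=> t; apply/cvgrPdist_lt => e e0; have /rnorm_cvgP/(_ _ e0) := ch t.
    by apply: filterS => x; apply: le_lt_trans; rewrite PB rnormC Pn.
  apply/eqP; rewrite -subr_eq0 -normr_le0; apply/ler_addgt0Pr => e e0; rewrite add0r.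
  have [s s0 Hs] := hc e e0; apply: (int_lavg cP s0) => t; apply: le_trans (Hs t).
  by rewrite -[\sum_(g <- s) _](big_morph P PD P0) -PZ PB Pn.
rewrite /complex_integral !part; first by case: c {hc part}.
- by move=> [a b] [a' b'].
- by move=> k [a b] /=; ring.
- exact: rnorm_Im.
- by move=> [a b] [a' b'].
- by move=> k [a b] /=; ring.
- exact: rnorm_Re.
Qed.

Lemma continuous_linear_bounded (V W : normedModType R[i]) (f : V -> W) : linear f -> continuous f ->
  exists2 C, 0 < C & forall x, rnorm (f x) <= C * rnorm x.
Proof.
move=> lf cf; have fZ k x : f (k *: x) = k *: f x.
  have f0 : f 0 = 0 by have := lf (-1) 0 0; rewrite !scaleN1r !addNr.
  by have := lf k x 0; rewrite f0 !addr0.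
have f0 : f 0 = 0 by have := fZ 0 0; rewrite !scale0r.
have /rnorm_cvgP/(_ 1 ltr01)/rnorm_nbhsP[d d0 Hd] := cf 0.
exists (2 / d); first by rewrite divr_gt0.
move=> x; have [x0|x0] := leP (rnorm x) 0.
  by rewrite (rnorm_eq0 x0) f0 !rnorm0 mulr0.
pose k := d / (2 * rnorm x).
have k0 : 0 < k by rewrite divr_gt0 // mulr_gt0.
have := Hd (k%:C *: x); rewrite f0 !subr0 fZ !rnormZr !gtr0_norm //.
have -> : k * rnorm x = d / 2 by rewrite /k; field; rewrite gt_eqF.
have dd : d / 2 < d by lra.
move=> /(_ dd) /ltW; rewrite -ler_pdivlMl // mulr1 => /le_trans; apply.
rewrite le_eqVlt; apply/orP; left; apply/eqP; rewrite /k; field.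
by rewrite !gt_eqF.
Qed.

(** The mean is a weak integral because functionals commute with finite averages. Functionals
    separate points, so whatever [xget] selects must be this mean. *)
Lemma vector_integral_mean (A : cstarAlgType R) (F : G -> A) c : continuous F -> lmean F c ->
  vector_integral mu F = c.
Proof.
move=> cF Fc; set P := [set a : A | forall phi : A -> R[i]^o, linear phi -> continuous phi ->
  phi a = complex_integral mu (fun t => phi (F t))].
have Pc : P c.
  move=> phi lphi cphi; have [C C0 HC] := continuous_linear_bounded lphi cphi.
  rewrite (@complex_integral_mean (fun t => phi (F t)) (phi c)) //.
    by move=> t; apply: (cvg_comp _ _ (cF t)); exact: cphi.
  exact: (lmean_linear lphi HC).
have PI : P (vector_integral mu F) by apply: (@xgetPex _ 0 P); exists c.
apply/eqP; rewrite -subr_eq0; apply/negPn/negP => ne.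
have [phi [lphi cphi /negP[]]] := separating_functional ne.
have := lphi (-1) c (vector_integral mu F); rewrite !scaleN1r [X in phi X]addrC => ->.
by rewrite (PI _ lphi cphi) (Pc _ lphi cphi) addNr.
Qed.
End Integrals.

(** * Rank-one operators in the crossed product *)

Section RankOne.
Variables (R : realType) (G : topologicalGroupType) (A B : cstarAlgType R).
Variable mu : probability (g_sigma_algebraType (@open G)) R.
Variables (alpha : cstarAction G A) (iota : (G -> A) -> B).
Hypotheses (cptG : compact [set: G]) (linv : left_invariant mu).
Hypothesis rep : convolution_rep mu alpha iota.
Implicit Types (f h : G -> A) (x y z w : A).

Lemma rep_iotaD f h : continuous f -> continuous h -> iota (f + h) = iota f + iota h.
Proof. by move=> cf ch; have [/(_ 1)] := rep cf ch; rewrite !scale1r. Qed.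

Lemma iota0 : iota 0 = 0.
Proof.
have c0 : continuous (0 : G -> A) by move=> t; exact: cvg_cst.
by apply: (addrI (iota 0)); rewrite -rep_iotaD // !addr0.
Qed.

Lemma iotaZ c f : continuous f -> iota (c *: f) = c *: iota f.
Proof.
move=> cf; have c0 : continuous (0 : G -> A) by move=> t; exact: cvg_cst.
by have [/(_ c)] := rep cf c0; rewrite iota0 !addr0.
Qed.

Lemma iota_continuousN f : continuous f -> continuous (- f).
Proof. by move=> cf t; apply: cvgN; exact: cf. Qed.

Lemma iotaB f h : continuous f -> continuous h -> iota (f - h) = iota f - iota h.
Proof.
move=> cf ch; rewrite rep_iotaD //; last exact: iota_continuousN.
by rewrite -scaleN1r iotaZ // scaleN1r.
Qed.

Lemma iota_star f : continuous f -> star (iota f) = iota (involution alpha f).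
Proof. by move=> cf; have [] := rep cf cf. Qed.

Lemma iota_norm f (M : R) : continuous f -> (forall t, rnorm (f t) <= M) -> rnorm (iota f) <= M.
Proof.
move=> cf fM; have [_ _ _ H] := rep cf cf; apply: (le_trans H).
have c1 : continuous (fun t => rnorm (f t)).
  by have := @rnorm_continuous_dist _ _ _ f 0 cf; under eq_fun do rewrite subr0.
have iM : mu.-integrable setT (EFin \o (fun=> M)).
  by apply: (@continuous_integrable _ _ mu cptG (fun=> M)) => t; exact: cvg_cst.
rewrite -[leRHS]mulr1 -[X in M * X]/(fine 1%E).
rewrite -[X in M * fine X](probability_setT mu : _ = 1%E) -Rintegral_cst //.
by apply: le_Rintegral => //; exact: continuous_integrable.
Qed.

(** The kernel of the rank-one operator [z |-> x <y, z>] for the inner product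
    [fixE alpha (star y ** z)] with values in the fixed point algebra. *)
Definition rankone x y : G -> A := fun g => x ** alpha g (star y).

Lemma rankone_continuous x y : continuous (rankone x y).
Proof. by move=> t; apply: cvg_amull; exact: act_continuous. Qed.

Definition rko x y : B := iota (rankone x y).

Lemma rko_norm x y : rnorm (rko x y) <= rnorm x * rnorm y.
Proof.
apply: iota_norm; first exact: rankone_continuous.
by move=> t; rewrite (le_trans (rnormM _ _)) // rnorm_act rnorm_star.
Qed.

Lemma rkoDl x x' y : rko (x + x') y = rko x y + rko x' y.
Proof.
rewrite /rko -rep_iotaD; try exact: rankone_continuous.
by congr iota; apply/funext => g; exact: amulDl.
Qed.

Lemma rko0l y : rko 0 y = 0.
Proof. by apply: (addrI (rko 0 y)); rewrite -rkoDl !addr0. Qed.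

Lemma rko_suml (I : Type) (s : seq I) (F : I -> A) y :
  rko (\sum_(i <- s) F i) y = \sum_(i <- s) rko (F i) y.
Proof. by apply: (big_morph (rko^~ y)) => [x x'|]; [exact: rkoDl|exact: rko0l]. Qed.

Lemma rko_star x y : star (rko x y) = rko y x.
Proof.
rewrite /rko iota_star; last exact: rankone_continuous.
congr iota; apply/funext => g; rewrite /involution /rankone starM actMul -actStar starK actKV.
by rewrite actStar.
Qed.

(** Rank-one operators are balanced over the fixed point algebra; this makes [rkmx] compatible with
    adjoints. *)
Lemma rko_fixed x y b : (forall g, alpha g b = b) -> rko x (y ** b) = rko (x ** star b) y.
Proof.
move=> fb; congr iota; apply/funext => g.
by rewrite /rankone starM actMul actStar fb amulA.
Qed.

(** In the convolution integrand [alpha t] and [t^-1] cancel in the last factor, so the integration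
    variable remains only in [alpha t (star y ** z)], whose integral is [fixE]. *)
Lemma rko_mul x y z w : rko x y ** rko z w = rko (x ** fixE alpha (star y ** z)) w.
Proof.
have [_ <- _ _] := rep (@rankone_continuous x y) (@rankone_continuous z w).
congr iota; apply/funext => s; rewrite /convolution /rankone.
have -> : (fun t => x ** alpha t (star y) ** alpha t (z ** alpha (t^-1 * s)%g (star w))) =
    (fun t => x ** alpha t (star y ** z) ** alpha s (star w)).
  apply/funext => t; rewrite !actMul -[alpha t (alpha _ _)]actM mulVKg //.
  by rewrite !amulA.
apply: vector_integral_mean => //.
  by move=> t; apply: cvg_amulr; apply: cvg_amull; exact: act_continuous.
apply: (@lmean_linear _ _ _ _ (fun u => x ** u ** alpha s (star w)) (rnorm x * rnorm w)).
- by move=> k u v; rewrite amulDr amulDl amulZr amulZl.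
- move=> u; rewrite (le_trans (rnormM _ _)) // rnorm_act rnorm_star mulrAC.
  by rewrite ler_wpM2r ?rnorm_ge0 // rnormM.
- exact: (fixE_mean alpha cptG _).1.
Qed.
End RankOne.

(** * Matrices *)

Section SchurComplement.
Variables (K : pzRingType) (st : K -> K) (I P : K -> Prop) (sa : bool).
Hypotheses (stD : {morph st : x y / x + y}) (stM : forall x y, st (x * y) = st y * st x)
  (st1 : st 1 = 1).
Hypotheses (IB : forall x y, I x -> I y -> I (x - y))
  (IMr : forall x y, I x -> I (x * y)).
Hypothesis invP : forall a, I a -> (sa -> st a = a) -> exists t v,
  [/\ P t, sa -> st t = t, (1 + a + t) * v = 1 & v * (1 + a + t) = 1].

(** The block inversion formula with pivot [n] and Schur complement [F - c v b], over a
    noncommutative ring. *)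
Lemma block_mx_inv (m : nat) (n v : 'M[K]_1) (b : 'rV[K]_m) (c : 'cV[K]_m) (F W : 'M[K]_m) :
  n *m v = 1%:M -> v *m n = 1%:M ->
  (F - c *m v *m b) *m W = 1%:M -> W *m (F - c *m v *m b) = 1%:M ->
  block_mx n b c F *m block_mx (v + v *m b *m W *m c *m v) (- (v *m b *m W)) (- (W *m c *m v)) W
    = 1%:M /\
  block_mx (v + v *m b *m W *m c *m v) (- (v *m b *m W)) (- (W *m c *m v)) W *m block_mx n b c F
    = 1%:M.
Proof.
move=> nv vn; rewrite mulmxBl mulmxBr => FW WF.
have {}FW : F *m W = 1%:M + c *m v *m b *m W by rewrite -FW subrK.
have {}WF : W *m F = 1%:M + W *m c *m v *m b by rewrite -WF !mulmxA subrK.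
rewrite !mulmx_block (scalar_mx_block 1 m 1); split; congr block_mx.
- by rewrite mulmxDr mulmxN !mulmxA nv !mul1mx addrK.
- by rewrite mulmxN !mulmxA nv mul1mx addNr.
- rewrite mulmxDr mulmxN !mulmxA FW !mulmxDl !mul1mx; abel.
- by rewrite mulmxN !mulmxA FW addrC addrK.
- by rewrite mulmxDl !mulNmx -!mulmxA vn !mulmx1 addrK.
- rewrite mulmxDl !mulNmx -(mulmxA _ W F) WF !mulmxDr mulmx1 !mulmxA; abel.
- by rewrite !mulNmx -!mulmxA vn mulmx1 addNr.
- by rewrite !mulNmx WF addrC addrK.
Qed.

(** Perturbing the corner entry makes the pivot invertible. The Schur complement again has entries
    in [I] and keeps the symmetry, so induction perturbs its diagonal; the off-diagonal entries
    never change. *)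
Lemma diagonal_perturbation (m : nat) (D : 'M[K]_m) :
  (forall i j, I (D i j)) -> (sa -> forall i j, st (D i j) = D j i) ->
  exists (t : 'rV[K]_m) (W : 'M[K]_m), [/\ forall i, P (t 0 i), sa -> forall i, st (t 0 i) = t 0 i,
    (1%:M + D + diag_mx t) *m W = 1%:M & W *m (1%:M + D + diag_mx t) = 1%:M].
Proof.
elim: m D => [|m IH] D ID sD.
  exists 0, 0; split=> [[]//|_ []//||]; by rewrite [LHS]flatmx0 [RHS]flatmx0.
rewrite -[m.+1]/(1 + m)%N in D ID sD *.
pose a := D (lshift m 0) (lshift m 0).
have [||t0 [v [Pt0 st0 nv vn]]] := invP (a := a); [exact: ID|by move=> sat; rewrite /a sD|].
have sv : sa -> st v = v.
  move=> sat; have sn : st (1 + a + t0) = 1 + a + t0 by rewrite !stD st1 st0 // /a sD.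
  have E : st v * (1 + a + t0) = 1 by rewrite -sn -stM nv st1.
  by rewrite -[LHS]mulr1 -nv mulrA E mul1r.
pose b : 'rV[K]_m := ursubmx D; pose c : 'cV[K]_m := dlsubmx D.
pose S := drsubmx D - c *m v%:M *m b.
have SE i j : S i j = D (rshift 1 i) (rshift 1 j) -
    D (rshift 1 i) (lshift m 0) * v * D (lshift m 0) (rshift 1 j).
  by rewrite !mxE big_ord1 !mxE big_ord1 !mxE eqxx mulr1n.
have [||t [W [Pt stt FW WF]]] := IH S.
- by move=> i j; rewrite SE; apply: IB => //; apply: IMr; exact: IMr.
- move=> sat i j; have st_N x : st (- x) = - st x.
    have s0 : st 0 = 0 by apply: (addrI (st 0)); rewrite -stD !addr0.
    by apply: (addrI (st x)); rewrite -stD !subrr.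
  by rewrite !SE stD st_N !stM sv // !sD // mulrA.
pose T : 'rV[K]_(1 + m) := row_mx t0%:M t.
have E : 1%:M + D + diag_mx T = block_mx (1 + a + t0)%:M b c (1%:M + drsubmx D + diag_mx t).
  rewrite -{1}[D]submxK (scalar_mx_block 1 m 1) diag_mx_row !add_block_mx; congr block_mx.
  - rewrite !raddfD /= [ulsubmx D]mx11_scalar !mxE; congr (_ + _ + _).
    by apply/matrixP => i j; rewrite !mxE !ord1 eqxx !mulr1n.
  - by rewrite add0r addr0.
  - by rewrite add0r addr0.
have SF : 1%:M + drsubmx D + diag_mx t - c *m v%:M *m b = 1%:M + S + diag_mx t.
  by rewrite /S; abel.
have nv' : (1 + a + t0)%:M *m v%:M = 1%:M :> 'M[K]_1 by rewrite -scalar_mxM nv.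
have vn' : v%:M *m (1 + a + t0)%:M = 1%:M :> 'M[K]_1 by rewrite -scalar_mxM vn.
rewrite -SF in FW WF; have [H1 H2] := block_mx_inv nv' vn' FW WF.
exists T; eexists; split; try by rewrite E; [exact: H1|exact: H2].
- move=> i; rewrite mxE; case: splitP => j _; last exact: Pt.
  by rewrite ord1 mxE eqxx mulr1n.
- move=> sat i; rewrite mxE; case: splitP => j _; last exact: stt.
  by rewrite ord1 mxE eqxx mulr1n st0.
- by rewrite E; exact: H1.
- by rewrite E; exact: H2.
Qed.
End SchurComplement.

(* The unitization again, this time as a ring, so that matrices over it make sense. *)
Definition unitz_ring (R : realType) (U : starAlgType R) : Type := unitization U.

Section UnitizationRing.
Variables (R : realType) (U : starAlgType R).
HB.instance Definition _ := GRing.Zmodule.on (unitz_ring U).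

Fact unitz_mul1 : left_id ((0, 1) : unitz_ring U) (@amul R (unitization U)).
Proof. by move=> x; case: (unitz_unit x). Qed.
Fact unitz_mulr1 : right_id ((0, 1) : unitz_ring U) (@amul R (unitization U)).
Proof. by move=> x; case: (unitz_unit x). Qed.

HB.instance Definition _ := GRing.Zmodule_isPzRing.Build (unitz_ring U)
  (@amulA R (unitization U)) unitz_mul1 unitz_mulr1
  (@amulDl R (unitization U)) (@amulDr R (unitization U)).

Lemma unitz_ring_mulE (x y : unitz_ring U) : x * y = (x : unitization U) ** (y : unitization U).
Proof. by []. Qed.
End UnitizationRing.

Lemma matrix_qdense (R : realType) (sa : bool) (A : normedStarAlgType R) (m : nat)
    (d : 'I_m -> 'I_m -> A) (e : R) :
  qdense sa A -> 0 < e -> (sa -> forall i j, star (d i j) = d j i) ->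
  exists d' c' : 'I_m -> 'I_m -> A, [/\ sa -> forall i j, star (d' i j) = d' j i,
    forall i j, rnorm (d' i j - d i j) <= e,
    forall i j, d' i j + c' i j + \sum_k d' i k ** c' k j = 0 &
    forall i j, d' i j + c' i j + \sum_k c' i k ** d' k j = 0].
Proof.
move=> Q e0 sd; pose K := unitz_ring A.
(* [I] is the copy of [A] in its unitization. Corrections are restricted to it, so that [1 + D'] has
   scalar part the identity matrix. *)
pose I (x : K) := x.2 = 0; pose P (x : K) := I x /\ rnorm x.1 <= e.
pose st (x : K) : K := star (x : unitization A).
have IB x y : I x -> I y -> I (x - y) by rewrite /I /= => -> ->; rewrite subrr.
have IMr x y : I x -> I (x * y) by rewrite /I unitz_ring_mulE unitz_mulE /= => ->; rewrite mul0r.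
have st1 : st 1 = 1 by apply: unitz_eqP; [exact: star0|exact: rmorph1].
have invP (a : K) : I a -> (sa -> st a = a) -> exists t v,
    [/\ P t, sa -> st t = t, (1 + a + t) * v = 1 & v * (1 + a + t) = 1].
  case: a => a k; rewrite /I /= => -> sta.
  have sa' : sa -> star a = a by move=> /sta [].
  have [b [c [sb [bc cb] ab]]] := Q a e sa' e0.
  exists (b - a, 0), (c, 1); split.
  - by split=> //=; rewrite rnormC ltW.
  - by move=> sat; apply: unitz_eqP; rewrite /= ?starD ?starN ?sb ?sa' ?rmorph0.
  - rewrite unitz_ring_mulE unitz_mulE; apply: unitz_eqP => /=; last by rewrite !addr0 mulr1.
    rewrite !addr0 !scale1r; have -> : 0 + a + (b - a) = b by abel.
    by have -> : b ** c + b + c = b + c + b ** c by abel.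
  - rewrite unitz_ring_mulE unitz_mulE; apply: unitz_eqP => /=; last by rewrite !addr0 mulr1.
    rewrite !addr0 !scale1r; have -> : 0 + a + (b - a) = b by abel.
    by have -> : c ** b + c + b = b + c + c ** b by abel.
pose D : 'M[K]_m := \matrix_(i, j) ((d i j, 0) : K).
have [||t [W [Pt stt DW WD]]] := @diagonal_perturbation K st I P sa (@starD R (unitization A))
  (@starM R (unitization A)) st1 IB IMr invP m D.
- by move=> i j; rewrite mxE.
- by move=> sat i j; rewrite !mxE; apply: unitz_eqP; rewrite /= ?sd ?rmorph0.
pose D' := D + diag_mx t; pose C := W - 1%:M.
rewrite -addrA -/D' in DW WD.
have ID i j : I (D' i j).
  rewrite /I !mxE /=; case: eqP => _; last by rewrite mulr0n addr0.
  by rewrite mulr1n (Pt i).1 addr0.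
have I_sum (F : 'I_m -> K) : (forall k, I (F k)) -> I (\sum_k F k).
  move=> IF; apply: (big_ind I) => // x y Ix Iy.
  by move: Ix Iy; rewrite /I /= => -> ->; rewrite addr0.
(* From [W = 1 - D' W]: the inverse minus the identity has entries in [A]. *)
have CE : C = - (D' *m W) by rewrite /C -DW mulmxDl mul1mx opprD addrA subrr add0r.
have IC i j : I (C i j).
  rewrite CE mxE -sub0r; apply: IB => //; rewrite mxE; apply: I_sum => k; exact: IMr.
have fstD (n : nat) (F : 'I_n -> K) : (\sum_k F k).1 = \sum_k (F k).1.
  exact: (big_morph (fun x : K => x.1) (fun _ _ => erefl) erefl).
have fstM (x y : K) : I x -> I y -> (x * y).1 = x.1 ** y.1.
  rewrite /I unitz_ring_mulE unitz_mulE /= => -> ->; by rewrite !scale0r !addr0.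
have entry (X Y : 'M[K]_m) i j : (forall i j, I (X i j)) -> (forall i j, I (Y i j)) ->
    D' + C + X *m Y = 0 -> (D' i j).1 + (C i j).1 + \sum_k (X i k).1 ** (Y k j).1 = 0.
  move=> IX IY E; have {}E : (D' + C + X *m Y) i j = 0 by rewrite E mxE.
  rewrite mxE [(D' + C) i j]mxE [(X *m Y) i j]mxE in E.
  have := congr1 fst E; rewrite /= fstD => H; rewrite -[RHS]H.
  by congr (_ + _); apply: eq_bigr => k _; rewrite fstM.
exists (fun i j => (D' i j).1), (fun i j => (C i j).1); split.
- move=> sat i j; rewrite !mxE /= starD sd //; congr (_ + _).
  rewrite eq_sym; case: eqP => [->|_]; last by rewrite !mulr0n star0.
  by rewrite !mulr1n -[in RHS]stt.
- move=> i j; rewrite !mxE /= addrC addKr; case: eqP => [->|_].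
    by rewrite mulr1n; case: (Pt j).
  by rewrite mulr0n rnorm0 ltW.
- move=> i j; have E : D' + C + D' *m C = 0.
    have {}DW : W + D' *m W = 1%:M by move: DW; rewrite mulmxDl mul1mx.
    rewrite /C mulmxBr mulmx1.
    have -> : D' + (W - 1%:M) + (D' *m W - D') = (W + D' *m W) - 1%:M by abel.
    by rewrite DW subrr.
  exact: entry.
- move=> i j; have E : D' + C + C *m D' = 0.
    have {}WD : W + W *m D' = 1%:M by move: WD; rewrite mulmxDr mulmx1.
    rewrite /C mulmxBl mul1mx.
    have -> : D' + (W - 1%:M) + (W *m D' - D') = (W + W *m D') - 1%:M by abel.
    by rewrite WD subrr.
  exact: entry.
Qed.

(** * Kernels of continuous functions *)

Lemma sum_continuous (R : realType) (T : topologicalType) (I : Type) (s : seq I) (F : I -> T -> R) : (forall i, continuous (F i)) ->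
  continuous (fun t => \sum_(i <- s) F i t).
Proof.
move=> cF; elim: s => [|i s IH] t; first by under eq_fun do rewrite big_nil; exact: cvg_cst.
have -> : (fun t => \sum_(j <- i :: s) F j t) = (fun t => F i t + \sum_(j <- s) F j t).
  by apply/funext => x; rewrite big_cons.
by apply: cvgD; [exact: cF|exact: IH].
Qed.

(** Each bump is multiplied by the factors [1 - u] of the bumps before it in the list. The sum
    telescopes to one minus the product of all [1 - u p], and that product vanishes because some
    bump equals 1 at every point. *)
Lemma partition_of_unity (R : realType) (G : topologicalGroupType) (rho : G -> G -> R) (d : R) :
  compact [set: G] -> (forall p, continuous (rho p)) -> (forall p, rho p p = 0) -> 0 < d ->
  exists (n : nat) (p : nat -> G) (a : nat -> G -> R),
    [/\ forall i, continuous (a i), forall i s, 0 <= a i s, forall s, \sum_(i < n) a i s = 1 &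
        forall i s, a i s != 0 -> rho (p i) s < 2 * d].
Proof.
move=> cptG crho rho0 d0.
have [ps [u [cu u01 ru us]]] := bump_cover cptG crho rho0 d0.
suff [n [p [a [ca a0 Sa ra]]]] : exists (n : nat) (p : nat -> G) (a : nat -> G -> R),
    [/\ forall i, continuous (a i), forall i s, 0 <= a i s,
        forall s, \sum_(i < n) a i s = 1 - \prod_(p <- ps) (1 - u p s) &
        forall i s, a i s != 0 -> rho (p i) s < 2 * d].
  exists n, p, a; split=> // s; rewrite Sa; have [q qps qs] := us s.
  by rewrite (big_rem q) //= qs subrr mul0r subr0.
elim: ps {us} => [|q ps [n [p [a [ca a0 Sa ra]]]]].
  exists 0%N, (fun=> 1%g), (fun _ _ => 0); split=> //.
  - by move=> i t; exact: cvg_cst.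
  - by move=> s; rewrite big_ord0 big_nil subrr.
  - by move=> i s; rewrite eqxx.
exists n.+1, (fun i => if i is j.+1 then p j else q),
  (fun i s => if i is j.+1 then (1 - u q s) * a j s else u q s); split.
- move=> [|i] t; first exact: cu.
  apply: cvgM; last exact: ca.
  by apply: cvgB; [exact: cvg_cst|exact: cu].
- move=> [|i] s; have /andP[H1 H2] := u01 q s => //.
  by rewrite mulr_ge0 ?subr_ge0.
- move=> s; rewrite big_ord_recl big_cons /= -mulr_sumr Sa; ring.
- move=> [|i] s; first exact: ru.
  by rewrite mulf_eq0 negb_or => /andP[_]; exact: ra.
Qed.

Lemma partition_close (R : realType) (V : normedModType R[i]) (n : nat) (w : 'I_n -> R) (x : 'I_n -> V)
    (y : V) (e : R) : (forall i, 0 <= w i) -> \sum_i w i = 1 ->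
  (forall i, w i != 0 -> rnorm (y - x i) <= e) -> rnorm (y - \sum_i (w i)%:C *: x i) <= e.
Proof.
move=> w0 w1 H; have -> : y - \sum_i (w i)%:C *: x i = \sum_i (w i)%:C *: (y - x i).
  under [RHS]eq_bigr do rewrite scalerBr.
  by rewrite sumrB -scaler_suml -rmorph_sum w1 scale1r.
rewrite (le_trans (rnorm_sum _ _ _)) // -[leRHS]mul1r -w1 mulr_suml; apply: ler_sum => i _.
rewrite rnormZr ger0_norm //; have [->|/H Hi] := eqVneq (w i) 0; first by rewrite !mul0r.
by rewrite ler_wpM2l.
Qed.

Section Kernel.
Variables (R : realType) (G : topologicalGroupType) (A : cstarAlgType R).
Variable alpha : cstarAction G A.
Hypothesis cptG : compact [set: G].

Lemma act_cvg (T : Type) (F : set_system T) {FF : Filter F} (h : T -> G) (u : T -> A) g x :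
  h @ F --> g -> u @ F --> x -> (fun y => alpha (h y) (u y)) @ F --> alpha g x.
Proof.
move=> hg /rnorm_cvgP ux; apply/rnorm_cvgP => e e0; have e2 : 0 < e / 2 by rewrite divr_gt0.
have /rnorm_cvgP/(_ _ e2) H : (fun y => alpha (h y) x) @ F --> alpha g x.
  exact: (cvg_comp _ _ hg (@act_continuous _ _ _ alpha x g)).
near=> y; rewrite (le_lt_trans (rnorm_tri (alpha (h y) x) _ _)) // [ltRHS]splitr ltrD //.
  by rewrite -actB rnorm_act; near: y; exact: ux.
by near: y.
Unshelve. all: by end_near. Qed.

Lemma uniform_net (V : normedModType R[i]) (k : G -> G -> V) (e : R) :
  (forall s t, (fun z : G * G => k z.1 z.2) @ nbhs (s, t) --> k s t) -> 0 < e ->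
  exists ts : seq G, forall t, exists2 t', t' \in ts & forall s, rnorm (k s t' - k s t) <= e.
Proof.
move=> ck e0; have e2 : 0 < e / 2 by rewrite divr_gt0.
apply: (finite_nbhs_cover cptG (U := fun t' => [set t | forall s, rnorm (k s t' - k s t) <= e])) => t.
apply: near_compact => // s.
have /rnorm_cvgP/(_ _ e2) H := ck s t.
have c1 : (fun z : G * G => (z.1, t)) @ nbhs (s, t) --> (s, t).
  by apply: cvg_pair => /=; [exact: cvg_fst|exact: cvg_cst].
have /rnorm_cvgP/(_ _ e2) H' : (fun z : G * G => k z.1 t) @ nbhs (s, t) --> k s t.
  exact: (cvg_comp _ _ c1 (ck s t)).
near=> z; rewrite (le_trans (rnorm_tri (k s t) _ _)) // [leRHS]splitr lerD // ltW //.
  by near: z.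
by rewrite rnormC; near: z.
Unshelve. all: by end_near. Qed.

(** With [k s t = alpha (s^-1) (f (s t^-1))] one has [f g = alpha s (k s (g^-1 s))] for every [s],
    so approximating the kernel [k] on [G * G] suffices. The same sample points serve both
    variables, and [star (k s t) = k t s] when [f] is self-adjoint. *)
Lemma kernel_partition (f : G -> A) (e : R) : continuous f -> 0 < e ->
  exists (n : nat) (a : nat -> G -> R) (d : nat -> nat -> A),
    [/\ forall i, continuous (a i), involution alpha f = f -> forall i j, star (d i j) = d j i &
        forall g s, rnorm (f g - \sum_(i < n) \sum_(j < n)
          (a i s * a j (g^-1 * s)%g)%:C *: alpha s (d i j)) <= e].
Proof.
move=> cf e0; pose k s t := alpha (s^-1)%g (f (s * t^-1)%g).
have ck s t : (fun z : G * G => k z.1 z.2) @ nbhs (s, t) --> k s t.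
  have cs : (fun z : G * G => z.1) @ nbhs (s, t) --> s by exact: cvg_fst.
  have ct : (fun z : G * G => z.2) @ nbhs (s, t) --> t by exact: cvg_snd.
  have cst : (fun z : G * G => z.1 * z.2^-1)%g @ nbhs (s, t) --> (s * t^-1)%g.
    by apply: cvg_mulg => //; exact: cvg_invg.
  by apply: act_cvg; [exact: cvg_invg|exact: (cvg_comp _ _ cst (cf _))].
have ck1 t : continuous (fun s => k s t).
  move=> s; have c1 : (fun x => (x, t)) @ nbhs s --> (s, t).
    by apply: cvg_pair => /=; [exact: cvg_id|exact: cvg_cst].
  exact: (cvg_comp _ _ c1 (ck s t)).
have ck2 s : continuous (k s).
  move=> t; have c1 : (fun x => (s, x)) @ nbhs t --> (s, t).
    by apply: cvg_pair => /=; [exact: cvg_cst|exact: cvg_id].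
  exact: (cvg_comp _ _ c1 (ck s t)).
(* Replacing one variable by a sample point costs [4 d]: [2 d] from [rho], and [d] twice for passing
   to the finite net in the other variable. *)
pose d := e / 8; have d0 : 0 < d by rewrite divr_gt0.
have [ts Hts] := uniform_net ck d0.
have [ss Hss] : exists ss : seq G, forall s, exists2 s', s' \in ss & forall t, rnorm (k s' t - k s t) <= d.
  apply: (@uniform_net _ (fun t s => k s t)) => // s t.
  have c1 : (fun z : G * G => (z.2, z.1)) @ nbhs (s, t) --> (t, s).
    by apply: cvg_pair => /=; [exact: cvg_snd|exact: cvg_fst].
  exact: (cvg_comp _ _ c1 (ck t s)).
(* [rho] measures the variation of [k] in both variables at once, tested on finite nets, so a single
   partition can be used twice. *)
pose rho p s := \sum_(t <- ts) rnorm (k s t - k p t) + \sum_(t <- ss) rnorm (k t s - k t p).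
have crho p : continuous (rho p).
  move=> s; apply: cvgD; apply: sum_continuous => t; exact: rnorm_continuous_dist.
have rho0 p : rho p p = 0 by rewrite /rho !big1 ?addr0 // => t _; rewrite subrr rnorm0.
have rho1 p s : rho p s < 2 * d -> (forall t, rnorm (k s t - k p t) <= 4 * d) /\
    (forall t, rnorm (k t s - k t p) <= 4 * d).
  move=> H; have S1 : 0 <= \sum_(t <- ts) rnorm (k s t - k p t).
    by apply: sumr_ge0 => t _; exact: rnorm_ge0.
  have S2 : 0 <= \sum_(t <- ss) rnorm (k t s - k t p).
    by apply: sumr_ge0 => t _; exact: rnorm_ge0.
  split=> t.
    have [t' t'ts Ht'] := Hts t.
    have H1 : rnorm (k s t' - k p t') <= \sum_(t <- ts) rnorm (k s t - k p t).
      by rewrite (big_rem t') //= lerDl; apply: sumr_ge0 => i _; exact: rnorm_ge0.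
    have := rnorm_tri (k s t') (k s t) (k p t); have := rnorm_tri (k p t') (k s t') (k p t).
    have := Ht' s; have := Ht' p; rewrite (rnormC (k s t) (k s t')); rewrite /rho in H; lra.
  have [t' t'ss Ht'] := Hss t.
  have H1 : rnorm (k t' s - k t' p) <= \sum_(t <- ss) rnorm (k t s - k t p).
    by rewrite (big_rem t') //= lerDl; apply: sumr_ge0 => i _; exact: rnorm_ge0.
  have := rnorm_tri (k t' s) (k t s) (k t p); have := rnorm_tri (k t' p) (k t' s) (k t p).
  have := Ht' s; have := Ht' p; rewrite (rnormC (k t s) (k t' s)); rewrite /rho in H; lra.
have [n [p [a [ca a0 Sa ra]]]] := partition_of_unity cptG crho rho0 d0.
exists n, a, (fun i j => k (p i) (p j)); split=> //.
  move=> fs i j; rewrite /k -actStar -[in LHS]fs /involution -actStar starK -actM.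
  by rewrite mulKg // invgM invgK.
move=> g s; set t := (g^-1 * s)%g.
have -> : f g = alpha s (k s t) by rewrite /k actKV /t invgM invgK mulgA mulgV mul1g.
have -> : \sum_(i < n) \sum_(j < n) (a i s * a j t)%:C *: alpha s (k (p i) (p j)) =
    alpha s (\sum_(i < n) (a i s)%:C *: (\sum_(j < n) (a j t)%:C *: k (p i) (p j))).
  rewrite (big_morph (alpha s) (actD alpha s) (act0 alpha s)); apply: eq_bigr => i _.
  rewrite actZ (big_morph (alpha s) (actD alpha s) (act0 alpha s)) scaler_sumr.
  by apply: eq_bigr => j _; rewrite actZ scalerA rmorphM.
rewrite -actB rnorm_act; apply: partition_close => // i /ra /rho1[H1 _].
rewrite (le_trans (rnorm_tri (k (p i) t) _ _)) //.
have H2 : rnorm (k (p i) t - \sum_(j < n) (a j t)%:C *: k (p i) (p j)) <= 4 * d.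
  by apply: partition_close => // j /ra /rho1[_]; exact.
rewrite (le_trans (lerD (H1 t) H2)) //; rewrite /d; lra.
Qed.
End Kernel.

(** * Orthonormal families for the Haar measure *)

Section GramSchmidt.
Variables (R : realType) (G : topologicalGroupType).
Variable mu : probability (g_sigma_algebraType (@open G)) R.
Hypotheses (cptG : compact [set: G]) (linv : left_invariant mu).
Local Notation int r := (Rintegral mu setT r).

Lemma mulr_continuous (r s : G -> R) : continuous r -> continuous s -> continuous (fun t => r t * s t).
Proof. by move=> cr cs t; apply: cvgM; [exact: cr|exact: cs]. Qed.

Lemma scaler_continuous (k : R) (r : G -> R) : continuous r -> continuous (fun t => k * r t).
Proof. by move=> cr t; apply: cvgMl_tmp; exact: cr. Qed.

Lemma int_sum (I : Type) (s : seq I) (F : I -> G -> R) : (forall i, continuous (F i)) ->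
  int (fun t => \sum_(i <- s) F i t) = \sum_(i <- s) int (F i).
Proof.
move=> cF; elim: s => [|i s IH].
  by under eq_fun do rewrite big_nil; rewrite big_nil Rintegral_cst // mul0r.
under eq_fun do rewrite big_cons.
rewrite RintegralD //; try exact: continuous_integrable; last first.
  by apply: continuous_integrable => //; exact: sum_continuous.
by rewrite IH big_cons.
Qed.

Lemma intZ k (r : G -> R) : continuous r -> int (fun t => k * r t) = k * int r.
Proof. by move=> cr; rewrite RintegralZl //; exact: continuous_integrable. Qed.

Lemma lmean_int (r : G -> R) : continuous r -> lmean (fun t => (r t)%:C : R[i]^o) (int r)%:C.
Proof.
move=> cr e e0; have e2 : 0 < e / 2 by rewrite divr_gt0.
have [s s0 Hs] := osc_lavg cptG (real_continuousC cr) e2.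
pose S t := (size s)%:R^-1 * \sum_(g <- s) r (g * t)%g.
have SE t : lavg s (fun t => (r t)%:C : R[i]^o) t = (S t)%:C.
  by rewrite /lavg /avg -rmorph_sum /S rmorphM.
exists s => // t; rewrite -[avg _ _]/(lavg s (fun t => (r t)%:C : R[i]^o) t) SE.
rewrite -rmorphB rnorm_real distrC (le_trans (y := e / 2)) //; last by lra.
apply: (int_lavg cptG linv cr s0) => t'; have := Hs t' t.
by rewrite !SE -rmorphB rnorm_real.
Qed.

Lemma rmean_int (r : G -> R) : continuous r -> rmean (fun t => (r t)%:C : R[i]^o) (int r)%:C.
Proof.
move=> cr; have cr' : continuous (fun t => r (t^-1)%g).
  by move=> t; apply: (cvg_comp _ _ (cvg_invg (cvg_id))); exact: cr.
have H : rmean (fun t => (r t)%:C : R[i]^o) (int (fun t => r (t^-1)%g))%:C.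
  by apply: rmean_inv; exact: lmean_int.
by rewrite (mean_uniq (lmean_int cr) H).
Qed.

(** If [r x] were nonzero, finitely many translates of the set where [r^2 > h] would cover [G].
    Summing the translates of [r^2] over the points of a finite average then gives at least [h] per
    point, while the mean being 0 allows only [h / 2]. *)
Lemma int_sq_eq0 (r : G -> R) : continuous r -> int (fun t => r t * r t) = 0 -> forall t, r t = 0.
Proof.
move=> cr r0 x; apply: contrapT => /eqP nx.
have csq := mulr_continuous cr cr.
pose h := r x * r x / 2; have h0 : 0 < h by rewrite divr_gt0 // -expr2 exprn_even_gt0.
have sq0 t : 0 <= r t * r t by rewrite -expr2 sqr_ge0.
have [p|ps Hps] := finite_nbhs_cover cptG
    (U := fun p => [set s | h < r (x * p^-1 * s)%g * r (x * p^-1 * s)%g]).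
  have H := @translate_continuous _ _ _ (x * p^-1)%g csq p.
  have /cvgrPdist_lt/(_ h h0) := H; rewrite -mulgA mulVg mulg1.
  apply: filterS => s /=; rewrite ltr_norml => /andP[_].
  by rewrite /h; lra.
have ps0 : (0 < size ps)%N by have [p + _] := Hps 1%g; case: (ps).
have N0 : 0 < (size ps)%:R :> R by rewrite ltr0n.
have e0 : 0 < h / (2 * (size ps)%:R) by rewrite divr_gt0 // mulr_gt0.
have [s s0 Hs] := rmean_int csq e0.
have S0 : 0 < (size s)%:R :> R by rewrite ltr0n.
have {}Hs p : \sum_(g <- s) r (x * p^-1 * g)%g * r (x * p^-1 * g)%g <= (size s)%:R * (h / (2 * (size ps)%:R)).
  have := Hs (x * p^-1)%g; rewrite r0 subr0 /avg -rmorph_sum rnormZr.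
  rewrite rnorm_real (ger0_norm (sumr_ge0 _ _)) // ger0_norm ?invr_ge0 ?ler0n //.
  by rewrite ler_pdivrMl.
have H1 : \sum_(g <- s) h <= \sum_(g <- s) \sum_(p <- ps) r (x * p^-1 * g)%g * r (x * p^-1 * g)%g.
  apply: ler_sum => g _; have [p pps /= Hp] := Hps g.
  by rewrite (big_rem p) //= (le_trans (ltW Hp)) // lerDl sumr_ge0.
have H2 : \sum_(p <- ps) \sum_(g <- s) r (x * p^-1 * g)%g * r (x * p^-1 * g)%g <=
    \sum_(p <- ps) (size s)%:R * (h / (2 * (size ps)%:R)) by apply: ler_sum.
rewrite exchange_big /= in H1; have := le_trans H1 H2.
rewrite !big_const_seq !count_predT !iter_addr_0 -[h *+ _]mulr_natr -[X in _ <= X]mulr_natr.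
have -> : (size s)%:R * (h / (2 * (size ps)%:R)) * (size ps)%:R = h * (size s)%:R / 2.
  by field; rewrite gt_eqF.
have : 0 < h * (size s)%:R by rewrite mulr_gt0.
lra.
Qed.

Lemma gram_schmidt (n : nat) (a : nat -> G -> R) : (forall i, continuous (a i)) ->
  exists (m : nat) (p : nat -> G -> R) (c : nat -> nat -> R),
    [/\ forall k, continuous (p k),
        forall j k, (j < m)%N -> (k < m)%N -> int (fun t => p j t * p k t) = (j == k)%:R &
        forall i t, (i < n)%N -> a i t = \sum_(k < m) c i k * p k t].
Proof.
move=> ca; elim: n => [|n [m [p [c [cp op ac]]]]].
  by exists 0%N, a, (fun _ _ => 0).
pose b k := int (fun t => a n t * p k t).
pose v t := a n t - \sum_(k < m) b k * p k t.
have cs : continuous (fun t => \sum_(k < m) b k * p k t).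
  by apply: sum_continuous => k; exact: scaler_continuous.
have cv : continuous v by move=> t; apply: cvgB; [exact: ca|exact: cs].
have vp j : (j < m)%N -> int (fun t => v t * p j t) = 0.
  move=> jm; have -> : (fun t => v t * p j t) =
      (fun t => a n t * p j t - \sum_(k < m) b k * (p k t * p j t)).
    apply/funext => t; rewrite /v mulrBl mulr_suml; congr (_ - _).
    by apply: eq_bigr => k _; rewrite mulrA.
  have cpp k : continuous (fun t => b k * (p k t * p j t)).
    by apply: scaler_continuous; exact: mulr_continuous.
  rewrite RintegralB //.
  - rewrite int_sum // (bigD1 (Ordinal jm)) //= big1 => [|k kj].
      by rewrite intZ ?op // ?eqxx ?mulr1 ?addr0 ?subrr //; exact: mulr_continuous.
    have kj' : (k == j :> nat) = false by exact: negbTE.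
    by rewrite intZ ?op // ?kj' ?mulr0 //; exact: mulr_continuous.
  - by apply: continuous_integrable => //; exact: mulr_continuous.
  - by apply: continuous_integrable => //; exact: sum_continuous.
have cvv := mulr_continuous cv cv.
have vv0 : 0 <= int (fun t => v t * v t).
  by apply: Rintegral_ge0 => t _; rewrite -expr2 sqr_ge0.
(* A residual of zero length vanishes identically, so [a n] is already in the span and no new
   function is added. *)
have [vv|nvv] := eqVneq (int (fun t => v t * v t)) 0.
  exists m, p, (fun i k => if (i < n)%N then c i k else b k); split=> // i t.
  rewrite ltnS leq_eqVlt => /orP[/eqP->|ni]; last by rewrite ni; exact: ac.
  by rewrite ltnn; have /eqP := int_sq_eq0 cv vv t; rewrite subr_eq0 => /eqP.
pose w := Num.sqrt (int (fun t => v t * v t)).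
have w0 : w != 0 by rewrite gt_eqF // sqrtr_gt0 lt_def nvv.
have ww : w * w = int (fun t => v t * v t) by rewrite -expr2 sqr_sqrtr.
exists m.+1, (fun k => if (k < m)%N then p k else fun t => w^-1 * v t),
  (fun i k => if (i < n)%N then (if (k < m)%N then c i k else 0) else if (k < m)%N then b k else w).
split.
- by move=> k; case: ifP => // _; exact: scaler_continuous.
- have vpw j : (j < m)%N -> int (fun t => w^-1 * v t * p j t) = 0.
    move=> jm; under eq_fun do rewrite -mulrA.
    by rewrite intZ ?vp ?mulr0 //; exact: mulr_continuous.
  move=> j k; rewrite !ltnS leq_eqVlt => /orP[/eqP->|jm]; rewrite leq_eqVlt => /orP[/eqP->|km].
  + rewrite ltnn eqxx; have -> : (fun t => w^-1 * v t * (w^-1 * v t)) = (fun t => (w * w)^-1 * (v t * v t)).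
      by apply/funext => t; rewrite mulrACA invfM.
    by rewrite intZ // ww mulVf.
  + by rewrite ltnn km (gtn_eqF km) vpw.
  + rewrite ltnn jm (ltn_eqF jm); under eq_fun do rewrite mulrC; exact: vpw.
  + by rewrite jm km op.
- move=> i t; rewrite ltnS big_ord_recr /= ltnn leq_eqVlt => /orP[/eqP->|ni].
    rewrite ltnn mulrA divff // mul1r.
    have -> : \sum_(k < m) (if (k < m)%N then b k else w) * (if (k < m)%N then p k else fun t => w^-1 * v t) t
        = \sum_(k < m) b k * p k t by apply: eq_bigr => k _; rewrite ltn_ord.
    by rewrite /v addrC subrK.
  rewrite ni mul0r addr0 ac //; apply: eq_bigr => k _; by rewrite ltn_ord.
Qed.

(** The kernel of [kernel_partition] in an orthonormal basis. The change of basis has real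
    coefficients and acts in the same way on both indices, so the matrix stays self-adjoint. *)
Lemma orthonormal_kernel (A : cstarAlgType R) (alpha : cstarAction G A) (f : G -> A) (e : R) :
  continuous f -> 0 < e ->
  exists (m : nat) (p : 'I_m -> G -> R) (d : 'I_m -> 'I_m -> A),
    [/\ forall i, continuous (p i), forall j k, int (fun t => p j t * p k t) = (j == k)%:R,
        involution alpha f = f -> forall i j, star (d i j) = d j i &
        forall g s, rnorm (f g - \sum_i \sum_j (p i s * p j (g^-1 * s)%g)%:C *: alpha s (d i j)) <= e].
Proof.
move=> cf e0; have [n [a [d [ca sd fa]]]] := kernel_partition alpha cptG cf e0.
have [m [p [c [cp op ac]]]] := gram_schmidt n ca.
exists m, (fun k => p k), (fun k l => \sum_(i < n) \sum_(j < n) (c i k * c j l)%:C *: d i j).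
split=> [i|j k|/sd{}sd k l|g s]; [exact: cp|by rewrite op| |].
  rewrite exchange_big /= (big_morph (@star R A) (@starD R A) (star0 A)); apply: eq_bigr => i _.
  rewrite (big_morph (@star R A) (@starD R A) (star0 A)); apply: eq_bigr => j _.
  by rewrite starZ sd mulrC; congr (_ *: _); exact: conjc_real.
set X := (X in _ - X); have -> : X = \sum_(i < n) \sum_(j < n)
    (a i s * a j (g^-1 * s)%g)%:C *: alpha s (d i j); last exact: fa.
set t := (g^-1 * s)%g in X *.
pose F (i j : 'I_n) (k l : 'I_m) : A := (c i k * p k s * (c j l * p l t))%:C *: alpha s (d i j).
transitivity (\sum_k \sum_l \sum_i \sum_j F i j k l).
  apply: eq_bigr => k _; apply: eq_bigr => l _.
  rewrite (big_morph (alpha s) (actD alpha s) (act0 alpha s)) scaler_sumr; apply: eq_bigr => i _.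
  rewrite (big_morph (alpha s) (actD alpha s) (act0 alpha s)) scaler_sumr; apply: eq_bigr => j _.
  by rewrite actZ scalerA -rmorphM /F; congr (_%:C *: _); ring.
under eq_bigr do rewrite exchange_big /=.
rewrite exchange_big /=; apply: eq_bigr => i _.
under eq_bigr do rewrite exchange_big /=.
rewrite exchange_big /=; apply: eq_bigr => j _.
rewrite !ac // big_distrlr rmorph_sum scaler_suml; apply: eq_bigr => k _.
by rewrite rmorph_sum scaler_suml.
Qed.
End GramSchmidt.

(** * Crossed products *)

Lemma rnorm_sum_ord (R : realType) (V : normedModType R[i]) (m : nat) (F : 'I_m -> V) (M : R) :
  (forall i, rnorm (F i) <= M) -> rnorm (\sum_i F i) <= m%:R * M.
Proof.
move=> FM; rewrite (le_trans (rnorm_sum _ _ _)) // (le_trans (ler_sum _ (fun i _ => FM i))) //.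
by rewrite sumr_const card_ord mulr_natl.
Qed.

Section RankOneMatrices.
Variables (R : realType) (G : topologicalGroupType) (A B : cstarAlgType R).
Variable mu : probability (g_sigma_algebraType (@open G)) R.
Variables (alpha : cstarAction G A) (iota : (G -> A) -> B).
Hypotheses (cptG : compact [set: G]) (linv : left_invariant mu).
Hypothesis rep : convolution_rep mu alpha iota.
Variables (m : nat) (x : 'I_m -> A).
Implicit Types u e : 'I_m -> 'I_m -> A.
Local Notation rko := (rko alpha iota).

Definition rkmx u : B := \sum_i \sum_j rko (x i ** u i j) (x j).

Lemma rkmx_star u : (forall i j g, alpha g (u i j) = u i j) ->
  (forall i j, star (u i j) = u j i) -> star (rkmx u) = rkmx u.
Proof.
move=> fu su; have starS (F : 'I_m -> B) : star (\sum_i F i) = \sum_i star (F i).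
  exact: (big_morph (@star R B) (@starD R B) (star0 B)).
rewrite /rkmx starS; under eq_bigr do rewrite starS.
rewrite exchange_big /=; apply: eq_bigr => i _; apply: eq_bigr => j _.
by rewrite (rko_star rep) (rko_fixed _ _ _ (fu j i)) su.
Qed.

Lemma iota_sum (I : Type) (r : seq I) (F : I -> G -> A) : (forall i, continuous (F i)) ->
  continuous (fun g => \sum_(i <- r) F i g) /\
  iota (fun g => \sum_(i <- r) F i g) = \sum_(i <- r) iota (F i).
Proof.
move=> cF; elim: r => [|i r [IH1 IH2]].
  have -> : (fun g => \sum_(i <- [::]) F i g) = 0 by apply/funext => g; rewrite big_nil.
  by rewrite big_nil (iota0 rep); split=> // t; exact: cvg_cst.
have -> : (fun g => \sum_(j <- i :: r) F j g) = F i + (fun g => \sum_(j <- r) F j g).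
  by apply/funext => g; rewrite big_cons.
rewrite big_cons (rep_iotaD rep) ?IH2 //; split=> // t.
by apply: cvgD; [exact: cF|exact: IH1].
Qed.

Lemma rkmx_close u f (M : R) : continuous f ->
  (forall g, rnorm (\sum_i \sum_j x i ** u i j ** alpha g (star (x j)) - f g) <= M) ->
  rnorm (rkmx u - iota f) <= M.
Proof.
move=> cf H; have crk i j := @rankone_continuous _ _ _ alpha (x i ** u i j) (x j).
have S i := iota_sum (index_enum 'I_m) (crk i).
have [c1 E1] := iota_sum (index_enum 'I_m) (fun i => (S i).1).
have -> : rkmx u = iota (fun g => \sum_i \sum_j rankone alpha (x i ** u i j) (x j) g).
  by rewrite E1; apply: eq_bigr => i _; rewrite (S i).2.
rewrite -(iotaB rep) //; apply: (iota_norm cptG rep); last exact: H.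
by move=> t; apply: cvgB; [exact: c1|exact: cf].
Qed.

Lemma rkmx_mul u e : rkmx u ** rkmx e = \sum_i \sum_j \sum_l \sum_k
  rko (x i ** u i j ** fixE alpha (star (x j) ** (x k ** e k l))) (x l).
Proof.
have mulS (F : 'I_m -> B) y : (\sum_i F i) ** y = \sum_i F i ** y.
  by apply: (big_morph (fun z => z ** y)) => [a b|]; [exact: amulDl|exact: amul0r].
have Smul (F : 'I_m -> B) y : y ** (\sum_i F i) = \sum_i y ** F i.
  by apply: (big_morph (fun z => y ** z)) => [a b|]; [exact: amulDr|exact: amulr0].
rewrite /rkmx mulS; apply: eq_bigr => i _; rewrite mulS; apply: eq_bigr => j _.
rewrite Smul exchange_big /=; apply: eq_bigr => k _.
rewrite Smul; apply: eq_bigr => l _.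
by rewrite (rko_mul cptG linv rep).
Qed.

(* If [fixE (star (x j) ** x k)] acts almost like the identity matrix then [rkmx]
   turns products of matrices into products. *)
Lemma rkmx_quasi u e (L h : R) : 0 <= L -> 0 <= h -> (forall i, rnorm (x i) <= L) ->
  (forall i j, rnorm (u i j) <= L) ->
  (forall j k l, rnorm (fixE alpha (star (x j) ** (x k ** e k l)) -
     (if j == k then e k l else 0)) <= h) ->
  (forall i l, rnorm (u i l + e i l + \sum_j u i j ** e j l) <= h) ->
  rnorm (rkmx u + rkmx e + rkmx u ** rkmx e) <=
    (m%:R * m%:R * L * L + m%:R * m%:R * m%:R * m%:R * L * L * L) * h.
Proof.
move=> L0 h0 xL uL eh uh; rewrite rkmx_mul.
(* [T] collects the defect of orthonormality, with [m^4] terms and three factors bounded by [L]; [S]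
   the defect of the matrix quasi-inverse, with [m^2] terms and two such factors. *)
pose T i j l k := rko (x i ** u i j ** (fixE alpha (star (x j) ** (x k ** e k l)) -
  (if j == k then e k l else 0))) (x l).
pose S i l := rko (x i ** (u i l + e i l + \sum_j u i j ** e j l)) (x l).
have -> : rkmx u + rkmx e + \sum_i \sum_j \sum_l \sum_k
    rko (x i ** u i j ** fixE alpha (star (x j) ** (x k ** e k l))) (x l) =
    \sum_i \sum_l S i l + \sum_i \sum_j \sum_l \sum_k T i j l k.
  rewrite /rkmx -!big_split /=; apply: eq_bigr => i _.
  have -> : \sum_l S i l = \sum_l (rko (x i ** u i l) (x l) + rko (x i ** e i l) (x l)) +
      \sum_j \sum_l rko (x i ** u i j ** e j l) (x l).
    rewrite exchange_big -big_split /=; apply: eq_bigr => l _.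
    rewrite /S !amulDr !(rkoDl rep); congr (_ + _).
    rewrite -(rko_suml rep); congr (rko _ _).
    rewrite (big_morph (fun z => x i ** z) (amulDr (x i)) (amulr0 (x i))).
    by apply: eq_bigr => j _; rewrite amulA.
  rewrite big_split /= -!addrA; congr (_ + _); congr (_ + _).
  rewrite -big_split /=; apply: eq_bigr => j _.
  rewrite -big_split /=; apply: eq_bigr => l _.
  have -> : rko (x i ** u i j ** e j l) (x l) =
      \sum_k rko (x i ** u i j ** (if j == k then e k l else 0)) (x l).
    rewrite (bigD1 j) //= eqxx big1 ?addr0 // => k kj.
    by rewrite eq_sym (negbTE kj) amulr0 (rko0l rep).
  rewrite -big_split /=; apply: eq_bigr => k _.
  by rewrite /T -(rkoDl rep); congr (rko _ _); amul_ring.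
rewrite mulrDl (le_trans (rnormD _ _)) // lerD //.
  have -> : m%:R * m%:R * L * L * h = m%:R * (m%:R * (L * h * L)) by ring.
  apply: rnorm_sum_ord => i; apply: rnorm_sum_ord => l.
  rewrite (le_trans (rko_norm cptG rep _ _)) // ler_pM ?rnorm_ge0 //.
  by rewrite (le_trans (rnormM _ _)) // ler_pM ?rnorm_ge0.
have -> : m%:R * m%:R * m%:R * m%:R * L * L * L * h =
  m%:R * (m%:R * (m%:R * (m%:R * (L * L * h * L)))) by ring.
apply: rnorm_sum_ord => i; apply: rnorm_sum_ord => j; apply: rnorm_sum_ord => l.
apply: rnorm_sum_ord => k.
rewrite (le_trans (rko_norm cptG rep _ _)) // ler_pM ?rnorm_ge0 //.
rewrite (le_trans (rnormM _ _)) // ler_pM ?rnorm_ge0 //.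
by rewrite (le_trans (rnormM _ _)) // ler_pM ?rnorm_ge0.
Qed.
End RankOneMatrices.

Section AsymptoticKernels.
Variables (R : realType) (G : topologicalGroupType) (A : cstarAlgType R).
Variable alpha : cstarAction G A.
Hypothesis cptG : compact [set: G].
Variable D : starSubalg A.
Hypothesis iD : forall g d, sset D d -> sset D (alpha g d).
Variable q : CG R G -> linf A.
Hypothesis Hq : rokhlin_lift alpha D q.
Local Notation Rep := (Rep D q).

Lemma linf_sum (I : Type) (r : seq I) (F : I -> linf A) n :
  val (\sum_(i <- r) F i) n = \sum_(i <- r) val (F i) n.
Proof. by elim: r => [|i r IH]; rewrite ?big_nil // !big_cons linfD IH. Qed.

Lemma eta_sum (I : Type) (r : seq I) (F : I -> linf A) :
  \sum_(i <- r) Defs.eta (F i) = Defs.eta (\sum_(i <- r) F i).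
Proof.
elim: r => [|i r IH]; last by rewrite !big_cons IH etaD.
by rewrite !big_nil; apply: (addrI (Defs.eta 0)); rewrite etaD !addr0.
Qed.

(** The product represents [r(s) alpha s d], and acting by [g^-1] only translates [r], because
    [alpha s d] is invariant. A finite average bringing [r] near [k] brings the orbit average near
    [k w] in the sequence algebra, and [fixE_near] passes to the integral. *)
Lemma fixE_near_seq (P P' : CG R G) (r : G -> R) (k : R) (w : linf A) (d : A) :
  (forall t, (val (star P) t : R[i]) * (val P' t : R[i]) = (r t)%:C) ->
  lmean (fun t => (r t)%:C : R[i]^o) k%:C ->
  Rep (Defs.eta w) (fun s => alpha s d) -> (forall n g, alpha g (val w n) = val w n) ->
  forall e : R, 0 < e -> \forall n \near \oo,
    rnorm (fixE alpha (star (val (q P) n) ** (val (q P') n ** val w n)) - k%:C *: val w n) <= e.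
Proof.
move=> Pr rk Rw fw e e0; pose v : linf A := star (q P) ** (q P' ** w).
have Rv : Rep (Defs.eta v) (fun s => (r s)%:C *: alpha s d).
  rewrite /v -etaM -etaS -etaM.
  by apply: (Rep_ext _ (RepQstar cptG Hq P (RepQ cptG Hq P' Rw))) => s; rewrite scalerA Pr.
have Rg g : Rep (Defs.eta (act_linf alpha (g^-1)%g v)) (fun s => (r (g * s)%g)%:C *: alpha s d).
  rewrite -act_infty_eta; apply: (Rep_ext _ (Rep_act iD Hq (g^-1)%g Rv)) => s.
  by rewrite actZ -actM invgK mulKg.
have d1 : 0 < rnorm d + 1 by rewrite ltr_wpDl // rnorm_ge0.
have e1 : 0 < e / 2 / (rnorm d + 1) by rewrite !divr_gt0.
have [s s0 Hs] := rk _ e1.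
pose c : R[i] := ((size s)%:R^-1 : R)%:C.
pose X : linf A := c *: (\sum_(g <- s) act_linf alpha (g^-1)%g v) - k%:C *: w.
have NX : snorm (Defs.eta X) <= e / 2.
  have RX : Rep (Defs.eta X)
      (fun t => c *: (\sum_(g <- s) (r (g * t)%g)%:C *: alpha t d) - k%:C *: alpha t d).
    rewrite /X -etaB -!etaZ -eta_sum; apply: (RepB Hq); last exact: (RepZ Hq).
    by apply: (RepZ Hq); apply: Rep_sum => g; exact: Rg.
  apply: (Rep_norm cptG Hq RX) => t.
  rewrite -scaler_suml scalerA -scalerBl rnormZ rnorm_act.
  have H1 := Hs t; rewrite /avg -/c in H1.
  apply: (@le_trans _ _ (e / 2 / (rnorm d + 1) * (rnorm d + 1))); last by rewrite divfK ?gt_eqF.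
  by rewrite ler_pM ?rnorm_ge0 // lerDl.
have e2 : 0 < e / 2 by rewrite divr_gt0.
have := snorm_le_nearle NX e2; apply: filterS => n Hn.
apply: (@fixE_near _ _ _ alpha cptG (map (fun g => g^-1)%g s)); first by rewrite size_map.
  by move=> g; rewrite actZ fw.
rewrite avg_map [e]splitr; apply: le_trans Hn.
rewrite linfB !linfZ linf_sum /avg -/c.
by under [X in _ <= rnorm (_ *: X - _)]eq_bigr do rewrite act_linfE.
Qed.

Variables (m : nat) (P : 'I_m -> CG R G) (p : 'I_m -> G -> R).
Hypothesis Pp : forall i t, val (P i) t = (p i t)%:C.
Variables (u : 'I_m -> 'I_m -> linf A) (d : 'I_m -> 'I_m -> A).
Hypothesis Ru : forall i j, Rep (Defs.eta (u i j)) (fun s => alpha s (d i j)).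

Let Phi n g : A := \sum_i \sum_j
  val (q (P i)) n ** val (u i j) n ** alpha g (star (val (q (P j)) n)).

Lemma kernel_near (v : A) (g : G) (M : R) : sset D v ->
  (forall s, rnorm (v - \sum_i \sum_j (p i s * p j (g^-1 * s)%g)%:C *: alpha s (d i j)) <= M) ->
  forall e, 0 < e -> \forall n \near \oo, rnorm (Phi n g - v) <= M + e.
Proof.
move=> Dv HM e e0.
pose X : linf A := \sum_i \sum_j q (P i) ** u i j ** act_linf alpha g (star (q (P j))) -
  mk_subalg (const_bounded v).
have NX : snorm (Defs.eta X) <= M.
  have RX : Rep (Defs.eta X)
      (fun s => \sum_i \sum_j (p i s * p j (g^-1 * s)%g)%:C *: alpha s (d i j) - v).
    rewrite /X -etaB; apply: (RepB Hq); last by apply: Rep_Tens; exact: (Tens_const Hq).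
    rewrite -eta_sum; apply: Rep_sum => i; rewrite -eta_sum; apply: Rep_sum => j.
    rewrite -!etaM -act_infty_eta -etaS.
    (* The right factor [alpha g (star (q (P j)))] represents no function by itself. The product is
       rewritten by adjoints and the action of [g^-1] and [g], so that [q (P j)] only multiplies
       represented elements from the left. *)
    have R1 := RepQ cptG Hq (P i) (Ru i j).
    set Y := Defs.eta (q (P i)) ** Defs.eta (u i j) in R1 *.
    have R2 := Rep_act iD Hq (g^-1)%g R1.
    have R3 := Rep_act iD Hq g (Rep_star Hq (RepQ cptG Hq (P j) (Rep_star Hq R2))).
    have E : act_infty alpha g (star (Defs.eta (q (P j)) ** star (act_infty alpha (g^-1)%g Y))) =
        Y ** act_infty alpha g (star (Defs.eta (q (P j)))).
      rewrite starM starK act_inftyM; congr (_ ** _).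
      rewrite /Y; elim/snorm_ind: (Defs.eta _ ** _) => y.
      rewrite !act_infty_eta; congr Defs.eta; apply: linf_ext => n.
      by rewrite !act_linfE actKV.
    rewrite E in R3; apply: (Rep_ext _ R3) => s.
    rewrite !invgK mulVKg !Pp !starZ starK !actZ actKV scalerA; congr (_ *: _).
    by rewrite mulrC rmorphM; congr (_ * _); exact: conjc_real.
  by apply: (Rep_norm cptG Hq RX) => s; rewrite rnormC.
apply: filterS (snorm_le_nearle NX e0) => n.
rewrite linfB linf_sum /=; under eq_bigr do rewrite linf_sum.
rewrite /Phi; under [X in rnorm (X - _) <= _ -> _]eq_bigr => i _.
  by under eq_bigr do rewrite !linfM act_linfE linfS; over.
by [].
Qed.

Lemma equicont_at (a : linf A) (g0 : G) : equicont alpha a -> forall e : R, 0 < e ->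
  \forall g \near g0, forall n, rnorm (alpha g (val a n) - alpha g0 (val a n)) <= e.
Proof.
move=> ea e /ea H; have c : (fun g => g0^-1 * g)%g @ nbhs g0 --> (1%g : G).
  by rewrite -(mulVg g0); apply: cvg_mulg; [exact: cvg_cst|exact: cvg_id].
have H' : \forall g \near g0, forall n, rnorm (alpha (g0^-1 * g)%g (val a n) - val a n) <= e := c _ H.
apply: filterS H' => g Hg n.
by rewrite -[in alpha g _](mulVKg g0 g) actM -actB rnorm_act.
Qed.

(** Only the finitely many values of [f] on [ps] are known to lie in [D]; passing through the
    nearest one costs [h] twice. Equicontinuity of the lifts and compactness make the index uniform
    in [g]. *)
Lemma kernel_uniform (f : G -> A) (ps : seq G) (h M : R) : continuous f ->
  (forall x, x \in ps -> sset D (f x)) ->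
  (forall s, exists2 x, x \in ps & rnorm (f s - f x) <= h) ->
  (forall g s, rnorm (f g - \sum_i \sum_j (p i s * p j (g^-1 * s)%g)%:C *: alpha s (d i j)) <= M) ->
  forall e, 0 < e -> \forall n \near \oo, forall g, rnorm (Phi n g - f g) <= M + 2 * h + e.
Proof.
move=> cf Df fps HM e e0; apply: near_compact => // g0.
have [x xps fx] := fps g0.
have e3 : 0 < e / 3 by rewrite divr_gt0.
have H1 : \forall n \near \oo, rnorm (Phi n g0 - f x) <= M + h + e / 3.
  apply: kernel_near => //; first exact: Df.
  move=> s; rewrite (le_trans (rnorm_tri (f g0) _ _)) // addrC lerD //.
  by rewrite rnormC.
have [L L0 HL] : exists2 L : R, 0 <= L & forall i j n,
    rnorm (val (q (P i)) n ** val (u i j) n) <= L.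
  have ex i j : exists L, forall n, rnorm (val (q (P i)) n ** val (u i j) n) <= L.
    by have [L _ HL] := linf_bounded (q (P i) ** u i j); exists L.
  have [Lf HLf] := choice (fun ij : 'I_m * 'I_m => ex ij.1 ij.2).
  exists (\sum_ij `|Lf ij|); first by apply: sumr_ge0 => i _.
  move=> i j n; rewrite (le_trans (HLf (i, j) n)) // (bigD1 (i, j)) //=.
  by rewrite (le_trans (ler_norm _)) // lerDl; apply: sumr_ge0.
have k0 : 0 < m%:R * m%:R * (L + 1) + 1 :> R by rewrite ltr_wpDl // !mulr_ge0 // addr_ge0.
pose h' := e / 3 / (m%:R * m%:R * (L + 1) + 1).
have h'0 : 0 < h' by rewrite divr_gt0.
have H2 : \forall g \near g0, forall j n,
    rnorm (alpha g (star (val (q (P j)) n)) - alpha g0 (star (val (q (P j)) n))) <= h'.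
  apply: filter_forall => j; have := equicont_at g0 (q_equicont Hq (P j)) h'0.
  by apply: filterS => g Hg n; rewrite !actStar -starN -starD rnorm_star.
have /rnorm_cvgP/(_ _ e3) H3 := cf g0.
near=> g n.
have A0 : forall j n', rnorm (alpha g (star (val (q (P j)) n')) - alpha g0 (star (val (q (P j)) n'))) <= h'.
  by near: g; exact: H2.
have A1 : rnorm (Phi n g - Phi n g0) <= e / 3.
  rewrite /Phi -sumrB.
  apply: (@le_trans _ _ (m%:R * (m%:R * (L * h')))).
    apply: rnorm_sum_ord => i; rewrite -sumrB; apply: rnorm_sum_ord => j.
    rewrite -amulNr -amulDr (le_trans (rnormM _ _)) // ler_pM ?rnorm_ge0 //.
  have -> : e / 3 = h' * (m%:R * m%:R * (L + 1) + 1) by rewrite /h' divfK // gt_eqF.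
  rewrite -subr_ge0.
  have -> : h' * (m%:R * m%:R * (L + 1) + 1) - m%:R * (m%:R * (L * h')) = h' * (m%:R * m%:R + 1) by ring.
  by rewrite mulr_ge0 ?ltW // addr_gt0 // mulr_ge0.
have A2 : rnorm (Phi n g0 - f x) <= M + h + e / 3 by near: n; exact: H1.
have A3 : rnorm (f g - f g0) <= e / 3 by apply: ltW; near: g.
have -> : Phi n g - f g = (Phi n g - Phi n g0) + (Phi n g0 - f x) - (f g0 - f x) - (f g - f g0) by abel.
rewrite (le_trans (rnormB _ _)) // (le_trans (lerD (rnormB _ _) A3)) //.
have A4 := rnormD (Phi n g - Phi n g0) (Phi n g0 - f x).
rewrite (le_trans (lerD (lerD (le_trans A4 (lerD A1 A2)) fx) (lexx _))) //; lra.
Unshelve. all: by end_near. Qed.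
End AsymptoticKernels.

Section CrossedProduct.
Variables (R : realType) (G : topologicalGroupType) (A B : cstarAlgType R).
Variable mu : probability (g_sigma_algebraType (@open G)) R.
Variables (alpha : cstarAction G A) (iota : (G -> A) -> B).
Hypotheses (cptG : compact [set: G]) (linv : left_invariant mu).
Hypothesis icp : is_crossed_product mu alpha iota.

Lemma iota_dense (sa : bool) (x : B) (e : R) : (sa -> star x = x) -> 0 < e ->
  exists f : G -> A, [/\ continuous f, sa -> involution alpha f = f & rnorm (iota f - x) < e].
Proof.
move=> sx e0; have [rep dns _] := icp.
have : closure (iota @` [set f | continuous f]) x by rewrite dns.
move=> /rnorm_closureP/(_ _ e0)[_ [f cf <-] fx].
case: sa sx => [/(_ isT) sx|_]; last by exists f.
have ci : continuous (involution alpha f).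
  move=> s; apply: act_cvg; first exact: cvg_id.
  by apply: cvg_star; apply: (cvg_comp _ _ (cvg_invg (cvg_id))); exact: cf.
pose h : R[i] := (1 / 2)%:C.
have cs : continuous (f + involution alpha f) by move=> s; apply: cvgD; [exact: cf|exact: ci].
exists (h *: (f + involution alpha f)); split.
- by move=> s; apply: cvgZl_tmp; exact: cs.
- move=> _; apply/funext => s; rewrite /involution !fctE.
  rewrite starZ actZ starD actD -actStar starK -actM mulgV act1 invgK addrC.
  by congr (_ *: (_ + _)); exact: conjc_real.
- rewrite (iotaZ rep) // (rep_iotaD rep) // -(iota_star rep) //.
  rewrite -[x in _ - x]scale_half -{2}sx -scalerBr rnormZr.
  have -> : iota f + star (iota f) - (x + star x) = (iota f - x) + star (iota f - x).
    by rewrite starD starN; abel.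
  have := rnormD (iota f - x) (star (iota f - x)); rewrite rnorm_star.
  by rewrite ger0_norm ?divr_ge0 //; lra.
Qed.

Theorem crossed_qdense (sa : bool) : sigma_unital A -> second_countable (T := G) ->
  rokhlin_property alpha -> qdense sa A -> qdense sa B.
Proof.
move=> sA scG rA Q x e sx e0; have [rep _ _] := icp.
have e2 : 0 < e / 2 by rewrite divr_gt0.
have [f [cf sf fx]] := iota_dense sx e2.
(* The final element is within [2 t + 2 t + t] of [iota f]: the kernel error for [d'], the net for
   [f], and the asymptotic error. This is less than [e / 2]. *)
pose t := e / 16; have t0 : 0 < t by rewrite divr_gt0.
have [m [p [d [cp op sd fd]]]] := orthonormal_kernel cptG linv alpha cf t0.
have [C C0 pC] : exists2 C : R, 0 <= C & forall i s, `|p i s| <= C.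
  have ex i : exists C, forall s, `|p i s| <= C.
    have [C HC] := cpt_rnorm_bounded cptG (real_continuousC (cp i)).
    by exists C => s; rewrite -rnorm_real.
  have [Cf HCf] := choice ex.
  exists (\sum_i `|Cf i|); first by apply: sumr_ge0.
  move=> i s; rewrite (le_trans (HCf i s)) // (bigD1 i) //= (le_trans (ler_norm _)) //.
  by rewrite lerDl; apply: sumr_ge0.
have k0 : 0 < m%:R * m%:R * C * C + 1 :> R by rewrite ltr_wpDl // !mulr_ge0.
have e1 : 0 < t / (m%:R * m%:R * C * C + 1) by rewrite divr_gt0.
have [d' [c' [sd' dd' qd1 qd2]]] := matrix_qdense Q e1 (fun sat => sd (sf sat)).
have fd' g s : rnorm (f g - \sum_i \sum_j (p i s * p j (g^-1 * s)%g)%:C *: alpha s (d' i j)) <= 2 * t.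
  rewrite (le_trans (rnorm_tri (\sum_i \sum_j (p i s * p j (g^-1 * s)%g)%:C *: alpha s (d i j)) _ _)) //.
  rewrite mulr_natl mulr2n lerD // -sumrB.
  apply: (@le_trans _ _ (m%:R * (m%:R * (C * C * (t / (m%:R * m%:R * C * C + 1)))))).
    apply: rnorm_sum_ord => i; rewrite -sumrB; apply: rnorm_sum_ord => j.
    rewrite -scalerBr -actB rnormZr rnorm_act normrM.
    apply: ler_pM; [exact: mulr_ge0|exact: rnorm_ge0|apply: ler_pM => //|rewrite rnormC; exact: dd'].
  have -> : m%:R * (m%:R * (C * C * (t / (m%:R * m%:R * C * C + 1)))) =
    (m%:R * m%:R * C * C) * t / (m%:R * m%:R * C * C + 1) by ring.
  rewrite ler_pdivrMr // mulrC ler_pM2l //; lra.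
have [y|ps Hps] := finite_nbhs_cover cptG (U := fun y => [set s | rnorm (f s - f y) < t]).
  by have /rnorm_cvgP/(_ _ t0) := cf y.
(* The finite list of elements that [D] must contain: values of [f] on a net and the entries of the
   quasi-invertible matrix and of its quasi-inverse. *)
pose l := [seq f y | y <- ps] ++ [seq d' z.1 z.2 | z <- enum {: 'I_m * 'I_m}] ++
  [seq c' z.1 z.2 | z <- enum {: 'I_m * 'I_m}].
have [D [q [psi [Dc iD Hq fpsi Hpsi]]]] := rokhlin_data (fun n => nth 0 l n) sA cptG scG rA.
have Dl y : y \in l -> sset D y by move=> /(nth_index 0) <-.
have Df y : y \in ps -> sset D (f y).
  by move=> yps; apply: Dl; rewrite mem_cat map_f.
have Rd i j : Rep D q (Defs.eta (psi (d' i j))) (fun s => alpha s (d' i j)).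
  apply: Hpsi; apply: Dl; rewrite !mem_cat; apply/orP; right; apply/orP; left.
  by apply/mapP; exists (i, j) => //; rewrite mem_enum.
have Rw i j : Rep D q (Defs.eta (psi (c' i j))) (fun s => alpha s (c' i j)).
  apply: Hpsi; apply: Dl; rewrite !mem_cat; apply/orP; right; apply/orP; right.
  by apply/mapP; exists (i, j) => //; rewrite mem_enum.
have [P HP] := choice (fun i => real_CG (cp i)).
pose h : R[i] := (1 / 2)%:C.
(* Symmetrized as for fixed points, now with a transposition, so that the entries form an exactly
   self-adjoint matrix at every index. *)
pose u i j : linf A := if sa then h *: (psi (d' i j) + star (psi (d' j i))) else psi (d' i j).
have uE i j : Defs.eta (u i j) = Defs.eta (psi (d' i j)).
  rewrite /u; case: ifP => // sat; rewrite -etaZ -etaD -etaS.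
  have -> : star (Defs.eta (psi (d' j i))) = Defs.eta (psi (d' i j)); last exact: scale_half.
  have RS : Rep D q (star (Defs.eta (psi (d' j i)))) (fun s => alpha s (d' i j)).
    by apply: (Rep_ext _ (Rep_star Hq (Rd j i))) => s; rewrite -actStar sd'.
  exact: (Rep_uniq cptG Hq RS (Rd i j)).
have fu i j n g : alpha g (val (u i j) n) = val (u i j) n.
  by rewrite /u; case: ifP => // _; rewrite linfZ linfD linfS actZ actD actStar !fpsi.
have su n : sa -> forall i j, star (val (u i j) n) = val (u j i) n.
  move=> sat i j; rewrite /u sat !linfZ !linfD !linfS starZ starD starK addrC; congr (_ *: _).
  exact: conjc_real.
have Ru i j : Rep D q (Defs.eta (u i j)) (fun s => alpha s (d' i j)) by rewrite uE.
pose w i j : linf A := psi (c' i j).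
have fw i j n g : alpha g (val (w i j) n) = val (w i j) n by exact: fpsi.
have [L L0 HL] : exists2 L : R, 0 <= L & forall i j n,
    [/\ rnorm (val (q (P i)) n) <= L, rnorm (val (u i j) n) <= L & rnorm (val (w i j) n) <= L].
  have ex (a : linf A) : exists L, 0 <= L /\ forall n, rnorm (val a n) <= L.
    by have [L L0 HL] := linf_bounded a; exists L.
  have [Lf HLf] := choice ex.
  have Lf0 a : 0 <= Lf a by case: (HLf a).
  pose Li ij := Lf (q (P ij.1)) + Lf (u ij.1 ij.2) + Lf (w ij.1 ij.2).
  have Li0 ij : 0 <= Li ij by rewrite !addr_ge0.
  exists (\sum_ij Li ij); first by apply: sumr_ge0.
  move=> i j n; have LE : Li (i, j) <= \sum_ij Li ij.
    by rewrite (bigD1 (i, j)) //= lerDl; apply: sumr_ge0.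
  have [_ /(_ n) b1] := HLf (q (P i)); have [_ /(_ n) b2] := HLf (u i j).
  have [_ /(_ n) b3] := HLf (w i j).
  have := Lf0 (q (P i)); have := Lf0 (u i j); have := Lf0 (w i j); rewrite /Li /= in LE.
  by move=> ? ? ?; split; lra.
pose K : R := m%:R * m%:R * L * L + m%:R * m%:R * m%:R * m%:R * L * L * L.
have K0 : 0 <= K by rewrite addr_ge0 // !mulr_ge0.
(* [K] is the constant of [rkmx_quasi]; with defects at most [r] both quasi-inverse errors are below
   1. *)
pose r := (2 * (K + 1))^-1; have r0 : 0 < r by rewrite invr_gt0 mulr_gt0 // ltr_wpDl.
have Kr : K * r < 1.
  rewrite /r ltr_pdivrMr ?mul1r; last by rewrite mulr_gt0 // ltr_wpDl.
  lra.
have near_fixE (v : 'I_m -> 'I_m -> linf A) (b : 'I_m -> 'I_m -> A) :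
    (forall i j, Rep D q (Defs.eta (v i j)) (fun s => alpha s (b i j))) ->
    (forall i j n g, alpha g (val (v i j) n) = val (v i j) n) ->
    \forall n \near \oo, forall j k i, rnorm (fixE alpha (star (val (q (P j)) n) **
      (val (q (P k)) n ** val (v k i) n)) - (if j == k then val (v k i) n else 0)) <= r.
  move=> Rv fv; apply: filter_forall => j; apply: filter_forall => k; apply: filter_forall => i.
  have Pjk s : (val (star (P j)) s : R[i]) * (val (P k) s : R[i]) = (p j s * p k s)%:C.
    by rewrite CG_starE !HP rmorphM; congr (_ * _); exact: conjc_real.
  (* Orthonormality enters here: the mean of [p j * p k] is the Kronecker symbol. *)
  have := lmean_int cptG linv (mulr_continuous (cp j) (cp k)); rewrite op => mjk.
  have := fixE_near_seq cptG iD Hq Pjk mjk (Rv k i) (fv k i) r0.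
  apply: filterS => n; case: eqP => _; first by rewrite scale1r.
  by rewrite scale0r.
have near_qinv (v v' : 'I_m -> 'I_m -> linf A) (b b' : 'I_m -> 'I_m -> A) :
    (forall i j, Rep D q (Defs.eta (v i j)) (fun s => alpha s (b i j))) ->
    (forall i j, Rep D q (Defs.eta (v' i j)) (fun s => alpha s (b' i j))) ->
    (forall i j, b i j + b' i j + \sum_k b i k ** b' k j = 0) ->
    \forall n \near \oo, forall i j,
      rnorm (val (v i j) n + val (v' i j) n + \sum_k val (v i k) n ** val (v' k j) n) <= r.
  move=> Rv Rv' Hb; apply: filter_forall => i; apply: filter_forall => j.
  pose X : linf A := v i j + v' i j + \sum_k v i k ** v' k j.
  have X0 : Defs.eta X = 0.
    apply: (Rep_uniq cptG Hq (K := fun=> 0)); last exact/Rep_Tens/Tens0.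
    rewrite /X -!etaD -eta_sum.
    have Rs : Rep D q (\sum_k Defs.eta (v i k ** v' k j)) (fun s => \sum_k alpha s (b i k) ** alpha s (b' k j)).
      by apply: Rep_sum => k; rewrite -etaM; exact: (RepM cptG Hq).
    apply: (Rep_ext _ (RepD (RepD (Rv i j) (Rv' i j)) Rs)) => s.
    have -> : \sum_k alpha s (b i k) ** alpha s (b' k j) = alpha s (\sum_k b i k ** b' k j).
      rewrite (big_morph (alpha s) (actD alpha s) (act0 alpha s)); apply: eq_bigr => k _.
      by rewrite actMul.
    by rewrite -!actD Hb act0.
  have /eta_eq0P/rnorm_cvgP/(_ _ r0) := X0; apply: filterS => n.
  by rewrite subr0 /X !linfD linf_sum => /ltW.
have N1 := near_fixE _ _ Rw fw.
have N2 := near_fixE _ _ Ru fu.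
have N3 := near_qinv _ _ _ _ Ru Rw qd1.
have qd2' i j : c' i j + d' i j + \sum_k c' i k ** d' k j = 0 by rewrite [c' i j + _]addrC.
have N4 := near_qinv _ _ _ _ Rw Ru qd2'.
have fps s : exists2 y, y \in ps & rnorm (f s - f y) <= t.
  by have [y yps /ltW] := Hps s; exists y.
have N5 := kernel_uniform cptG iD Hq HP Ru cf Df fps fd' t0.
(* All asymptotic estimates are evaluated at one common index, after which only elements of [A] and
   [B] remain. *)
have [n [[[[M1 M2] M3] M4] M5]] := @filter_ex _ _ (eventually_filter) _ (filterI (filterI (filterI (filterI N1 N2) N3) N4) N5).
pose xn i := val (q (P i)) n.
pose Y := rkmx alpha iota xn (fun i j => val (u i j) n).
pose Z := rkmx alpha iota xn (fun i j => val (w i j) n).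
have xL i : rnorm (xn i) <= L by case: (HL i i n).
have H1 : rnorm (Y + Z + Y ** Z) < 1.
  apply: le_lt_trans Kr; apply: (rkmx_quasi cptG linv rep L0 (ltW r0) xL) => //.
  by move=> i j; case: (HL i j n).
have H2 : rnorm (Y + Z + Z ** Y) < 1.
  rewrite [Y + Z]addrC; apply: le_lt_trans Kr.
  apply: (rkmx_quasi cptG linv rep L0 (ltW r0) xL) => //.
  by move=> i j; case: (HL i j n).
have [c qc] := approx_qinv H1 H2.
exists Y, c; split=> //.
- by move=> sat; apply: (rkmx_star rep) => [i j g|i j]; [exact: fu|exact: su].
- have Yf : rnorm (Y - iota f) <= 2 * t + 2 * t + t.
    by apply: (rkmx_close cptG rep).
  rewrite (le_lt_trans (rnorm_tri (iota f) _ _)) // [rnorm (x - _)]rnormC [rnorm (_ - Y)]rnormC.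
  by move: fx Yf; rewrite /t; lra.
Qed.
End CrossedProduct.

Theorem proposition4p13 (R : realType) (A : cstarAlgType R) (G : topologicalGroupType)
    (alpha : cstarAction G A) :
  sigma_unital A ->
  compact [set: G] -> hausdorff_space G -> second_countable (T := G) ->
  rokhlin_property alpha ->
  (real_rank_zero A ->
     real_rank_zero (subalg_type (fixed_algebra alpha)) /\
     forall (mu : probability (g_sigma_algebraType (@open G)) R)
       (B : cstarAlgType R) (iota : (G -> A) -> B),
       left_invariant mu -> is_crossed_product mu alpha iota -> real_rank_zero B) /\
  (stable_rank_one A ->
     stable_rank_one (subalg_type (fixed_algebra alpha)) /\
     forall (mu : probability (g_sigma_algebraType (@open G)) R)
       (B : cstarAlgType R) (iota : (G -> A) -> B),
       left_invariant mu -> is_crossed_product mu alpha iota -> stable_rank_one B).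
Proof.
move=> sA cptG _ scG rA.
have H sa : qdense sa A -> rank_prop sa (subalg_type (fixed_algebra alpha)) /\
    forall (mu : probability (g_sigma_algebraType (@open G)) R)
      (B : cstarAlgType R) (iota : (G -> A) -> B),
      left_invariant mu -> is_crossed_product mu alpha iota -> rank_prop sa B.
  move=> Q; split=> [|mu B iota linv icp]; apply: qdense_rank.
  - by move=> a b; exact: (normM_le (val a) (val b)).
  - exact: fixed_qdense.
  - exact: normM_le.
  - exact: (crossed_qdense cptG linv icp).
split=> [/rr0_rank|/sr1_rank] /rank_qdense /H[H1 H2].
  by split=> [|mu B iota linv icp]; apply/rr0_rank => //; exact: (H2 mu B iota).
by split=> [|mu B iota linv icp]; apply/sr1_rank => //; exact: (H2 mu B iota).
Qed.
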